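(* Let $d\ge 2$ and $T>0$. Let $B$ be a collision kernel of the form $B(|v-v_*|,\theta)\sin^{d-2}\theta=\Phi(|v-v_*|)\,\beta(d\theta)$, for some function $\Phi:\mathbb{R}_+\to\mathbb{R}_+$ and some nonnegative measure $\beta$ on $(0,\pi]$ such that $\kappa_1:=\int_0^\pi\theta\,\beta(d\theta)<+\infty$. Let $f=(f_t)_{t\in[0,T]}$ and $\tilde f=(\tilde f_t)_{t\in[0,T]}$ be two weak solutions of the Boltzmann equation with kernel $B$, lying in $L^\infty([0,T],\mathcal{P}_1(\mathbb{R}^d))$ and satisfying $$\int_0^T dt\int_{\mathbb{R}^d\times\mathbb{R}^d}\big[f_t(dv)f_t(dv_* )+\tilde f_t(dv)\tilde f_t(dv_* )\big](1+|v|)\,\Phi(|v-v_*|)<+\infty.$$ For $s\in[0,T]$, let $R_s\in\mathcal{H}(f_s,\tilde f_s)$ be such that $d_1(f_s,\tilde f_s)=\int_{\mathbb{R}^d\times\mathbb{R}^d}|v-\tilde v|\,R_s(dv,d\tilde v)$. Then for all $t\in[0,T]$, $$\begin{aligned} d_1(f_t,\tilde f_t)\le\ & d_1(f_0,\tilde f_0)+\kappa_1\frac{|\mathbb{S}^{d-2}|}{2}\int_0^t ds\int_{\mathbb{R}^d\times\mathbb{R}^d}R_s(dv,d\tilde v)\int_{\mathbb{R}^d\times\mathbb{R}^d}R_s(dv_*,d\tilde v_* )\\ &\times\Big[8\big(\Phi(|v-v_*|)\wedge\Phi(|\tilde v-\tilde v_*|)\big)|v-\tilde v|\\ &\quad+\big(\Phi(|v-v_*|)-\Phi(|\tilde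 v-\tilde v_*|)\big)_+|v-v_*|\\ &\quad+\big(\Phi(|\tilde v-\tilde v_*|)-\Phi(|v-v_*|)\big)_+|\tilde v-\tilde v_*|\Big].\end{aligned}$$
   Context: Notation. $x\wedge y=\min\{x,y\}$, $x_+=\max\{x,0\}$. $\mathbb{S}^{d-2}$ is the unit sphere of $\mathbb{R}^{d-1}$ with surface measure $d\xi$ and total mass $|\mathbb{S}^{d-2}|$; for $d=2$, $\mathbb{S}^0=\{-1,+1\}$. $\mathrm{Lip}(\mathbb{R}^d)$ is the set of globally Lipschitz functions $\mathbb{R}^d\to\mathbb{R}$. $\mathcal{P}_1(\mathbb{R}^d)$ is the set of probability measures $f$ on $\mathbb{R}^d$ with $m_1(f):=\int_{\mathbb{R}^d}|v|f(dv)<\infty$. $L^\infty([0,T],\mathcal{P}_1(\mathbb{R}^d))$ is the set of measurable families $(f_t)_{t\in[0,T]}$ of probability measures on $\mathbb{R}^d$ with $\sup_{[0,T]}m_1(f_t)<\infty$. For $g,\tilde g\in\mathcal{P}_1(\mathbb{R}^d)$, $\mathcal{H}(g,\tilde g)$ is the set of probability measures on $\mathbb{R}^d\times\mathbb{R}^d$ with first marginal $g$ and second marginal $\tilde g$, and $d_1(g,\tilde g)=\min\{\int_{\mathbb{R}^d\times\mathbb{R}^d}|v-\tilde v|\,G(dv,d\tilde v):G\in\mathcal{H}(g,\tilde g)\}$ (Kantorovich-Rubinstein distance; the infimum is attained). Post-collisional velocity: for $v,v_*\in\mathbb{R}^d$ and $\sigma\in\mathbb{S}^{d-1}$, $v'=\frac{v+v_*}{2}+\frac{|v-v_*|}{2}\sigma$,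 where $\sigma=(\cos\theta,\sin\theta\,\xi)$ with $\theta\in[0,\pi]$, $\xi\in\mathbb{S}^{d-2}$, in some orthonormal basis of $\mathbb{R}^d$ with first vector $(v-v_* )/|v-v_*|$. Weak solution: a family $f=(f_t)_{t\in[0,T]}\in L^\infty([0,T],\mathcal{P}_1(\mathbb{R}^d))$ is a weak solution of the Boltzmann equation with kernel $B$ if $$\int_0^T dt\int_{\mathbb{R}^d}f_t(dv)\int_{\mathbb{R}^d}f_t(dv_* )\,\Phi(|v-v_*|)\,|v-v_*|<+\infty$$ and if for any $\varphi\in\mathrm{Lip}(\mathbb{R}^d)$ and any $t\in[0,T]$, $$\frac{d}{dt}\int_{\mathbb{R}^d}\varphi(v)f_t(dv)=\int_{\mathbb{R}^d}f_t(dv)\int_{\mathbb{R}^d}f_t(dv_* )\,A[\varphi](v,v_* ),\qquad A[\varphi](v,v_* )=\Phi(|v-v_*|)\int_0^\pi\beta(d\theta)\int_{\mathbb{S}^{d-2}}[\varphi(v')-\varphi(v)]\,d\xi.$$ *)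

(* Defs.v *)
From HB Require Import structures.
From mathcomp Require Import all_boot all_order all_algebra.
From mathcomp Require Import all_classical all_reals all_analysis.
From mathcomp Require Import measurable_realfun.

Set Implicit Arguments.
Unset Strict Implicit.
Unset Printing Implicit Defensive.
Import Order.TTheory GRing.Theory Num.Theory.
Import numFieldNormedType.Exports.

Local Open Scope classical_set_scope.
Local Open Scope ring_scope.

(* The sigma-algebra on row vectors is the product of the Borel sigma-algebras
   of the coordinates, i.e. the Borel sigma-algebra of R^n. *)
Definition measure_rV_display : measure_display -> measure_display.
Proof. exact. Qed.

Section measurable_rV.
Context {R : realType}.
Variable n : nat.

Let coords : 'I_n -> 'rV[R]_n -> R := fun i v => v ord0 i.

Let rV_set0 : g_sigma_preimage coords set0.
Proof. exact: sigma_algebra0. Qed.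

Let rV_setC A : g_sigma_preimage coords A -> g_sigma_preimage coords (~` A).
Proof. exact: sigma_algebraC. Qed.

Let rV_bigcup (F : (set 'rV[R]_n)^nat) :
  (forall i, g_sigma_preimage coords (F i)) ->
  g_sigma_preimage coords (\bigcup_i (F i)).
Proof. exact: sigma_algebra_bigcup. Qed.

HB.instance Definition _ :=
  @isMeasurable.Build (measure_rV_display default_measure_display)
    'rV[R]_n (g_sigma_preimage coords) rV_set0 rV_setC rV_bigcup.

Lemma measurable_coord (i : 'I_n) :
  measurable_fun [set: 'rV[R]_n] (fun v : 'rV[R]_n => v ord0 i).
Proof.
move=> _ Y mY; rewrite setTI; apply: sub_sigma_algebra => /=.
rewrite -bigcup_seq/=; exists i => /=; first by rewrite mem_index_enum.
by exists Y => //; rewrite setTI.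
Qed.

Lemma measurable_fun_rV d (X : measurableType d) (f : X -> 'rV[R]_n) :
  (forall i, measurable_fun [set: X] (fun x => f x ord0 i)) ->
  measurable_fun [set: X] f.
Proof.
move=> mf _ A mA; rewrite setTI.
have sub : <<s \big[setU/set0]_(i < n)
      preimage_set_system setT (coords i) measurable >> `<=`
    [set B | measurable (f @^-1` B)].
  apply: smallest_sub.
    split => /=.
    - by rewrite preimage_set0; exact: measurable0.
    - move=> B mB; rewrite setTD preimage_setC; exact: measurableC.
    - by move=> F mF; rewrite preimage_bigcup; exact: bigcupT_measurable.
  rewrite -bigcup_seq => B [i _ [Y mY <-]] /=.
  rewrite setTI -[X in measurable X]setTI.
  exact: mf.
exact: sub.
Qed.

End measurable_rV.

Section euclidean.
Context {R : realType}.

(* The library norm of 'rV[R]_n is the sup norm. *)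
Definition enorm n (v : 'rV[R]_n) : R := Num.sqrt (\sum_(i < n) v ord0 i ^+ 2).

Lemma measurable_enorm n : measurable_fun [set: 'rV[R]_n] (@enorm n).
Proof.
apply: (@measurableT_comp _ _ _ _ _ _ (@Num.sqrt R)) => /=.
  by apply: continuous_measurable_fun; exact: sqrt_continuous.
apply: measurable_sum => i.
by apply: measurable_funX; exact: measurable_coord.
Qed.

Definition rV_cons n (p : measurableTypeR R * 'rV[R]_n) : 'rV[R]_n.+1 :=
  \row_i oapp (fun j => p.2 ord0 j) p.1 (unlift ord0 i).

Definition rV_uncons n (v : 'rV[R]_n.+1) : measurableTypeR R * 'rV[R]_n :=
  (v ord0 ord0, \row_j v ord0 (lift ord0 j)).

Lemma rV_consK n : cancel (@rV_cons n) (@rV_uncons n).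
Proof.
move=> [x v]; congr pair; first by rewrite mxE unlift_none.
by apply/rowP => j; rewrite !mxE liftK.
Qed.

Lemma measurable_rV_cons n :
  measurable_fun [set: measurableTypeR R * 'rV[R]_n] (@rV_cons n).
Proof.
apply: measurable_fun_rV => i.
under eq_fun do rewrite mxE.
case: unliftP => [j _|_] /=; last exact: measurable_fst.
exact: (measurableT_comp (measurable_coord j) measurable_snd).
Qed.

Lemma measurable_rV_uncons n :
  measurable_fun [set: 'rV[R]_n.+1] (@rV_uncons n).
Proof.
apply/measurable_fun_pairP; split; first exact: measurable_coord.
apply: measurable_fun_rV => i /=.
under eq_fun do rewrite mxE.
exact: measurable_coord.
Qed.

End euclidean.

Section lebesgue_rV.
Context {R : realType}.

Section step.
Variables (n : nat) (m : {sigma_finite_measure set 'rV[R]_n -> \bar R}).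

Definition lebesgue_step : set 'rV[R]_n.+1 -> \bar R :=
  pushforward (lebesgue_measure \x m)%E (@rV_cons R n).

Let mu : {measure set 'rV[R]_n.+1 -> \bar R} :=
  measure_function_pushforward__canonical__measure_function_Measure
    (lebesgue_measure \x m)%E (@measurable_rV_cons R n).

Let step0 : lebesgue_step set0 = 0%E.
Proof. exact: (measure0 mu). Qed.

Let step_ge0 A : (0 <= lebesgue_step A)%E.
Proof. exact: (measure_ge0 mu). Qed.

Let step_sigma_additive : semi_sigma_additive lebesgue_step.
Proof. exact: (@measure_semi_sigma_additive _ _ _ mu). Qed.

HB.instance Definition _ := isMeasure.Build _ _ _ lebesgue_step
  step0 step_ge0 step_sigma_additive.

Let step_sigma_finite : sigma_finite setT lebesgue_step.
Proof.
have /sigma_finiteP[F [FT ndF Foo]] := sigma_finiteT (@lebesgue_measure R).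
have /sigma_finiteP[E [ET ndE Eoo]] := sigma_finiteT m.
exists (fun i => @rV_uncons R n @^-1` (F i `*` E i)) => [|i].
  rewrite -preimage_bigcup -[LHS](preimage_setT (@rV_uncons R n)).
  congr (_ @^-1` _); apply/esym; rewrite -subTset => -[x y] _.
  have [j _ Fx] : (\bigcup_i F i) x by rewrite -FT.
  have [k _ Ey] : (\bigcup_i E i) y by rewrite -ET.
  exists (maxn j k) => //; split => /=.
  - by move: x Fx; exact/subsetPset/ndF/leq_maxl.
  - by move: y Ey; exact/subsetPset/ndE/leq_maxr.
have [mF Fioo] := Foo i; have [mE Eioo] := Eoo i; split.
  rewrite -[X in measurable X]setTI.
  by apply: measurable_rV_uncons => //; exact: measurableX.
rewrite /lebesgue_step /pushforward -comp_preimage.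
rewrite (_ : _ \o _ = id); last first.
  by apply/funext => x /=; rewrite rV_consK.
rewrite preimage_id product_measure1E// lte_mul_pinfty//.
by rewrite ge0_fin_numE.
Qed.

HB.instance Definition _ := Measure_isSigmaFinite.Build _ _ _ lebesgue_step
  step_sigma_finite.

End step.

(* Lebesgue measure on R^n. *)
Fixpoint lebesgue_rV (n : nat) :
    {sigma_finite_measure set 'rV[R]_n -> \bar R} :=
  match n with
  | 0%N => \d_(0 : 'rV[R]_0)
  | n'.+1 => lebesgue_step (lebesgue_rV n')
  end.

End lebesgue_rV.

Section surface.
Context {R : realType}.
Variable n : nat.

Definition pointed_ball : set 'rV[R]_n := [set x | 0 < enorm x <= 1].

Definition normalize (x : 'rV[R]_n) : 'rV[R]_n := (enorm x)^-1 *: x.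

Lemma measurable_pointed_ball : measurable pointed_ball.
Proof.
rewrite (_ : pointed_ball = @enorm R n @^-1` `]0, 1]).
  by rewrite -[X in measurable X]setTI; exact: measurable_enorm.
by apply/seteqP; split => x /=; rewrite in_itv.
Qed.

Lemma measurable_normalize : measurable_fun [set: 'rV[R]_n] normalize.
Proof.
apply: measurable_fun_rV => i.
under eq_fun do rewrite mxE.
apply: measurable_funM; last exact: measurable_coord.
under eq_fun do rewrite -powR_inv1 ?sqrtr_ge0//.
apply: (@measurableT_comp _ _ _ _ _ _ (fun r => r `^ (- 1))) => /=.
  exact: measurable_powR.
exact: measurable_enorm.
Qed.

(* The surface measure of the unit sphere S^(n-1) of R^n, as a measure on R^n
   carried by the sphere, for n >= 1: the surface area of A is n times the
   Lebesgue measure of the cone {x | 0 < |x| <= 1, x / |x| \in A}.  For n = 1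
   this is the counting measure on {-1, +1}. *)
Definition surface_measure : set 'rV[R]_n -> \bar R :=
  pushforward (mscale (n%:R)%:nng (mrestr (lebesgue_rV n) measurable_pointed_ball))
    normalize.

Let mu : {measure set 'rV[R]_n -> \bar R} :=
  measure_function_pushforward__canonical__measure_function_Measure
    (mscale (n%:R)%:nng (mrestr (lebesgue_rV n) measurable_pointed_ball))
    measurable_normalize.

Let surface0 : surface_measure set0 = 0%E.
Proof. exact: (measure0 mu). Qed.

Let surface_ge0 A : (0 <= surface_measure A)%E.
Proof. exact: (measure_ge0 mu). Qed.

Let surface_sigma_additive : semi_sigma_additive surface_measure.
Proof. exact: (@measure_semi_sigma_additive _ _ _ mu). Qed.

HB.instance Definition _ := isMeasure.Build _ _ _ surface_measure
  surface0 surface_ge0 surface_sigma_additive.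

End surface.
Arguments surface_measure {R} n _.

Section wasserstein.
Context {R : realType} {d : nat}.
Local Open Scope ereal_scope.
Implicit Types g h : probability 'rV[R]_d R.

Definition m1 g : \bar R := \int[g]_v (enorm v)%:E.

Definition coupling g h : set (probability ('rV[R]_d * 'rV[R]_d)%type R) :=
  [set G | forall A : set 'rV[R]_d, measurable A ->
    pushforward G fst A = g A /\ pushforward G snd A = h A].

Definition d1 g h : \bar R :=
  ereal_inf [set \int[G]_x (enorm (x.1 - x.2)%R)%:E | G in coupling g h].

End wasserstein.

Section boltzmann.
Context {R : realType} {d : nat}.
Implicit Types (v w e : 'rV[R]_d) (phi : 'rV[R]_d -> R) (Phi : R -> R).

Definition Lip phi : Prop :=
  exists L : R, forall v w, `|phi v - phi w| <= L * enorm (v - w).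

(* The rows of O complete the unit vector e into an orthonormal basis. *)
Definition completes_to_orthonormal_basis e (O : 'M[R]_(d.-1, d)) : Prop :=
  O *m O^T = 1%:M /\ O *m e^T = 0.

(* A chosen completion; integrals against the rotation-invariant measure
   [surface_measure] do not depend on the choice. *)
Definition frame e : 'M[R]_(d.-1, d) :=
  xget 0 [set O | completes_to_orthonormal_basis e O].

(* sigma = (cos theta, sin theta xi) in the basis (e, frame e). *)
Definition scatter e (theta : R) (xi : 'rV[R]_d.-1) : 'rV[R]_d :=
  cos theta *: e + sin theta *: (xi *m frame e).

(* For v = w the direction is the junk vector 0, but then the second summand
   vanishes. *)
Definition post_velocity v w (theta : R) (xi : 'rV[R]_d.-1) : 'rV[R]_d :=
  2^-1 *: (v + w)
  + (enorm (v - w) / 2) *: scatter (normalize (v - w)) theta xi.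

Local Open Scope ereal_scope.

Definition collision_op Phi (beta : {measure set R -> \bar R}) phi v w : \bar R :=
  (Phi (enorm (v - w)))%:E *
  \int[beta]_(theta in `]0%R, pi])
    \int[surface_measure d.-1]_xi (phi (post_velocity v w theta xi) - phi v)%:E.

Definition kappa1 (beta : {measure set R -> \bar R}) : \bar R :=
  \int[beta]_(theta in `]0%R, pi]) theta%:E.

(* L^oo([0,T], P_1(R^d)), with a genuine supremum over [0,T]. *)
Definition Linfty_P1 (T : R) (f : R -> probability 'rV[R]_d R) : Prop :=
  (forall A : set 'rV[R]_d, measurable A ->
     measurable_fun `[0%R, T] (fun t => f t A)) /\
  ereal_sup [set m1 (f t) | t in `[0%R, T]] < +oo.

(* The derivative at t is taken within [0,T], hence is one-sided at 0 and T. *)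
Definition weak_solution (T : R) Phi (beta : {measure set R -> \bar R})
    (f : R -> probability 'rV[R]_d R) : Prop :=
  [/\ Linfty_P1 T f,
      \int[lebesgue_measure]_(t in `[0%R, T]) \int[f t]_v \int[f t]_w
        (Phi (enorm (v - w)) * enorm (v - w))%:E < +oo
    & forall phi, Lip phi -> forall t, t \in `[0%R, T] ->
        exists2 l : R,
          l%:E = \int[f t]_v \int[f t]_w collision_op Phi beta phi v w
        & ((\int[f s]_v phi v - \int[f t]_v phi v) / (s - t))%R
            @[s --> within `[0%R, T] t^'] --> l].

End boltzmann.

(* Main.v *)
Require Import Defs.
From HB Require Import structures.
From mathcomp Require Import all_boot all_order all_algebra.
From mathcomp Require Import all_classical all_reals all_analysis.
From mathcomp Require Import ring lra measurable_realfun.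

Set Implicit Arguments.
Unset Strict Implicit.
Unset Printing Implicit Defensive.
Import Order.TTheory GRing.Theory Num.Theory.
Import numFieldNormedType.Exports.

(** By Kantorovich duality the distance between [f t] and [ft t] is the difference
    of the means of some 1-Lipschitz function [phi], chosen at the time [t], while
    at any other time the difference of the means of [phi] is at most the distance.
    The left derivative of the distance at [t] is therefore at most the difference
    of the derivatives of the two means, which the weak equation expresses through
    the collision operator applied to [phi] ([left_dini_potential]).  The potential
    comes from the optimal coupling [G t] itself: its support is cyclically
    monotone ([support_monotone]), and Rockafellar's construction
    ([potential_of_monotone]) gives [phi v - phi v~ = |v - v~|] for [G t]-almost
    all pairs [(v, v~)].

    The two collision terms are compared under the product of [G t] with itself
    ([generator_sub_le]), for a pair [(v, v~)] colliding with a pair [(w, w~)].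
    The excess of one collision rate over the other is charged with the size of a
    displacement, which is at most [theta / 2] times the relative velocity
    ([abs_deviation]).  On the common part of the rates both pairs collide
    together, with the same [theta] and with azimuths matched by Tanaka's isometry
    ([tanaka_coupling]), so that the two displacements differ by at most
    [theta |(v - w) - (v~ - w~)|] ([displacement_coupling]).  Then the increment of
    [phi v - phi v~ = |v - v~|] is at most
    [|v' - v~'| - |v - v~| <= theta (|v - v~| + |w - w~|)]: the terms of order one
    cancel, and the first moment of [beta] suffices ([deviation_sub_le]).  The matching of azimuths is legitimate because the
    surface measure is invariant under orthogonal maps, which goes back to the
    invariance of Lebesgue measure ([lebesgue_rV_orth]).  Exchanging the two pairs
    turns [|w - w~|] into [|v - v~|], and the resulting weight 4 is below the 8 of
    the theorem.

    It remains to integrate in time.  The distance is continuous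
    ([continuous_clamped_distance]), and a continuous function whose left
    derivative is finite at every time grows by at most the integral of the
    positive part of this derivative ([growth_le_integral_dini], by way of the
    Vitali-Caratheodory theorem).  At almost every time that positive part is at
    most the integrand of the theorem.  The latter may fail to be measurable in
    time, but it suffices that it has a measurable minorant
    ([ge0_le_lower_integral]). *)

Local Open Scope classical_set_scope.
Local Open Scope ring_scope.

(** * Euclidean geometry of row vectors *)

Section dot.
Context {R : realType} {n : nat}.
Implicit Types (u v w : 'rV[R]_n).

Definition dot u v : R := \sum_(i < n) u ord0 i * v ord0 i.

Lemma dotC u v : dot u v = dot v u.
Proof. by apply: eq_bigr => i _; rewrite mulrC. Qed.

Lemma dotDl u v w : dot (u + v) w = dot u w + dot v w.
Proof. by rewrite -big_split /=; apply: eq_bigr => i _; rewrite mxE mulrDl. Qed.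

Lemma dotZl a u w : dot (a *: u) w = a * dot u w.
Proof. by rewrite /dot mulr_sumr; apply: eq_bigr => i _; rewrite mxE mulrA. Qed.

Lemma dotDr u v w : dot w (u + v) = dot w u + dot w v.
Proof. by rewrite dotC dotDl dotC (dotC v). Qed.

Lemma dotZr a u w : dot w (a *: u) = a * dot w u.
Proof. by rewrite dotC dotZl dotC. Qed.

Lemma dotNl u w : dot (- u) w = - dot u w.
Proof. by rewrite -scaleN1r dotZl mulN1r. Qed.

Lemma dotNr u w : dot w (- u) = - dot w u.
Proof. by rewrite dotC dotNl dotC. Qed.

Definition dotE := (dotDl, dotDr, dotNl, dotNr, dotZl, dotZr).

Lemma dot_mx u v : u *m v^T = (dot u v)%:M.
Proof.
apply/matrixP => i j; rewrite !ord1 !mxE eqxx mulr1n.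
by apply: eq_bigr => k _; rewrite !mxE.
Qed.

Lemma dot_ge0 u : 0 <= dot u u.
Proof. by apply: sumr_ge0 => i _; rewrite -expr2 sqr_ge0. Qed.

Lemma dot_eq0 u : (dot u u == 0) = (u == 0).
Proof.
apply/idP/eqP => [|->]; last by rewrite /dot big1// => i _; rewrite mxE mul0r.
rewrite psumr_eq0; last by move=> i _; rewrite -expr2 sqr_ge0.
move=> /allP h; apply/rowP => i; rewrite mxE.
have := h i (mem_index_enum _) => /implyP/(_ isT).
by rewrite mulf_eq0 orbb => /eqP.
Qed.

Lemma enormE u : enorm u = Num.sqrt (dot u u).
Proof. by []. Qed.

Lemma enorm_ge0 u : 0 <= enorm u.
Proof. exact: sqrtr_ge0. Qed.

Lemma sqr_enorm u : enorm u ^+ 2 = dot u u.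
Proof. by rewrite enormE sqr_sqrtr// dot_ge0. Qed.

Lemma enorm_eq0 u : (enorm u == 0) = (u == 0).
Proof. by rewrite -dot_eq0 -sqr_enorm sqrf_eq0. Qed.

Lemma enorm0 : enorm (0 : 'rV[R]_n) = 0.
Proof. by apply/eqP; rewrite enorm_eq0. Qed.

Lemma enormZ a u : enorm (a *: u) = `|a| * enorm u.
Proof.
apply/eqP; rewrite -(@eqrXn2 _ 2)// ?mulr_ge0 ?enorm_ge0//.
by rewrite exprMn !sqr_enorm !dotE mulrA -expr2 real_normK// num_real.
Qed.

Lemma enormN u : enorm (- u) = enorm u.
Proof. by rewrite -scaleN1r enormZ normrN1 mul1r. Qed.

Lemma enormBC u v : enorm (u - v) = enorm (v - u).
Proof. by rewrite -enormN opprB. Qed.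

Lemma enorm_le u (c : R) : 0 <= c -> dot u u <= c ^+ 2 -> enorm u <= c.
Proof. by move=> c0; rewrite -sqr_enorm ler_pXn2r// ?nnegrE ?enorm_ge0. Qed.

Lemma dot_le_enorm u v : dot u v <= enorm u * enorm v.
Proof.
have [->|v0] := eqVneq v 0.
  by rewrite enorm0 mulr0 /dot big1// => i _; rewrite mxE mulr0.
have nv : 0 < enorm v by rewrite lt_neqAle eq_sym enorm_eq0 v0 enorm_ge0.
have [|uv0] := ltP (dot u v) 0; first by move=> /ltW/le_trans; apply; rewrite mulr_ge0 ?enorm_ge0.
rewrite -(@ler_pXn2r _ 2)// ?nnegrE ?mulr_ge0 ?enorm_ge0// exprMn.
have := dot_ge0 ((enorm v ^+ 2) *: u - dot u v *: v).
rewrite !dotE -!sqr_enorm (dotC v u).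
set a := enorm u; set b := enorm v; set c := dot u v => h.
have {}h : 0 <= b ^+ 2 * (a ^+ 2 * b ^+ 2 - c ^+ 2).
  by apply: le_trans h _; rewrite le_eqVlt; apply/orP; left; apply/eqP; ring.
by rewrite pmulr_rge0 ?exprn_gt0// subr_ge0 in h.
Qed.

Lemma ler_enormD u v : enorm (u + v) <= enorm u + enorm v.
Proof.
apply: enorm_le; first by rewrite addr_ge0 ?enorm_ge0.
rewrite !dotE (dotC v u) -!sqr_enorm.
have := dot_le_enorm u v; nra.
Qed.

Lemma ler_enormB u v : enorm (u - v) <= enorm u + enorm v.
Proof. by rewrite -(enormN v) ler_enormD. Qed.

Lemma ler_enorm_tri w u v : enorm (u - v) <= enorm (u - w) + enorm (w - v).
Proof. by rewrite (le_trans _ (ler_enormD _ _))// addrA subrK. Qed.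

Lemma abs_coord_le u i : `|u ord0 i| <= enorm u.
Proof.
rewrite -(@ler_pXn2r _ 2)// ?nnegrE ?enorm_ge0//.
rewrite sqr_enorm real_normK ?num_real// /dot (bigD1 i)//= -expr2 lerDl.
by apply: sumr_ge0 => j _; rewrite -expr2 sqr_ge0.
Qed.

Lemma enorm_normalize u : u != 0 -> enorm (normalize u) = 1.
Proof.
move=> u0; rewrite enormZ ger0_norm ?invr_ge0 ?enorm_ge0// mulVf//.
by rewrite enorm_eq0.
Qed.

Lemma enorm_scale_normalize u : enorm u *: normalize u = u.
Proof.
have [->|u0] := eqVneq u 0; first by rewrite enorm0 scale0r.
by rewrite scalerA divff ?scale1r// enorm_eq0.
Qed.

End dot.

Section dot_mul.
Context {R : realType}.

Lemma dot_mulmx n m (u : 'rV[R]_n) (A : 'M[R]_(n, m)) v :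
  dot (u *m A) v = dot u (v *m A^T).
Proof.
have := dot_mx (u *m A) v; rewrite -mulmxA -[A in A *m v^T]trmxK -trmx_mul dot_mx.
by move/matrixP/(_ 0 0); rewrite !mxE eqxx !mulr1n => ->.
Qed.

Lemma enorm_mulmx_orth n m (u : 'rV[R]_n) (A : 'M[R]_(n, m)) :
  A *m A^T = 1%:M -> enorm (u *m A) = enorm u.
Proof. by move=> hA; rewrite !enormE dot_mulmx -mulmxA hA mulmx1. Qed.

Lemma enorm_le_sum n (u : 'rV[R]_n) : enorm u <= \sum_i `|u ord0 i|.
Proof.
apply: enorm_le; first by apply: sumr_ge0.
rewrite expr2 mulr_suml; apply: ler_sum => i _.
rewrite -expr2 -[leLHS]real_normK ?num_real// expr2 ler_wpM2l//.
by rewrite (bigD1 i)//= lerDl sumr_ge0.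
Qed.

Lemma enorm_le_coord n (u : 'rV[R]_n) (c : R) : 0 < c ->
  (forall i, `|u ord0 i| < c) -> enorm u <= n%:R * c.
Proof.
move=> c0 h; apply: (le_trans (enorm_le_sum _)).
rewrite mulr_natl -[n in leRHS]card_ord -sumr_const.
by apply: ler_sum => i _; apply: ltW.
Qed.

End dot_mul.

Section rotation.
Context {R : realType} {n : nat}.
Implicit Types (e f u v : 'rV[R]_n).

(** For unit vectors that are not opposite this is the rotation of the plane of
    [e] and [f] that takes [e] to [f], and the identity on the orthogonal
    complement of that plane. *)
Definition plane_rotation e f : 'M[R]_n :=
  1%:M - (1 + dot e f)^-1 *: ((e + f)^T *m (e + f)) + 2 *: (e^T *m f).

Lemma mul_plane_rotation u e f : u *m plane_rotation e f =
  u - ((1 + dot e f)^-1 * dot u (e + f)) *: (e + f) + (2 * dot u e) *: f.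
Proof.
rewrite /plane_rotation mulmxDr mulmxBr mulmx1 -!scalemxAr !mulmxA !dot_mx.
by rewrite !mul_scalar_mx !scalerA.
Qed.

Lemma plane_rotation_isometry e f u v : dot e e = 1 -> dot f f = 1 ->
  1 + dot e f != 0 ->
  dot (u *m plane_rotation e f) (v *m plane_rotation e f) = dot u v.
Proof.
move=> e1 f1 c0; rewrite !mul_plane_rotation !dotE (dotC f e) e1 f1.
rewrite (dotC e v) (dotC f v).
by field.
Qed.

Lemma orthogonal_mxP (M : 'M[R]_n) : (forall u v, dot (u *m M) (v *m M) = dot u v) ->
  M *m M^T = 1%:M.
Proof.
move=> h; apply/matrixP => i j.
have := h (delta_mx 0 j) (delta_mx 0 i); rewrite dot_mulmx -mulmxA.
rewrite /dot (bigD1 j)//= big1 ?addr0 => [|k kj]; last first.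
  by rewrite !mxE eqxx (negbTE kj) mul0r.
rewrite (bigD1 j)//= big1 ?addr0 => [|k kj]; last first.
  by rewrite !mxE eqxx (negbTE kj) mul0r.
by rewrite -rowE !mxE !eqxx !mul1r [j == i]eq_sym.
Qed.

(** When the plane rotation degenerates, [f = - e] and the central symmetry does
    the job; the bound on [dot u (u *m M)] says that no unit vector orthogonal to
    [e] is turned by a larger angle than [e] itself. *)
Lemma rotation_to e f : dot e e = 1 -> dot f f = 1 ->
  exists M : 'M[R]_n, [/\ M *m M^T = 1%:M, e *m M = f &
    forall u, dot u e = 0 -> dot u u = 1 -> dot e f <= dot u (u *m M)].
Proof.
move=> e1 f1; have [c0|c0] := eqVneq (1 + dot e f) 0.
  have efN : f = - e.
    apply/eqP; rewrite -addr_eq0 -dot_eq0 !dotE (dotC f e) e1 f1.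
    by apply/eqP; lra.
  exists (- 1%:M); split.
  - by rewrite linearN /= trmx1 mulmxN mulNmx opprK mulmx1.
  - by rewrite mulmxN mulmx1.
  - by move=> u _ u1; rewrite mulmxN mulmx1 dotNr u1; lra.
exists (plane_rotation e f); split.
- by apply: orthogonal_mxP => u v; rewrite plane_rotation_isometry.
- rewrite mul_plane_rotation dotDr e1 mulVf// scale1r mulr1.
  by rewrite opprD addrA subrr add0r scaler_nat mulr2n addrA addNr add0r.
- move=> u ue u1.
  have c1 : 0 < 1 + dot e f.
    rewrite lt_neqAle eq_sym c0 /=.
    have := dot_ge0 (e + f); rewrite !dotE (dotC f e) e1 f1; lra.
  rewrite mul_plane_rotation !dotE ue u1 !(mulr0, mul0r, addr0, add0r).
  set c := dot e f in c1 c0 *; set b := dot u f.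
  have bc : b ^+ 2 <= (1 - c) * (1 + c).
    have := dot_ge0 (f - c *: e - b *: u).
    rewrite !dotE (dotC f e) (dotC f u) (dotC e u) ue e1 f1 u1 -/c -/b; nra.
  have : (1 + c)^-1 * b ^+ 2 <= 1 - c by rewrite mulrC ler_pdivrMr.
  by rewrite -mulrA -expr2; lra.
Qed.

End rotation.

(** * Measurability of Lipschitz functions *)

Section lipschitz_measurable.
Context {R : realType}.

(** McShane: a function that is Lipschitz for [delta] is the infimum of the
    measurable functions [phi (q k) + L * delta x k], [q] running over a dense
    sequence. *)
Lemma measurable_lipschitz d (X : measurableType d) (q : nat -> X)
    (delta : X -> nat -> R) (phi : X -> R) (L : R) : 0 <= L ->
  (forall k, measurable_fun setT (delta ^~ k)) ->
  (forall x k, `|phi x - phi (q k)| <= L * delta x k) ->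
  (forall x e, 0 < e -> exists k, delta x k < e) ->
  measurable_fun setT phi.
Proof.
move=> L0 mdelta lip dense_q mT.
apply: (measurability _ (RGenInftyO.measurableE R)) => //.
move=> /= _ [_ [r ->] <-]; rewrite setTI.
have -> : phi @^-1` `]-oo, r[ =
    \bigcup_k ((fun x => phi (q k) + L * delta x k) @^-1` `]-oo, r[).
  apply/seteqP; split => [x /=|x [k _] /=]; rewrite !in_itv /=; last first.
    by apply: le_lt_trans; rewrite -lerBlDl (le_trans (ler_norm _)).
  move=> xr; have L1 : 0 < 2 * (L + 1) by lra.
  have [|k] := dense_q x ((r - phi x) / (2 * (L + 1))).
    by rewrite divr_gt0// subr_gt0.
  rewrite ltr_pdivlMr// => hk; exists k => //=.
  rewrite in_itv /=; have := lip x k; rewrite ler_norml => /andP[h1 h2].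
  nra.
apply: bigcup_measurable => k _; rewrite -[X in measurable X]setTI.
apply: (_ : measurable_fun setT (fun x => phi (q k) + L * delta x k)) => //.
by apply: measurable_funD => //; apply: measurable_funM.
Qed.

Definition rat_rV n (k : nat) : 'rV[R]_n :=
  if unpickle k is Some r then map_mx ratr (r : 'rV[rat]_n) else 0.

Definition rat_rV2 n (k : nat) : 'rV[R]_n * 'rV[R]_n :=
  if unpickle k is Some r then (rat_rV n r.1, rat_rV n r.2) else (0, 0).

Lemma rat_rV_dense n (x : 'rV[R]_n) e : 0 < e ->
  exists k, enorm (x - rat_rV n k) < e.
Proof.
move=> e0; have c0 : 0 < e / n.+1%:R by rewrite divr_gt0// ltr0n.
have h i : exists r : rat, `|x ord0 i - ratr r| < e / n.+1%:R.
  have [||y [xy [r _ ry]]] := @dense_rat R (ball (x ord0 i) (e / n.+1%:R)).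
  - by exists (x ord0 i); exact: ballxx.
  - exact: ball_open.
  - by exists r; rewrite ry.
exists (pickle (\row_i projT1 (cid (h i)))); rewrite /rat_rV pickleK.
apply: (@le_lt_trans _ _ (n%:R * (e / n.+1%:R))).
  apply: enorm_le_coord => // i; rewrite !mxE.
  exact: (projT2 (cid (h i))).
rewrite mulrCA gtr_pMr// ltr_pdivrMr ?ltr0n// mul1r ltr_nat.
exact: ltnSn.
Qed.

Lemma rat_rV2_dense n (x : 'rV[R]_n * 'rV[R]_n) e : 0 < e -> exists k,
  enorm (x.1 - (rat_rV2 n k).1) + enorm (x.2 - (rat_rV2 n k).2) < e.
Proof.
move=> e0; have e20 : 0 < e / 2 by rewrite divr_gt0.
have [k1 h1] := rat_rV_dense x.1 e20; have [k2 h2] := rat_rV_dense x.2 e20.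
exists (pickle (k1, k2)); rewrite /rat_rV2 pickleK [ltRHS]splitr; exact: ltrD h1 h2.
Qed.

Lemma measurable_fun_addrV d (X : measurableType d) n (f g : X -> 'rV[R]_n) :
  measurable_fun setT f -> measurable_fun setT g ->
  measurable_fun setT (fun x => f x + g x).
Proof.
move=> mf mg; apply: measurable_fun_rV => i; under eq_fun do rewrite mxE.
by apply: measurable_funD; exact: (measurableT_comp (measurable_coord i)).
Qed.

Lemma measurable_fun_scalerV d (X : measurableType d) n (a : X -> R)
    (f : X -> 'rV[R]_n) :
  measurable_fun setT a -> measurable_fun setT f ->
  measurable_fun setT (fun x => a x *: f x).
Proof.
move=> ma mf; apply: measurable_fun_rV => i; under eq_fun do rewrite mxE.
by apply: measurable_funM => //; exact: (measurableT_comp (measurable_coord i)).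
Qed.

Lemma measurable_fun_oppV d (X : measurableType d) n (f : X -> 'rV[R]_n) :
  measurable_fun setT f -> measurable_fun setT (fun x => - f x).
Proof.
move=> mf; apply: measurable_fun_rV => i; under eq_fun do rewrite mxE.
by apply: measurable_funN; exact: (measurableT_comp (measurable_coord i)).
Qed.

Lemma measurable_fun_subrV d (X : measurableType d) n (f g : X -> 'rV[R]_n) :
  measurable_fun setT f -> measurable_fun setT g ->
  measurable_fun setT (fun x => f x - g x).
Proof. by move=> mf mg; apply: measurable_fun_addrV => //; exact: measurable_fun_oppV. Qed.

Lemma measurable_fun_mulmx d (X : measurableType d) n m (f : X -> 'rV[R]_n)
    (A : 'M[R]_(n, m)) :
  measurable_fun setT f -> measurable_fun setT (fun x => f x *m A).
Proof.
move=> mf; apply: measurable_fun_rV => i; under eq_fun do rewrite mxE.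
apply: measurable_sum => j; apply: measurable_funM => //.
exact: (measurableT_comp (measurable_coord j)).
Qed.

Lemma measurable_fun_enorm d (X : measurableType d) n (f : X -> 'rV[R]_n) :
  measurable_fun setT f -> measurable_fun setT (fun x => enorm (f x)).
Proof. by move=> mf; exact: (measurableT_comp (@measurable_enorm R n)). Qed.

Lemma measurable_lipschitz_rV n (phi : 'rV[R]_n -> R) (L : R) : 0 <= L ->
  (forall x y, `|phi x - phi y| <= L * enorm (x - y)) ->
  measurable_fun setT phi.
Proof.
move=> L0 lip; apply: (@measurable_lipschitz _ _ (rat_rV n)
  (fun x k => enorm (x - rat_rV n k)) _ L) => // [k|x e].
  by apply/measurable_fun_enorm/measurable_fun_subrV.
exact: rat_rV_dense.
Qed.

Lemma measurable_lipschitz_rV2 n (phi : 'rV[R]_n * 'rV[R]_n -> R) (L : R) : 0 <= L ->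
  (forall x y, `|phi x - phi y| <= L * (enorm (x.1 - y.1) + enorm (x.2 - y.2))) ->
  measurable_fun setT phi.
Proof.
move=> L0 lip; apply: (@measurable_lipschitz _ _ (rat_rV2 n)
  (fun x k => enorm (x.1 - (rat_rV2 n k).1) + enorm (x.2 - (rat_rV2 n k).2)) _ L)
  => // [k|x e]; last exact: rat_rV2_dense.
by apply: measurable_funD; apply/measurable_fun_enorm/measurable_fun_subrV.
Qed.

End lipschitz_measurable.

(** * Invariance of the surface measure under orthogonal maps *)

Section lebesgue_rV_invariance.
Context {R : realType}.

Definition pushforward_measure d1 d2 (T1 : measurableType d1)
    (T2 : measurableType d2) (m : {measure set T1 -> \bar R}) (f : T1 -> T2)
    (mf : measurable_fun setT f) : {measure set T2 -> \bar R} :=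
  measure_function_pushforward__canonical__measure_function_Measure m mf.

Lemma measurable_preimageT d1 d2 (T1 : measurableType d1)
    (T2 : measurableType d2) (f : T1 -> T2) A :
  measurable_fun setT f -> measurable A -> measurable (f @^-1` A).
Proof. by move=> mf mA; rewrite -[X in measurable X]setTI; exact: mf. Qed.

Local Open Scope ereal_scope.

Lemma lebesgue_measure_shift (a : R) (A : set R) : measurable A ->
  lebesgue_measure ((fun x => x + a)%R @^-1` A) = lebesgue_measure A.
Proof.
move=> mA.
have mf : measurable_fun setT (fun x : measurableTypeR R => (x + a)%R : measurableTypeR R).
  by apply: measurable_funD.
apply/esym/(@lebesgue_measure_unique R (pushforward_measure lebesgue_measure mf)) => //.
move=> _ [[x y] _ <-] /=; rewrite /pushforward.
have -> : (fun z => z + a)%R @^-1` `]x, y] = `](x - a)%R, (y - a)%R]%classic.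
  by apply/seteqP; split => z /=; rewrite !in_itv /= ltrBlDr lerBrDr.
rewrite !lebesgue_measure_itv /= !lte_fin ltrD2r; case: ifP => // _.
by rewrite -!EFinB; congr EFin; ring.
Qed.

Lemma lebesgue_rVS n (A : set 'rV[R]_n.+1) :
  lebesgue_rV n.+1 A = \int[lebesgue_measure]_x
    lebesgue_rV n (xsection (@rV_cons R n @^-1` A) x).
Proof. by []. Qed.

Lemma lebesgue_rV_shift n (a : 'rV[R]_n) (A : set 'rV[R]_n) : measurable A ->
  lebesgue_rV n ((fun x => x + a)%R @^-1` A) = lebesgue_rV n A.
Proof.
elim: n a A => [|n IH] a A mA.
  congr (lebesgue_rV 0 _); apply/funext => x /=; congr (A _).
  by apply/rowP => -[].
pose a' : 'rV[R]_n := \row_j a ord0 (lift ord0 j).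
have consD x y : (rV_cons (x, y) + a = rV_cons (x + a ord0 ord0, y + a'))%R.
  apply/rowP => i; rewrite !mxE; case: unliftP => [j|] -> //=.
  by rewrite [RHS]mxE [a' _ _]mxE.
have mcA : measurable (@rV_cons R n @^-1` A).
  by apply: measurable_preimageT mA; exact: measurable_rV_cons.
rewrite !lebesgue_rVS.
pose F (x : measurableTypeR R) := lebesgue_rV n (xsection (@rV_cons R n @^-1` A) x).
have mF : measurable_fun setT F by exact: measurable_fun_xsection.
have mf : measurable_fun setT (fun x : measurableTypeR R => (x + a ord0 ord0)%R : measurableTypeR R).
  by apply: measurable_funD.
transitivity (\int[lebesgue_measure]_x F (x + a ord0 ord0)%R).
  apply: eq_integral => x _; rewrite /F -[RHS](IH a'); last exact: measurable_xsection.
  congr (lebesgue_rV n _); apply/seteqP.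
  by split => y /=; rewrite /xsection /= !inE /= consD.
have := @ge0_integral_pushforward _ _ _ _ R _ mf lebesgue_measure setT F
  measurableT mF.
rewrite preimage_setT => <-; last by move=> x _; rewrite /F.
apply: eq_measure_integral => B mB _; exact: lebesgue_measure_shift.
Qed.

Definition unit_ball n : set 'rV[R]_n := [set x | (enorm x <= 1)%R].
Definition cube n (c : R) : set 'rV[R]_n :=
  [set x | forall i, (`|x ord0 i| <= c)%R].

Arguments unit_ball n _ : clear implicits.
Arguments cube n c _ : clear implicits.

Lemma measurable_unit_ball n : measurable (unit_ball n).
Proof.
rewrite (_ : unit_ball n = @enorm R n @^-1` `]-oo, 1%R]).
  by apply: measurable_preimageT => //; exact: measurable_enorm.
by apply/seteqP; split => x /=; rewrite in_itv.
Qed.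

Lemma cube_cons n c :
  @rV_cons R n @^-1` (cube n.+1 c) = `[(- c)%R, c] `*` cube n c.
Proof.
apply/seteqP; split => [[x y] /= h|[x y] /= [hx hy] i].
  split; first by have := h ord0; rewrite mxE unlift_none /= in_itv /= ler_norml.
  by move=> i; have := h (lift ord0 i); rewrite mxE liftK.
rewrite mxE; case: unliftP => [j|] _ /=; first exact: hy.
by move: hx; rewrite in_itv /= ler_norml.
Qed.

Lemma measurable_cube n c : measurable (cube n c).
Proof.
rewrite (_ : cube n c = \big[setI/setT]_(i < n) ((fun x : 'rV[R]_n => x ord0 i) @^-1` `[(- c)%R, c])).
  apply: bigsetI_measurable => i _.
  by apply: measurable_preimageT => //; exact: measurable_coord.
rewrite -bigcap_seq; apply/seteqP; split => x h i.
  by move=> _ /=; rewrite in_itv /= -ler_norml; exact: h.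
by have := h i (mem_index_enum i); rewrite /= in_itv /= -ler_norml.
Qed.

Lemma lebesgue_rV_cube n (c : R) : (0 < c)%R ->
  lebesgue_rV n (cube n c) = ((2 * c) ^+ n)%:E.
Proof.
move=> c0; elim: n => [|n IH].
  rewrite expr0 /= diracE (_ : _ \in _ = true)//.
  by apply/mem_set => i; case: i.
have : lebesgue_rV n.+1 (cube n.+1 c) =
   (lebesgue_measure \x lebesgue_rV n) (@rV_cons R n @^-1` (cube n.+1 c)) by [].
rewrite cube_cons product_measure1E//; last exact: measurable_cube.
move=> ->; have := lebesgue_measure_itv `[(- c)%R, c].
rewrite /= lte_fin gtrN// => ->; rewrite IH -EFinB -EFinM.
by congr EFin; rewrite exprS; ring.
Qed.

Lemma lebesgue_rV_ball_fin n : lebesgue_rV n (unit_ball n) < +oo.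
Proof.
apply: (@le_lt_trans _ _ (lebesgue_rV n (cube n 1%R))).
  apply: le_measure; rewrite ?inE; [exact: measurable_unit_ball|exact: measurable_cube|].
  by move=> x /= h i; apply: le_trans h; exact: abs_coord_le.
by rewrite lebesgue_rV_cube// ltry.
Qed.

Lemma lebesgue_rV_ball_gt0 n : 0 < lebesgue_rV n (unit_ball n).
Proof.
have c0 : (0 < n.+1%:R^-1 :> R)%R by rewrite invr_gt0.
apply: (@lt_le_trans _ _ (lebesgue_rV n (cube n (n.+1%:R^-1)%R))).
  by rewrite lebesgue_rV_cube// lte_fin exprn_gt0// mulr_gt0.
apply: le_measure; rewrite ?inE; [exact: measurable_cube|exact: measurable_unit_ball|].
move=> x /= h; apply: (le_trans (enorm_le_sum _)).
apply: (@le_trans _ _ (\sum_(i < n) n.+1%:R^-1)%R); first exact: ler_sum.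
by rewrite sumr_const card_ord -[leLHS]mulr_natl ler_pdivrMr// mul1r ler_nat.
Qed.

(** Integrate [1_A (x Q + y) 1_B (y)] over [x] and [y], where [B] is the unit
    ball: integrating first in [x] gives the measure of [B] times the measure of
    the preimage of [A] under [Q]; substituting [y - x Q] for [y] and
    integrating first in [x] gives the measure of [A] times that of [B], because
    [Q] maps [B] to itself. *)
Lemma lebesgue_rV_orth n (Q : 'M[R]_n) (A : set 'rV[R]_n) :
  (Q *m Q^T = 1%:M)%R -> measurable A ->
  lebesgue_rV n ((fun x => x *m Q)%R @^-1` A) = lebesgue_rV n A.
Proof.
move=> QQ mA; set la := lebesgue_rV n.
have QQ' : (Q^T *m Q = 1%:M)%R by apply: mulmx1C.
have mB := @measurable_unit_ball n; set B := unit_ball n in mB.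
pose X := 'rV[R]_n.
pose E : set (X * X) := [set p | A (p.1 *m Q + p.2)%R /\ B p.2].
pose E' : set (X * X) := [set p | A p.2 /\ B (p.2 - p.1 *m Q)%R].
have mQ1 : measurable_fun setT (fun p : X * X => p.1 *m Q).
  exact: measurable_fun_mulmx.
have mE : measurable E.
  rewrite (_ : E = (fun p : X * X => p.1 *m Q + p.2)%R @^-1` A `&` snd @^-1` B)//.
  apply: measurableI; last exact: measurable_preimageT.
  by apply: measurable_preimageT => //; apply: measurable_fun_addrV.
have mE' : measurable E'.
  rewrite (_ : E' = snd @^-1` A `&` (fun p : X * X => p.2 - p.1 *m Q)%R @^-1` B)//.
  apply: measurableI; first exact: measurable_preimageT.
  by apply: measurable_preimageT => //; apply: measurable_fun_subrV.
have tonelli (D : set (X * X)) : measurable D ->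
    \int[la]_x la (xsection D x) = \int[la]_y la (ysection D y).
  move=> mD; have := indic_fubini_tonelli la la mD.
  by rewrite indic_fubini_tonelli_FE// indic_fubini_tonelli_GE.
have sections x : la (xsection E x) = la (xsection E' x).
  rewrite -[RHS](lebesgue_rV_shift (x *m Q)); last exact: measurable_xsection.
  congr (la _); apply/seteqP; split => y; rewrite /xsection /= !inE /E /E' /=.
    by rewrite addrK addrC.
  by rewrite addrK addrC.
have lhs : \int[la]_y la (ysection E y) =
    la ((fun x => x *m Q)%R @^-1` A) * la B.
  rewrite -integral_cst// [RHS]integral_mkcond; apply: eq_integral => y _.
  rewrite patchE; case: ifPn => [|] yB; last first.
    rewrite (_ : ysection E y = set0) ?measure0//.
    apply/seteqP; split => // x; rewrite /ysection /= inE => -[_ /= By].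
    by move/negP: yB; apply; exact: mem_set.
  rewrite -[RHS](lebesgue_rV_shift (y *m Q^T)%R); last first.
    apply: measurable_preimageT mA.
    by apply: measurable_fun_mulmx.
  congr (la _); apply/seteqP; split => x; rewrite /ysection /= inE /E /=.
    by rewrite mulmxDl -mulmxA QQ' mulmx1 => -[].
  by rewrite mulmxDl -mulmxA QQ' mulmx1; split=> //; exact: set_mem.
have rhs : \int[la]_y la (ysection E' y) = la A * la B.
  rewrite muleC -integral_cst// [RHS]integral_mkcond; apply: eq_integral => y _.
  rewrite patchE; case: ifPn => [|] yA; last first.
    rewrite (_ : ysection E' y = set0) ?measure0//.
    apply/seteqP; split => // x; rewrite /ysection /= inE => -[/= Ay _].
    by move/negP: yA; apply; exact: mem_set.
  rewrite -[RHS](lebesgue_rV_shift (- (y *m Q^T))%R); last exact: mB.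
  congr (la _).
  have bE x : (enorm (y - x *m Q) = enorm (x - y *m Q^T))%R.
    rewrite -(enorm_mulmx_orth (y - x *m Q) (A := Q^T)%R); last by rewrite trmxK.
    by rewrite mulmxBl -mulmxA QQ mulmx1 enormBC.
  apply/seteqP; split => x; rewrite /ysection /= inE /E' /B /unit_ball /= bE.
    by case.
  by split => //; exact: set_mem.
have : la ((fun x => x *m Q)%R @^-1` A) * la B = la A * la B.
  rewrite -lhs -rhs -(tonelli _ mE) -(tonelli _ mE'); apply: eq_integral => x _; exact: sections.
have := lebesgue_rV_ball_gt0 n; have := lebesgue_rV_ball_fin n; rewrite -/la -/B.
move=> Boo B0.
have Bfin : la B \is a fin_num by rewrite ge0_fin_numE.
move=> /(congr1 (fun z => z * (la B)^-1)).
rewrite -!muleA divee// ?mule1//.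
by rewrite gt_eqF.
Qed.

End lebesgue_rV_invariance.

Section surface_measure_facts.
Context {R : realType} {n : nat}.
Local Open Scope ereal_scope.

Definition unit_sphere : set 'rV[R]_n := [set x | enorm x = 1%R].

Lemma measurable_unit_sphere : measurable unit_sphere.
Proof.
rewrite (_ : unit_sphere = @enorm R n @^-1` [set 1%R])//.
by apply: measurable_preimageT => //; exact: measurable_enorm.
Qed.

Lemma surface_measureE (A : set 'rV[R]_n) : surface_measure n A =
  n%:R%:E * lebesgue_rV n (@normalize R n @^-1` A `&` @pointed_ball R n).
Proof. by []. Qed.

Lemma surface_measure_fin : surface_measure n [set: 'rV[R]_n] < +oo.
Proof.
rewrite surface_measureE preimage_setT setTI.
have : lebesgue_rV n (@pointed_ball R n) < +oo.
  apply: le_lt_trans (lebesgue_rV_ball_fin n).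
  apply: le_measure; rewrite ?inE; [exact: measurable_pointed_ball|exact: measurable_unit_ball|].
  by move=> x /= /andP[].
by move=> h; rewrite lte_mul_pinfty// lee_fin.
Qed.

Lemma surface_measure_sphere : surface_measure n (~` unit_sphere) = 0.
Proof.
rewrite surface_measureE (_ : _ `&` _ = set0) ?measure0 ?mule0//.
apply/seteqP; split => // x [/= + /andP[x0 _]]; apply.
by rewrite /unit_sphere /= enorm_normalize// -enorm_eq0 gt_eqF.
Qed.

Lemma surface_measure_orth (Q : 'M[R]_n) (A : set 'rV[R]_n) :
  (Q *m Q^T = 1%:M)%R -> measurable A ->
  surface_measure n ((fun x => x *m Q)%R @^-1` A) = surface_measure n A.
Proof.
move=> QQ mA; rewrite !surface_measureE; congr (_ * _).
rewrite -[RHS](lebesgue_rV_orth QQ); last first.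
  apply: measurableI; last exact: (@measurable_pointed_ball R n).
  by apply: measurable_preimageT mA; exact: (@measurable_normalize R n).
congr (lebesgue_rV n _); apply/seteqP; split => x /=;
by rewrite /pointed_ball /normalize /= enorm_mulmx_orth// scalemxAl.
Qed.

End surface_measure_facts.

(** * Orthonormal frames and the coupling of azimuthal angles *)

Section trigo_bounds.
Context {R : realType}.
Implicit Types x y : R.

Lemma lipschitz_of_derive (f df : R -> R) :
  (forall x, is_derive x 1 f (df x)) -> (forall x, `|df x| <= 1) ->
  forall x y, `|f x - f y| <= `|x - y|.
Proof.
move=> fdf df1.
suff H x y : x <= y -> `|f y - f x| <= `|y - x|.
  by move=> x y; have [/H|/ltW/H//] := leP x y; rewrite distrC (distrC y).
move=> xy; have [] := @MVT_segment _ f df x y xy => //.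
  apply: derivable_within_continuous => z _.
  by have := fdf z => -[].
by move=> c _ ->; rewrite normrM ler_piMl.
Qed.

Lemma sin_lipschitz x y : `|sin x - sin y| <= `|x - y|.
Proof.
apply: (@lipschitz_of_derive _ cos) => z.
by rewrite ler_norml cos_geN1 cos_le1.
Qed.

Lemma cos_lipschitz x y : `|cos x - cos y| <= `|x - y|.
Proof.
apply: (@lipschitz_of_derive _ (fun z => - sin z)) => z.
by rewrite normrN ler_norml sin_geN1 sin_le1.
Qed.

Lemma abs_sin_le x : `|sin x| <= `|x|.
Proof. by have := sin_lipschitz x 0; rewrite sin0 !subr0. Qed.

Lemma one_sub_cos x : 1 - cos x = 2 * sin (x / 2) ^+ 2.
Proof.
have -> : cos x = cos ((x / 2) *+ 2) by rewrite -mulr_natr divfK.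
rewrite cos_mulr2n; have := cos2Dsin2 (x / 2); lra.
Qed.

Lemma one_sub_cos_le_sqr x : 1 - cos x <= x ^+ 2 / 2.
Proof.
rewrite one_sub_cos; have := abs_sin_le (x / 2).
rewrite -(@ler_pXn2r _ 2)// ?nnegrE// !real_normK ?num_real// => h.
by rewrite (_ : x ^+ 2 / 2 = 2 * (x / 2) ^+ 2); [rewrite ler_pM2l|field].
Qed.

Lemma one_sub_cos_le x : 0 <= x -> 1 - cos x <= x.
Proof.
move=> x0; rewrite one_sub_cos -real_normK ?num_real//.
have := abs_sin_le (x / 2); rewrite [`|x / 2|]ger0_norm ?divr_ge0//.
have : `|sin (x / 2)| <= 1 by rewrite ler_norml sin_geN1 sin_le1.
have := normr_ge0 (sin (x / 2)); nra.
Qed.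

End trigo_bounds.

Section frames.
Context {R : realType} {n : nat}.
Implicit Types e X Y : 'rV[R]_n.+1.

Lemma frame_spec e : dot e e = 1 \/ e = 0 ->
  completes_to_orthonormal_basis e (frame e).
Proof.
pose e0 : 'rV[R]_n.+1 := delta_mx 0 ord0.
have e01 : dot e0 e0 = 1.
  rewrite /dot (bigD1 ord0)//= big1 ?addr0 ?mxE ?eqxx ?mulr1// => i i0.
  by rewrite mxE (negbTE i0) mul0r.
have H e' : dot e' e' = 1 -> exists O, completes_to_orthonormal_basis e' O.
  move=> e1; have [M [MM eM _]] := rotation_to e01 e1.
  exists (row' ord0 M : 'M[R]_(n, n.+1)); split.
    apply/matrixP => i j; rewrite !mxE.
    have := congr1 (fun A : 'M[R]_n.+1 => A (lift ord0 i) (lift ord0 j)) MM.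
    rewrite !mxE (inj_eq lift_inj) => <-; apply: eq_bigr => k _.
    by rewrite !mxE.
  apply/matrixP => i j; rewrite !mxE -eM trmx_mul.
  have := congr1 (fun A : 'M[R]_n.+1 => A (lift ord0 i) ord0) MM.
  rewrite !mxE /= => h; apply: etrans h; apply: eq_bigr => k _.
  rewrite !mxE; congr (_ * _).
  rewrite (bigD1 ord0)//= big1 ?addr0 ?mxE ?ord1 ?eqxx ?mulr1// => l l0.
  by rewrite !mxE (negbTE l0) andbF mulr0.
move=> [e1|->]; apply: xgetPex; first exact: H.
have [A [AA _]] := H _ e01.
by exists A; split => //; rewrite trmx0 mulmx0.
Qed.

Lemma dot_normalize X : dot (normalize X) (normalize X) = 1 \/ normalize X = 0.
Proof.
have [->|X0] := eqVneq X 0; first by right; rewrite /normalize scaler0.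
by left; rewrite -sqr_enorm enorm_normalize// expr1n.
Qed.

Lemma frame_orthP X : completes_to_orthonormal_basis (normalize X) (frame (normalize X)).
Proof. exact/frame_spec/dot_normalize. Qed.

Lemma enorm_mul_frame X (xi : 'rV[R]_n) :
  enorm (xi *m frame (normalize X)) = enorm xi.
Proof. by have [AA _] := frame_orthP X; exact: enorm_mulmx_orth. Qed.

Lemma dot_mul_frame X (xi : 'rV[R]_n) :
  dot (xi *m frame (normalize X)) (normalize X) = 0.
Proof.
have [_ Oe] := frame_orthP X.
have := dot_mx (xi *m frame (normalize X)) (normalize X).
by rewrite -mulmxA Oe mulmx0 => /matrixP/(_ 0 0); rewrite !mxE eqxx mulr1n.
Qed.

(** [1 = e^T e + O^T O], since the rows of [O] complete the unit vector [e]. *)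
Lemma frame_projection (e : 'rV[R]_n.+1) (O : 'M[R]_(n, n.+1)) :
  dot e e = 1 -> completes_to_orthonormal_basis e O ->
  O^T *m O = 1%:M - e^T *m e.
Proof.
move=> e1 [AA Oe]; pose N : 'M[R]_(1 + n) := col_mx e O.
have NN : N *m N^T = 1%:M.
  have eO : e *m O^T = 0 by rewrite -[LHS]trmxK trmx_mul trmxK Oe trmx0.
  by rewrite tr_col_mx mul_col_row dot_mx e1 AA Oe eO -scalar_mx_block.
have /mulmx1C := NN; rewrite tr_col_mx mul_row_col => h.
by apply: (canRL (addrK _)); rewrite addrC; exact: h.
Qed.

(** Tanaka's coupling of the azimuthal variables: [xi] is paired with its image
    under the rotation of the plane of [X] and [Y] that aligns the two
    directions, expressed in the two frames.  Every unit vector orthogonal to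
    [X] is turned by at most the angle between [X] and [Y], so that the rotated
    vectors of lengths [|X|] and [|Y|] are no farther apart than [X] and [Y]. *)
Lemma tanaka_coupling X Y : exists Q : 'M[R]_n, Q *m Q^T = 1%:M /\
  forall xi : 'rV[R]_n, enorm xi = 1 ->
    enorm (enorm X *: (xi *m frame (normalize X)) -
           enorm Y *: (xi *m Q *m frame (normalize Y))) <= enorm (X - Y).
Proof.
have [->|X0] := eqVneq X 0.
  exists 1%:M; split => [|xi xi1]; first by rewrite trmx1 mulmx1.
  rewrite enorm0 scale0r !sub0r !enormN enormZ mulmx1 enorm_mul_frame xi1 mulr1.
  by rewrite ger0_norm ?enorm_ge0.
have [->|Y0] := eqVneq Y 0.
  exists 1%:M; split => [|xi xi1]; first by rewrite trmx1 mulmx1.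
  rewrite enorm0 scale0r !subr0 enormZ enorm_mul_frame xi1 mulr1.
  by rewrite ger0_norm ?enorm_ge0.
have eX := enorm_normalize X0; have eY := enorm_normalize Y0.
set e := normalize X in eX *; set f := normalize Y in eY *.
have e1 : dot e e = 1 by rewrite -sqr_enorm eX expr1n.
have f1 : dot f f = 1 by rewrite -sqr_enorm eY expr1n.
have [M [MM eM Mang]] := rotation_to e1 f1.
have [AA Oe] := frame_orthP X; have [PP Pf] := frame_orthP Y.
rewrite -/e -/f in AA Oe PP Pf.
set O := frame e in AA Oe *; set P := frame f in PP Pf *.
have QP : O *m M *m P^T *m P = O *m M.
  rewrite -[LHS]mulmxA (frame_projection f1 (conj PP Pf)) mulmxBr mulmx1.
  rewrite [X in _ - X](_ : _ = 0) ?subr0// -eM trmx_mul.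
  rewrite !mulmxA -(mulmxA O M) MM mulmx1 Oe.
  by rewrite !mul0mx.
exists (O *m M *m P^T); split.
  set Q := O *m M *m P^T in QP *.
  have -> : Q *m Q^T = (Q *m P) *m (Q *m P)^T.
    by rewrite (trmx_mul Q P) mulmxA -(mulmxA Q P) PP mulmx1.
  by rewrite QP trmx_mul mulmxA -(mulmxA O) MM mulmx1 AA.
move=> xi xi1; rewrite -(mulmxA xi) QP mulmxA.
set eta := xi *m O.
have etae : dot eta e = 0 by exact: dot_mul_frame.
have eta1 : dot eta eta = 1 by rewrite -sqr_enorm enorm_mul_frame xi1 expr1n.
have etaM1 : dot (eta *m M) (eta *m M) = 1.
  by rewrite -sqr_enorm enorm_mulmx_orth// sqr_enorm.
apply: enorm_le; first exact: enorm_ge0.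
have hX : enorm X *: e = X by exact: enorm_scale_normalize.
have hY : enorm Y *: f = Y by exact: enorm_scale_normalize.
rewrite sqr_enorm -[in leRHS]hX -[in leRHS]hY; clearbody e f.
rewrite !dotE (dotC f e) (dotC (eta *m M) eta) e1 f1 eta1 etaM1.
have := Mang eta etae eta1; have := enorm_ge0 X; have := enorm_ge0 Y.
set a := enorm X; set b := enorm Y; set c := dot e f; set c' := dot eta _.
move=> b0 a0 cc'; have := mulr_ge0 a0 b0; nra.
Qed.

End frames.

(** * Displacement of a velocity in a collision *)

Section integral_generalities.
Context {R : realType}.
Local Open Scope ereal_scope.

Lemma integral_pushforwardT d1 d2 (T1 : measurableType d1)
    (T2 : measurableType d2) (m : {measure set T1 -> \bar R}) (phi : T1 -> T2)
    (mphi : measurable_fun setT phi) (f : T2 -> \bar R) :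
  measurable_fun setT f ->
  \int[pushforward_measure m mphi]_y f y = \int[m]_x f (phi x).
Proof.
move=> mf; rewrite integralE [RHS]integralE.
have := ge0_integral_pushforward mphi m measurableT; rewrite preimage_setT => H.
have Hp := H _ (measurable_funepos mf) (fun x _ => funepos_ge0 f x).
have Hn := H _ (measurable_funeneg mf) (fun x _ => funeneg_ge0 f x).
congr (_ - _).
  by apply: (etrans Hp); apply: eq_integral => x _; rewrite /= !funeposE.
by apply: (etrans Hn); apply: eq_integral => x _; rewrite /= !funenegE.
Qed.

Lemma eq_measure_integralT d (T : measurableType d) (m1 m2 : {measure set T -> \bar R})
    (f : T -> \bar R) :
  (forall A, measurable A -> m1 A = m2 A) -> \int[m1]_x f x = \int[m2]_x f x.
Proof. by move=> h; apply: eq_measure_integral => A mA _; exact: h. Qed.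

Lemma integral_conull d (T : measurableType d) (m : {measure set T -> \bar R})
    (D : set T) (f : T -> \bar R) : measurable D -> m (~` D) = 0 ->
  measurable_fun setT f -> \int[m]_x f x = \int[m]_(x in D) f x.
Proof.
move=> mD m0 mf; rewrite [RHS]integral_mkcond; apply: ae_eq_integral => //.
  by apply/(measurable_restrictT _ mD); exact: measurable_funTS.
exists (~` D); split => //; first exact: measurableC.
move=> x /= h Dx; apply: h => _; rewrite patchE.
by move/mem_set : Dx => ->.
Qed.

Lemma bounded_integrable d (T : measurableType d) (m : {measure set T -> \bar R})
    (D : set T) (f : T -> R) (M : R) : measurable D -> m D < +oo ->
  measurable_fun D f -> (forall x, D x -> (`|f x| <= M)%R) ->
  m.-integrable D (EFin \o f).
Proof.
move=> mD moo mf fM; apply: (@le_integrable _ _ _ _ _ mD _ (cst M%:E)).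
- exact/measurable_EFinP.
- by move=> x Dx; rewrite /= lee_fin (le_trans (fM x Dx))// ler_norm.
- apply/integrableP; split; first exact: measurable_cst.
  by rewrite integral_cst// lte_mul_pinfty.
Qed.

End integral_generalities.

Section displacement.
Context {R : realType} {n : nat}.
Implicit Types (X Y v w : 'rV[R]_n.+1) (xi : 'rV[R]_n) (theta : R).

Definition displacement X theta xi : 'rV[R]_n.+1 :=
  ((cos theta - 1) / 2) *: X +
  (sin theta / 2) *: (enorm X *: (xi *m frame (normalize X))).

Lemma post_velocityE v w theta xi :
  post_velocity v w theta xi = v + displacement (v - w) theta xi.
Proof.
rewrite /post_velocity /scatter /displacement.
have := enorm_scale_normalize (v - w).
move: (enorm (v - w)) (normalize (v - w)) (frame _) => r e O hX.
apply/rowP => i; have := congr1 (fun u : 'rV[R]_n.+1 => u ord0 i) hX.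
move: (xi *m O) => o; rewrite !mxE => he.
have -> : w ord0 i = v ord0 i - r * e ord0 i by rewrite he; ring.
by field.
Qed.

(** The squared length of the displacement is [|X|^2 (1 - cos theta) / 2]. *)
Lemma enorm_displacement X theta xi : 0 <= theta -> enorm xi = 1 ->
  enorm (displacement X theta xi) <= theta / 2 * enorm X.
Proof.
move=> t0 xi1; apply: enorm_le; first by rewrite mulr_ge0 ?divr_ge0 ?enorm_ge0.
have XO : dot X (xi *m frame (normalize X)) = 0.
  by rewrite -[X in dot X _]enorm_scale_normalize dotZl dotC dot_mul_frame mulr0.
rewrite /displacement !dotE (dotC _ X) XO -!sqr_enorm enorm_mul_frame xi1.
have := one_sub_cos_le_sqr theta; have := cos2Dsin2 theta.
have := enorm_ge0 X; set r := enorm X; set c := cos theta; set s := sin theta.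
move=> r0 cs h.
have s2 : s ^+ 2 = 1 - c ^+ 2 by lra.
rewrite [leLHS](_ : _ = r ^+ 2 * ((1 - c) / 2)); last first.
  transitivity (r ^+ 2 * ((c - 1) ^+ 2 + s ^+ 2) / 4); first by field.
  by rewrite s2; field.
rewrite (_ : (theta / 2 * r) ^+ 2 = r ^+ 2 * (theta ^+ 2 / 2 / 2)); last by field.
by apply: ler_wpM2l; [exact: sqr_ge0|lra].
Qed.

(** The components along and across the relative velocity contribute half of
    the bound each. *)
Lemma displacement_coupling X Y : exists Q : 'M[R]_n, Q *m Q^T = 1%:M /\
  forall theta xi, 0 <= theta -> enorm xi = 1 ->
    enorm (displacement X theta xi - displacement Y theta (xi *m Q)) <=
      theta * enorm (X - Y).
Proof.
have [Q [QQ h]] := tanaka_coupling X Y; exists Q; split => // theta xi t0 xi1.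
rewrite /displacement opprD addrACA -!scalerBr.
apply: (le_trans (ler_enormD _ _)); rewrite !enormZ.
have {h} := h xi xi1; set a := enorm (_ - _); set b := enorm (X - Y) => ab.
have b0 : 0 <= b by exact: enorm_ge0.
have h1 : `|(cos theta - 1) / 2| <= theta / 2.
  rewrite normrM distrC !ger0_norm ?invr_ge0 ?subr_ge0 ?cos_le1//.
  by rewrite ler_wpM2r// one_sub_cos_le.
have h2 : `|sin theta / 2| <= theta / 2.
  rewrite normrM [`|2^-1|]ger0_norm// ler_wpM2r//.
  by rewrite (le_trans (abs_sin_le _))// ger0_norm.
have := normr_ge0 (sin theta / 2); have : 0 <= a by exact: enorm_ge0.
move=> a0 s0; have : `|sin theta / 2| * a <= theta / 2 * b by apply: ler_pM.
have : `|(cos theta - 1) / 2| * b <= theta / 2 * b by apply: ler_wpM2r.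
lra.
Qed.

Lemma displacement_lipschitz_angle X theta theta' xi : enorm xi = 1 ->
  enorm (displacement X theta xi - displacement X theta' xi) <=
    `|theta - theta'| * enorm X.
Proof.
move=> xi1; rewrite /displacement opprD addrACA -!scalerBl.
apply: (le_trans (ler_enormD _ _)); rewrite !enormZ enorm_mul_frame xi1 mulr1.
rewrite [`|enorm X|]ger0_norm ?enorm_ge0// -mulrDl ler_wpM2r ?enorm_ge0//.
change (`|(cos theta - 1 - (cos theta' - 1)) / 2| +
  `|(sin theta - sin theta') / 2| <= `|theta - theta'|).
rewrite !normrM (ger0_norm (_ : 0 <= 2^-1))//.
have := sin_lipschitz theta theta'; have := cos_lipschitz theta theta'.
have -> : cos theta - 1 - (cos theta' - 1) = cos theta - cos theta' by ring.
lra.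
Qed.

Lemma measurable_displacement X theta :
  measurable_fun setT (displacement X theta).
Proof.
apply: measurable_fun_addrV => //; apply: measurable_fun_scalerV => //.
by apply: measurable_fun_scalerV => //; exact: measurable_fun_mulmx.
Qed.

End displacement.

(** * Averages over the azimuthal sphere *)

Section angular_average.
Context {R : realType} {n : nat}.
Variable phi : 'rV[R]_n.+1 -> R.
Hypothesis lip_phi : forall x y, `|phi x - phi y| <= enorm (x - y).
Implicit Types (v w : 'rV[R]_n.+1) (xi : 'rV[R]_n) (theta : R).

Local Notation S := (@unit_sphere R n).

Definition sphere_area : R := fine (surface_measure n [set: 'rV[R]_n]).

Lemma sphere_areaE : surface_measure n [set: 'rV[R]_n] = sphere_area%:E.
Proof. by rewrite fineK// ge0_fin_numE// surface_measure_fin. Qed.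

Lemma sphere_area_ge0 : 0 <= sphere_area.
Proof. exact: fine_ge0. Qed.

Lemma surface_unit_sphere : surface_measure n S = sphere_area%:E.
Proof.
have mS := @measurable_unit_sphere R n.
rewrite -sphere_areaE -(setUv S) measureU//; last 2 first.
- exact: measurableC.
- by rewrite setICr.
by rewrite [X in (_ + X)%E](@surface_measure_sphere R n) adde0.
Qed.

Lemma measurable_lip1 : measurable_fun setT phi.
Proof. by apply: (@measurable_lipschitz_rV _ _ _ 1) => // x y; rewrite mul1r. Qed.

Definition increment theta v w xi : R :=
  phi (v + displacement (v - w) theta xi) - phi v.

Definition angular theta v w : R :=
  \int[surface_measure n]_(xi in S) increment theta v w xi.

Lemma measurable_increment theta v w : measurable_fun setT (increment theta v w).
Proof.
apply: measurable_funB => //; apply: (measurableT_comp measurable_lip1).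
by apply: measurable_fun_addrV => //; exact: measurable_displacement.
Qed.

Lemma abs_increment theta v w xi : 0 <= theta -> S xi ->
  `|increment theta v w xi| <= theta / 2 * enorm (v - w).
Proof.
move=> t0 xi1; apply: (le_trans (lip_phi _ _)).
by rewrite addrC addKr enorm_displacement.
Qed.

Lemma integrable_increment theta v w (Q : 'M[R]_n) : 0 <= theta ->
  Q *m Q^T = 1%:M ->
  (surface_measure n).-integrable S (EFin \o (fun xi => increment theta v w (xi *m Q))).
Proof.
move=> t0 QQ; apply: (@bounded_integrable _ _ _ _ _ _ (theta / 2 * enorm (v - w))).
- exact: measurable_unit_sphere.
- by rewrite /= surface_unit_sphere ltry.
- apply: measurable_funTS; apply: (measurableT_comp (measurable_increment _ _ _)).
  exact: measurable_fun_mulmx.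
- by move=> xi xi1; apply: abs_increment => //; rewrite /unit_sphere /= enorm_mulmx_orth.
Qed.

Lemma integrable_increment1 theta v w : 0 <= theta ->
  (surface_measure n).-integrable S (EFin \o increment theta v w).
Proof.
move=> t0; have := @integrable_increment theta v w 1%:M t0.
rewrite trmx1 mulmx1 => /(_ erefl).
by under [in X in integrable _ _ X]eq_fun do rewrite mulmx1.
Qed.

Lemma angularE theta v w : 0 <= theta ->
  (\int[surface_measure n]_xi (phi (post_velocity v w theta xi) - phi v)%:E =
    (angular theta v w)%:E)%E.
Proof.
move=> t0; under eq_integral do rewrite post_velocityE.
rewrite (@integral_conull _ _ _ _ S)//.
- rewrite fineK//; apply: integrable_fin_num; first exact: measurable_unit_sphere.
  exact: integrable_increment1.
- exact: measurable_unit_sphere.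
- exact: surface_measure_sphere.
- by apply/measurable_EFinP; exact: measurable_increment.
Qed.

Lemma angular_orth theta v w (Q : 'M[R]_n) : 0 <= theta -> Q *m Q^T = 1%:M ->
  angular theta v w = \int[surface_measure n]_(xi in S) increment theta v w (xi *m Q).
Proof.
move=> t0 QQ; apply: (congr1 fine).
have mI := measurable_increment theta v w.
have mQ := @measurable_fun_mulmx R _ _ n n id Q (@measurable_id _ _ setT).
have mS := @measurable_unit_sphere R n.
have nullS := @surface_measure_sphere R n.
have mIE : measurable_fun setT (EFin \o increment theta v w) by exact/measurable_EFinP.
have mIQ : measurable_fun setT (EFin \o (fun xi => increment theta v w (xi *m Q))).
  by apply/measurable_EFinP; exact: (measurableT_comp mI).
have E1 := @integral_conull _ _ _ (surface_measure n) S _ mS nullS mIE.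
have E2 := @integral_conull _ _ _ (surface_measure n) S _ mS nullS mIQ.
apply: (etrans (esym E1)); apply: etrans E2.
rewrite -(integral_pushforwardT _ mQ mIE).
apply: eq_measure_integralT => A mA.
exact/esym/surface_measure_orth.
Qed.

Lemma abs_angular theta v w : 0 <= theta ->
  `|angular theta v w| <= sphere_area * (theta / 2 * enorm (v - w)).
Proof.
move=> t0; have mS := @measurable_unit_sphere R n.
have iI := integrable_increment1 v w t0.
apply: (le_trans (le_normr_Rintegral _ iI)) => //.
rewrite mulrC -[sphere_area]/(fine sphere_area%:E) -surface_unit_sphere.
rewrite -Rintegral_cst//; apply: le_Rintegral => //.
- exact: (integrable_norm iI).
- apply: (@bounded_integrable _ _ _ _ _ _ `|theta / 2 * enorm (v - w)|) => //.
  by rewrite /= surface_unit_sphere ltry.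
- by move=> xi xi1; exact: abs_increment.
Qed.

(** Pairing the azimuthal variables by [displacement_coupling]; the invariance
    of the surface measure makes this legitimate under the integral. *)
Lemma angular_sub_le theta v w v' w' : 0 <= theta ->
  angular theta v w - angular theta v' w' <=
  sphere_area * (enorm (v - v') - (phi v - phi v') +
                 theta * enorm ((v - w) - (v' - w'))).
Proof.
have arith (p q r s e c : R) : p - r <= e + c -> p - q - (r - s) <= e - (q - s) + c.
  by move=> h; lra.
move=> t0; have mS := @measurable_unit_sphere R n.
have [Q [QQ h]] := displacement_coupling (v - w) (v' - w').
rewrite (angular_orth v' w' t0 QQ) -RintegralB//; last 2 first.
- exact: integrable_increment1.
- exact: integrable_increment.
rewrite mulrC -[sphere_area]/(fine sphere_area%:E) -surface_unit_sphere.
rewrite -Rintegral_cst//; set c := (X in \int[_]_(_ in _) X); apply: le_Rintegral => //.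
- have iB := integrableB mS (integrable_increment1 v w t0) (integrable_increment v' w' t0 QQ).
  exact: iB.
- apply: (@bounded_integrable _ _ _ _ _ _ `|c|) => //.
  by rewrite /= surface_unit_sphere ltry.
- move=> xi xi1; rewrite /increment /c.
  have := h theta xi t0 xi1.
  set a := displacement (v - w) theta xi; set b := displacement _ _ _ => hab.
  apply: arith; apply: (le_trans (le_trans (ler_norm _) (lip_phi _ _))).
  by rewrite opprD addrACA (le_trans (ler_enormD _ _))// lerD2l.
Qed.

Lemma abs_angular_sub_le theta v w v' w' : 0 <= theta ->
  `|angular theta v w - angular theta v' w'| <=
  sphere_area * ((2 + theta) * (enorm (v - v') + enorm (w - w'))).
Proof.
move=> t0.
have tri : enorm ((v - w) - (v' - w')) <= enorm (v - v') + enorm (w - w').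
  rewrite (_ : v - w - (v' - w') = (v - v') - (w - w')) ?ler_enormB//.
  by apply/rowP => i; rewrite !mxE; ring.
have tri' : enorm ((v' - w') - (v - w)) <= enorm (v - v') + enorm (w - w').
  by rewrite enormBC.
have := lip_phi v v'; rewrite ler_norml => /andP[l1 l2].
have := enorm_ge0 (w - w') => ww.
have := angular_sub_le v w v' w' t0; have := angular_sub_le v' w' v w t0.
rewrite (enormBC v' v) => h1 h2; rewrite ler_norml lerNl opprB; apply/andP; split.
- apply: (le_trans h1); apply: ler_wpM2l; first exact: sphere_area_ge0.
  have := ler_wpM2l t0 tri'; lra.
- apply: (le_trans h2); apply: ler_wpM2l; first exact: sphere_area_ge0.
  have := ler_wpM2l t0 tri; lra.
Qed.

Lemma angular_lipschitz_angle theta theta' v w : 0 <= theta -> 0 <= theta' ->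
  `|angular theta v w - angular theta' v w| <=
  sphere_area * enorm (v - w) * `|theta - theta'|.
Proof.
move=> t0 t0'; have mS := @measurable_unit_sphere R n.
have i1 := integrable_increment1 v w t0; have i2 := integrable_increment1 v w t0'.
have iB : (surface_measure n).-integrable S
    (EFin \o (fun xi => increment theta v w xi - increment theta' v w xi)).
  exact: (integrableB mS i1 i2).
rewrite -RintegralB//; apply: (le_trans (le_normr_Rintegral _ iB)) => //.
rewrite mulrAC mulrC mulrA -mulrA [sphere_area * _]mulrC mulrA.
rewrite -[sphere_area]/(fine sphere_area%:E) -surface_unit_sphere.
rewrite -Rintegral_cst//; apply: le_Rintegral => //.
- exact: (integrable_norm iB).
- apply: (@bounded_integrable _ _ _ _ _ _ `|enorm (v - w) * `|theta - theta'| |) => //.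
  by rewrite /= surface_unit_sphere ltry.
- move=> xi xi1; rewrite /increment opprB addrA subrK.
  apply: (le_trans (lip_phi _ _)); rewrite opprD addrACA subrr add0r mulrC.
  exact: displacement_lipschitz_angle.
Qed.

End angular_average.

(** * Averages over all the collision angles *)

Section collision.
Context {R : realType} {n : nat}.
Variable beta : {measure set R -> \bar R}.
Hypothesis kappa_fin : (kappa1 beta < +oo)%E.
Variable phi : 'rV[R]_n.+1 -> R.
Hypothesis lip_phi : forall x y, `|phi x - phi y| <= enorm (x - y).
Implicit Types (v w : 'rV[R]_n.+1).

Local Notation D := (`]0, pi]%classic : set R).
Local Notation area := (@sphere_area R n).
Local Notation angular := (angular phi).

Definition kappa : R := fine (kappa1 beta).

Lemma pos_angle theta : D theta -> 0 <= theta.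
Proof. by rewrite /= in_itv /= => /andP[/ltW]. Qed.

Lemma kappa1_ge0 : (0 <= kappa1 beta)%E.
Proof. by apply: integral_ge0 => theta /pos_angle; rewrite lee_fin. Qed.

Lemma kappaE : kappa1 beta = kappa%:E.
Proof. by rewrite fineK// ge0_fin_numE// kappa1_ge0. Qed.

Lemma kappa_ge0 : 0 <= kappa.
Proof. exact: fine_ge0 kappa1_ge0. Qed.

Lemma integrable_angle : beta.-integrable D (EFin \o (fun theta : R => theta)).
Proof.
apply/integrableP; split.
  by apply/measurable_EFinP; exact: measurable_funTS.
rewrite (eq_integral (fun theta => theta%:E)) => [|theta]; first exact: kappa_fin.
by rewrite inE => /pos_angle t0; rewrite /= ger0_norm.
Qed.

Lemma integrable_angle_scale (c : R) :
  beta.-integrable D (EFin \o (fun theta : R => c * theta)).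
Proof. exact: (integrableZl _ c integrable_angle). Qed.

Lemma Rintegral_angle_scale (c : R) :
  \int[beta]_(theta in D) (c * theta) = c * kappa.
Proof. by rewrite RintegralZl//; exact: integrable_angle. Qed.

(** The set of the angles that contribute has finite [beta]-measure, so that the
    integral of the truncation is Lipschitz in the velocities; the integral of
    [angular] itself is only a limit of such functions. *)
Definition truncated_angular k v w theta : R :=
  if k.+1%:R^-1 <= theta then angular theta v w else 0.

Lemma measurable_angular v w : measurable_fun D (fun theta => angular theta v w).
Proof.
(* the absolute value extends the Lipschitz bound to negative angles *)
apply: (eq_measurable_fun (fun theta : R => angular `|theta| v w)).
  by move=> theta; rewrite inE => /pos_angle t0; rewrite ger0_norm.
apply: measurable_funTS; apply: continuous_measurable_fun => x.
apply/cvgrPdist_le => e e0; set c := area * enorm (v - w) + 1.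
have c0 : 0 < c by rewrite ltr_wpDl// mulr_ge0 ?sphere_area_ge0 ?enorm_ge0.
near=> y; apply: (le_trans (angular_lipschitz_angle lip_phi _ _ _ _)) => //.
apply: (@le_trans _ _ (c * `|x - y|)).
  apply: ler_pM => //; first by rewrite mulr_ge0 ?sphere_area_ge0 ?enorm_ge0.
    by rewrite lerDl.
  exact: ler_dist_dist.
rewrite mulrC -ler_pdivlMr//; near: y.
by apply: (@cvgr_dist_le _ _ _ _ _ id x) => //; rewrite divr_gt0.
Unshelve. all: by end_near. Qed.

Lemma measurable_truncated_angular k v w :
  measurable_fun D (truncated_angular k v w).
Proof.
apply: measurable_fun_if => //.
- apply: (@measurable_funTS _ _ _ _ _ (fun theta : R => k.+1%:R^-1 <= theta)).
  exact: measurable_fun_ler.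
- by apply: measurable_funS (measurable_angular v w) => // x [].
Qed.

Lemma abs_truncated_angular k v w theta : D theta ->
  `|truncated_angular k v w theta| <= area * enorm (v - w) / 2 * theta.
Proof.
move=> Dt; have t0 := pos_angle Dt; rewrite /truncated_angular.
have := abs_angular lip_phi v w t0; have := @sphere_area_ge0 R n.
have := enorm_ge0 (v - w) => r0 a0.
case: ifP => _; last by rewrite normr0 !mulr_ge0.
by move=> /le_trans; apply; rewrite le_eqVlt; apply/orP; left; apply/eqP; field.
Qed.

Lemma integrable_truncated_angular k v w :
  beta.-integrable D (EFin \o truncated_angular k v w).
Proof.
apply: (le_integrable _ _ _ (integrable_angle_scale (area * enorm (v - w) / 2))) => //.
  apply/measurable_EFinP; exact: measurable_truncated_angular.
move=> theta Dt; rewrite /= lee_fin (le_trans (abs_truncated_angular _ _ _ Dt))//.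
exact: ler_norm.
Qed.

Lemma abs_angularD v w theta : D theta ->
  `|angular theta v w| <= area * enorm (v - w) / 2 * theta.
Proof.
move=> Dt; apply: (le_trans (abs_angular lip_phi v w (pos_angle Dt))).
by rewrite le_eqVlt; apply/orP; left; apply/eqP; field.
Qed.

Lemma integrable_angular v w : beta.-integrable D (EFin \o (fun theta => angular theta v w)).
Proof.
apply: (le_integrable _ _ _ (integrable_angle_scale (area * enorm (v - w) / 2))) => //.
  apply/measurable_EFinP; exact: measurable_angular.
move=> theta Dt; rewrite /= lee_fin (le_trans (abs_angularD _ _ Dt))//.
exact: ler_norm.
Qed.

Definition deviation v w : R := \int[beta]_(theta in D) angular theta v w.

Lemma abs_deviation v w : `|deviation v w| <= kappa * (area / 2) * enorm (v - w).
Proof.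
have iA := integrable_angular v w.
apply: (le_trans (le_normr_Rintegral _ iA)) => //.
rewrite (_ : _ * _ = (area * enorm (v - w) / 2) * kappa); last by field.
rewrite -Rintegral_angle_scale; apply: le_Rintegral => //.
- exact: (integrable_norm iA).
- exact: integrable_angle_scale.
- by move=> theta; exact: abs_angularD.
Qed.

(** When [phi] realises the distance between [v] and [v'], the singular terms
    [phi v - phi v'] and [|v - v'|] cancel and the rest is of order [theta]. *)
Lemma deviation_sub_le v w v' w' : phi v - phi v' = enorm (v - v') ->
  deviation v w - deviation v' w' <=
  kappa * area * (enorm (v - v') + enorm (w - w')).
Proof.
move=> tight; have i1 := integrable_angular v w; have i2 := integrable_angular v' w'.
rewrite /deviation -RintegralB//.
rewrite (_ : kappa * _ * _ = (area * (enorm (v - v') + enorm (w - w'))) * kappa); last by ring.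
rewrite -Rintegral_angle_scale; apply: le_Rintegral => //.
- exact: (integrableB _ i1 i2).
- exact: integrable_angle_scale.
move=> theta /pos_angle t0.
apply: (le_trans (angular_sub_le lip_phi v w v' w' t0)).
rewrite tight subrr add0r -mulrA ler_wpM2l ?sphere_area_ge0// mulrC ler_wpM2r//.
rewrite (_ : v - w - (v' - w') = (v - v') - (w - w')) ?ler_enormB//.
by apply/rowP => i; rewrite !mxE; ring.
Qed.

Lemma truncated_deviation_lipschitz k v w v' w' :
  `|\int[beta]_(theta in D) truncated_angular k v w theta -
    \int[beta]_(theta in D) truncated_angular k v' w' theta| <=
  (area * (2 * k.+1%:R + 1) * kappa) * (enorm (v - v') + enorm (w - w')).
Proof.
have i1 := integrable_truncated_angular k v w.
have i2 := integrable_truncated_angular k v' w'.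
have iB := integrableB (measurable_itv _) i1 i2.
rewrite -RintegralB//; apply: (le_trans (le_normr_Rintegral _ iB)) => //.
set s := enorm (v - v') + _.
rewrite (_ : _ * kappa * s = (area * (2 * k.+1%:R + 1) * s) * kappa); last by ring.
rewrite -Rintegral_angle_scale; apply: le_Rintegral => //.
- exact: (integrable_norm iB).
- exact: integrable_angle_scale.
move=> theta /pos_angle t0; rewrite /truncated_angular.
have s0 : 0 <= s by rewrite addr_ge0 ?enorm_ge0.
case: ifPn => [kt|_]; last first.
  by rewrite subrr normr0 !mulr_ge0 ?sphere_area_ge0// addr_ge0.
apply: (le_trans (abs_angular_sub_le lip_phi v w v' w' t0)).
rewrite -!mulrA ler_wpM2l ?sphere_area_ge0//.
have : 1 <= k.+1%:R * theta.
  by rewrite mulrC -ler_pdivrMr ?mul1r// ltr0n.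
move: (k.+1%:R : R) => K h; rewrite -/s [leRHS](_ : _ = (2 * (K * theta) + theta) * s); last by ring.
by rewrite ler_wpM2r//; lra.
Qed.

Lemma measurable_deviation :
  measurable_fun setT (fun p : 'rV[R]_n.+1 * 'rV[R]_n.+1 => deviation p.1 p.2).
Proof.
apply: (@measurable_fun_cvg _ _ _ _ (fun k p =>
    \int[beta]_(theta in D) truncated_angular k p.1 p.2 theta)) => [k|[v w] _].
  apply: (@measurable_lipschitz_rV2 _ _ _ (area * (2 * k.+1%:R + 1) * kappa)).
    by rewrite !mulr_ge0 ?sphere_area_ge0 ?kappa_ge0// addr_ge0.
  by move=> x y; exact: truncated_deviation_lipschitz.
have iA := integrable_angular v w.
have /= := @dominated_convergence _ _ _ beta D (measurable_itv _)
  (fun k => EFin \o truncated_angular k v w) (EFin \o (fun theta => angular theta v w))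
  (EFin \o (fun theta => area * enorm (v - w) / 2 * theta)).
case.
- by move=> k; apply/measurable_EFinP; exact: measurable_truncated_angular.
- apply/measurable_EFinP; exact: measurable_angular.
- apply: aeW => theta; rewrite /= in_itv /= => /andP[t0 _].
  apply: cvg_near_cst; near=> k; rewrite /= /truncated_angular ifT//.
  apply: ltW; near: k.
  exact: (near_infty_natSinv_lt (PosNum t0)).
- exact: integrable_angle_scale.
- by apply: aeW => theta k Dt; rewrite /= lee_fin; exact: abs_truncated_angular.
move=> _ _ h; apply: (@fine_cvg _ _ _ _ (fun k => \int[beta]_(theta in D) (truncated_angular k v w theta)%:E)%E).
rewrite /deviation /Rintegral fineK//; exact: integrable_fin_num.
Unshelve. all: by end_near. Qed.

Lemma collision_opE (Phi : R -> R) v w :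
  collision_op Phi beta phi v w = (Phi (enorm (v - w)) * deviation v w)%:E.
Proof.
rewrite /collision_op EFinM; congr (_ * _)%E.
rewrite fineK; last exact: (integrable_fin_num _ (integrable_angular v w)).
apply: eq_integral => theta; rewrite inE => /pos_angle t0; exact: angularE.
Qed.

End collision.

(** * Exchange of mass in a coupling *)

Section density.
Local Open Scope ereal_scope.
Context {R : realType} d {T : measurableType d}.
Variables (mu : {measure set T -> \bar R}) (rho : T -> R).
Hypotheses (mrho : measurable_fun setT rho) (rho_ge0 : forall x, (0 <= rho x)%R).

Let density_fun (A : set T) : \bar R := \int[mu]_(x in A) (rho x)%:E.

Let density0 : density_fun set0 = 0.
Proof. by rewrite /density_fun integral_set0. Qed.

Let density_ge0 A : 0 <= density_fun A.
Proof. by apply: integral_ge0 => x _; rewrite lee_fin. Qed.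

Let density_sigma_additive : semi_sigma_additive density_fun.
Proof.
apply: semi_sigma_additive_nng_induced => [|x]; last by rewrite lee_fin.
exact/measurable_EFinP.
Qed.

Definition density : {measure set T -> \bar R} := HB.pack density_fun
  (isMeasure.Build _ _ _ density_fun density0 density_ge0 density_sigma_additive).

Let integral_density_indic E : measurable E ->
  \int[density]_x (\1_E x)%:E = \int[mu]_x ((\1_E x)%:E * (rho x)%:E).
Proof.
move=> mE; rewrite integral_indic// setIT /= /density_fun integral_mkcond.
apply: eq_integral => x _; rewrite patchE indicE.
by case: ifP; rewrite ?mul1e ?mul0e.
Qed.

Import HBNNSimple.

Let integral_density_nnsfun (h : {nnsfun T >-> R}) :
  \int[density]_x (h x)%:E = \int[mu]_x ((h x)%:E * (rho x)%:E).
Proof.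
under [LHS]eq_integral do rewrite fimfunE -fsumEFin//.
rewrite [LHS]ge0_integral_fsum//; last 2 first.
  - by move=> r; exact/measurable_EFinP/measurableT_comp.
  - by move=> n x _; rewrite EFinM nnfun_muleindic_ge0.
under [RHS]eq_integral.
  move=> x xD; rewrite fimfunE -fsumEFin// ge0_mule_fsuml; last first.
    by move=> r; rewrite EFinM nnfun_muleindic_ge0.
  over.
have mr r : measurable_fun setT (fun x => (r * \1_(h @^-1` [set r]) x)%:E * (rho x)%:E).
  apply: emeasurable_funM; last exact/measurable_EFinP.
  by apply/measurable_EFinP; do 2 apply/measurableT_comp => //.
rewrite [RHS]ge0_integral_fsum//; last first.
  by move=> n x _; rewrite mule_ge0 ?[0 <= (rho _)%:E]lee_fin// EFinM nnfun_muleindic_ge0.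
apply: eq_fsbigr => r /[!inE] -[t _ <-].
under [RHS]eq_integral do rewrite EFinM -muleA.
rewrite integralZl_indic_nnsfun//= integral_density_indic// ge0_integralZl//.
- apply: emeasurable_funM; last exact/measurable_EFinP.
  by apply/measurable_EFinP; exact: measurable_indic.
- by move=> x _; rewrite mule_ge0// lee_fin.
- by rewrite lee_fin.
Qed.

Lemma ge0_integral_density (f : T -> \bar R) : measurable_fun setT f ->
  (forall x, 0 <= f x) ->
  \int[density]_x f x = \int[mu]_x (f x * (rho x)%:E).
Proof.
move=> mf f0; pose f_ := nnsfun_approx measurableT mf.
have cvgf x : (EFin \o (f_ ^~ x)) n @[n --> \oo] --> f x.
  by apply: cvg_nnsfun_approx.
have ndf x (a b : nat) : (a <= b)%N -> (f_ a x)%:E <= (f_ b x)%:E.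
  by move=> ab; rewrite lee_fin; exact/lefP/nd_nnsfun_approx.
have mcd := @monotone_convergence _ _ _ density _ measurableT
  (fun n x => (f_ n x)%:E).
have mcm := @monotone_convergence _ _ _ mu _ measurableT
  (fun n x => (f_ n x)%:E * (rho x)%:E).
transitivity (limn (fun n => \int[density]_x (f_ n x)%:E)).
  rewrite -mcd => [|n|n x _|x _]; last exact: ndf.
  - by apply: eq_integral => x _; apply/esym/cvg_lim => //; exact: cvgf.
  - exact/measurable_EFinP/measurable_funTS.
  - by rewrite lee_fin.
transitivity (limn (fun n => \int[mu]_x ((f_ n x)%:E * (rho x)%:E))).
  by congr (limn _); apply/funext => n; exact: integral_density_nnsfun.
rewrite -mcm => [|n|n x _|x _ a b ab].
- apply: eq_integral => x _; apply/cvg_lim => //.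
  by apply: cvgeZr => //; exact: cvgf.
- apply: emeasurable_funM; last exact/measurable_EFinP.
  exact/measurable_EFinP/measurable_funTS.
- by rewrite mule_ge0// lee_fin.
- by apply: lee_wpmul2r; [rewrite lee_fin|exact: ndf].
Qed.

End density.

Section exchange.
Local Open Scope ereal_scope.
Context {R : realType} {d : nat}.
Let T : measurableType _ := 'rV[R]_d.
Let X : measurableType _ := (T * T)%type.
Variables (G : probability X R) (w : X * X -> R) (m : X -> R).
Hypotheses (mw : measurable_fun setT w) (w_ge0 : forall z, (0 <= w z)%R).
Hypotheses (mm : measurable_fun setT m) (m_le1 : forall x, (m x <= 1)%R).
Hypothesis w_left : forall y, \int[G]_x (w (x, y))%:E = (m y)%:E.
Hypothesis w_right : forall x, \int[G]_y (w (x, y))%:E = (m x)%:E.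

Let m_ge0 x : (0 <= m x)%R.
Proof. by rewrite -lee_fin -w_right; apply: integral_ge0 => y _; rewrite lee_fin. Qed.

Let mcompl : measurable_fun setT (fun x => 1 - m x)%R.
Proof. exact: measurable_funB. Qed.

Let compl_ge0 x : (0 <= 1 - m x)%R.
Proof. by rewrite subr_ge0. Qed.

Let exch (z : X * X) : X := (z.1.1, z.2.2).

Let mexch : measurable_fun setT exch.
Proof.
apply/measurable_fun_pairP; split => /=.
  exact: (measurableT_comp measurable_fst measurable_fst).
exact: (measurableT_comp measurable_snd measurable_snd).
Qed.

Let kept : {measure set X -> \bar R} := density G mcompl compl_ge0.
Let exchanged : {measure set X -> \bar R} :=
  pushforward_measure (density (G \x G) mw w_ge0) mexch.
Let total : {measure set X -> \bar R} := measure_add kept exchanged.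

Let integral_total (h : X -> \bar R) : measurable_fun setT h ->
  (forall x, 0 <= h x) -> \int[total]_x h x =
  \int[G]_x (h x * (1 - m x)%:E) +
  \int[G]_x \int[G]_y (h (x.1, y.2) * (w (x, y))%:E).
Proof.
move=> mh h0; rewrite ge0_integral_measure_add//; congr (_ + _).
  by rewrite ge0_integral_density.
have mhe : measurable_fun setT (h \o exch) by exact: measurableT_comp.
rewrite integral_pushforwardT// ge0_integral_density//.
rewrite fubini_tonelli1//=.
- by apply: emeasurable_funM => //; exact/measurable_EFinP.
- by move=> z; rewrite mule_ge0// lee_fin.
Qed.

Let split_mass (k : T -> \bar R) (pr : X -> T) : measurable_fun setT pr ->
  measurable_fun setT k -> (forall x, 0 <= k x) ->
  \int[G]_x (k (pr x) * (1 - m x)%:E) + \int[G]_x (k (pr x) * (m x)%:E) =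
  \int[G]_x k (pr x).
Proof.
move=> mpr mk k0; have mkp : measurable_fun setT (k \o pr) by exact: measurableT_comp.
rewrite -ge0_integralD//.
- apply: eq_integral => x _; rewrite -ge0_muleDr ?lee_fin//.
  by rewrite -EFinD subrK mule1.
- by move=> x _; rewrite mule_ge0// lee_fin.
- by apply: emeasurable_funM => //; exact/measurable_EFinP.
- by move=> x _; rewrite mule_ge0// lee_fin.
- by apply: emeasurable_funM => //; exact/measurable_EFinP.
Qed.

Let mwl x : measurable_fun setT (fun y => (w (x, y))%:E).
Proof. by apply/measurable_EFinP; exact: (measurableT_comp mw (pair1_measurable x)). Qed.

Let mwr y : measurable_fun setT (fun x => (w (x, y))%:E).
Proof. by apply/measurable_EFinP; exact: (measurableT_comp mw (pair2_measurable y)). Qed.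

Let total_fst (k : T -> \bar R) : measurable_fun setT k -> (forall x, 0 <= k x) ->
  \int[total]_x k x.1 = \int[G]_x k x.1.
Proof.
move=> mk k0; have mk1 : measurable_fun setT (fun x : X => k x.1).
  exact: (measurableT_comp mk measurable_fst).
rewrite integral_total// -[RHS](split_mass measurable_fst)//; congr (_ + _).
apply: eq_integral => x _; rewrite /= ge0_integralZl//=.
- by rewrite w_right.
- by move=> y _; rewrite lee_fin.
Qed.

Let total_snd (k : T -> \bar R) : measurable_fun setT k -> (forall x, 0 <= k x) ->
  \int[total]_x k x.2 = \int[G]_x k x.2.
Proof.
move=> mk k0; have mk2 : measurable_fun setT (fun x : X => k x.2).
  exact: (measurableT_comp mk measurable_snd).
rewrite integral_total// -[RHS](split_mass measurable_snd)//; congr (_ + _).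
have := @fubini_tonelli _ _ _ _ _ G G (fun z : X * X => k z.2.2 * (w z)%:E).
rewrite /fubini_F /fubini_G /= => ->.
- apply: eq_integral => x _; rewrite /= ge0_integralZl//=.
  + by rewrite w_left.
  + by move=> y _; rewrite lee_fin.
- apply: emeasurable_funM; last exact/measurable_EFinP.
  exact: (measurableT_comp mk2 measurable_snd).
- by move=> z; rewrite mule_ge0// lee_fin.
Qed.

Let total_pushforward (pr : X -> T) : measurable_fun setT pr ->
  (forall k : T -> \bar R, measurable_fun setT k -> (forall x, 0 <= k x) ->
    \int[total]_x k (pr x) = \int[G]_x k (pr x)) ->
  forall A, measurable A -> pushforward total pr A = pushforward G pr A.
Proof.
move=> mpr H A mA; have mpA : measurable (pr @^-1` A) by exact: measurable_preimageT.
have := H (fun x => (\1_A x)%:E) ltac:(by apply/measurable_EFinP; exact: measurable_indic)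
  ltac:(by move=> x; rewrite lee_fin).
have E (mu : {measure set X -> \bar R}) : \int[mu]_x (\1_A (pr x))%:E = mu (pr @^-1` A).
  by have := integral_indic mu measurableT mpA; rewrite setIT => <-.
by rewrite !E.
Qed.

Let total_setT : total setT = 1.
Proof.
have := total_pushforward measurable_fst total_fst measurableT.
rewrite /pushforward preimage_setT => ->.
by rewrite probability_setT.
Qed.

(** The mass [w (x, y)] is moved from the pair [x] to the pair made of the first
    component of [x] and the second one of [y].  As [w] has the same marginal
    density [m] on both sides, each component receives what it has lost. *)
Lemma exchange_coupling : exists G' : probability X R,
  (forall A : set T, measurable A -> pushforward G' fst A = pushforward G fst A /\
    pushforward G' snd A = pushforward G snd A) /\
  (forall h : X -> \bar R, measurable_fun setT h -> (forall x, 0 <= h x) ->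
    \int[G']_x h x = \int[G]_x (h x * (1 - m x)%:E) +
      \int[G]_x \int[G]_y (h (x.1, y.2) * (w (x, y))%:E)).
Proof.
pose P : probability X R :=
  HB.pack (Measure.sort total) (Measure_isProbability.Build _ _ _ total total_setT).
exists P; split; last exact: integral_total.
by move=> A mA; split; [exact: total_pushforward total_fst _ mA|
  exact: total_pushforward total_snd _ mA].
Qed.

End exchange.

(** * Potentials of cyclically monotone sets *)

Section chains.
Context {R : realType} {d : nat}.
Local Notation T := 'rV[R]_d.
Implicit Types (s : seq (T * T)) (a z : T) (p : T * T).

(** The sums whose infimum over the chains [s] is Rockafellar's potential. *)
Fixpoint chain_length a s z : R :=
  if s is p :: s' then enorm (a - p.1) - enorm (p.1 - p.2) + chain_length p.2 s' z
  else enorm (a - z).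

Lemma chain_length_rcons a s p z : chain_length a (rcons s p) z =
  chain_length a s p.1 - enorm (p.1 - p.2) + enorm (p.2 - z).
Proof. by elim: s a => [|q s IH] a //=; rewrite IH; ring. Qed.

Lemma chain_length_lipschitz a s z z' :
  chain_length a s z <= chain_length a s z' + enorm (z - z').
Proof.
elim: s a => [|q s IH] a /=.
  by rewrite (le_trans (ler_enorm_tri z' _ _))// lerD2l enormBC.
by have := IH q.2; lra.
Qed.

Variable Gamma : set (T * T).

(** Cyclical monotonicity, for an arbitrary permutation of the pairs. *)
Hypothesis Gamma_mono : forall N (p : 'I_N -> T * T) (sigma : 'I_N -> 'I_N),
  injective sigma -> (forall i, Gamma (p i)) ->
  \sum_i enorm ((p i).1 - (p i).2) <= \sum_i enorm ((p (sigma i)).1 - (p i).2).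

Let x0 : T * T := (0, 0).

Let chain_length_cons a p s z : chain_length a (p :: s) z =
  enorm (a - p.1) + enorm ((last p s).2 - z)
  + \sum_(i < size s) enorm ((nth x0 s i).1 - (nth x0 (p :: s) i).2)
  - \sum_(i < (size s).+1) enorm ((nth x0 (p :: s) i).1 - (nth x0 (p :: s) i).2).
Proof.
elim: s a p => [|q s IH] a p; first by rewrite /= big_ord0 big_ord1 /=; ring.
have -> : chain_length a (p :: q :: s) z =
  enorm (a - p.1) - enorm (p.1 - p.2) + chain_length p.2 (q :: s) z by [].
rewrite IH [X in _ = _ + X - _]big_ord_recl [X in _ = _ - X]big_ord_recl /=.
by rewrite (enormBC q.1); ring.
Qed.

Lemma chain_length_closed_ge0 a s : (forall p, p \in s -> Gamma p) ->
  0 <= chain_length a s a.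
Proof.
case: s => [|p s] sG; first by rewrite /= enorm_ge0.
rewrite chain_length_cons.
pose P (i : 'I_(size s).+1) := nth x0 (p :: s) i.
have PG i : Gamma (P i) by apply: sG; rewrite mem_nth.
have := Gamma_mono (@ordS_inj (size s).+1) PG.
rewrite [leRHS]big_ord_recr /=.
have -> : P (ordS ord_max) = p by rewrite /P /= modnn.
have -> : P ord_max = last p s by rewrite /P /= (last_nth x0).
have -> : \sum_(i < size s) enorm ((P (ordS (widen_ord (leqnSn (size s)) i))).1 -
    (P (widen_ord (leqnSn (size s)) i)).2) =
  \sum_(i < size s) enorm ((nth x0 s i).1 - (nth x0 (p :: s) i).2).
  by apply: eq_bigr => i _; rewrite /P /= modn_small// ltnS.
have := ler_enorm_tri a p.1 (last p s).2; rewrite (enormBC p.1 a) (enormBC a (last p s).2).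
by rewrite /P; lra.
Qed.

Lemma chain_length_ge a s z : (forall p, p \in s -> Gamma p) ->
  - enorm (a - z) <= chain_length a s z.
Proof.
move=> sG; have := chain_length_closed_ge0 a sG.
have := chain_length_lipschitz a s a z; lra.
Qed.

(** The potential is the shortest length of a chain of [Gamma] from the origin.
    Going through one more pair [p] of [Gamma] shows that it drops by
    [|p.1 - p.2|] from [p.1] to [p.2]; it cannot drop by more. *)
Lemma potential_of_monotone : exists phi : T -> R,
  (forall x y, `|phi x - phi y| <= enorm (x - y)) /\
  (forall p, Gamma p -> phi p.1 - phi p.2 = enorm (p.1 - p.2)).
Proof.
pose L z := [set r | exists2 s, (forall p, p \in s -> Gamma p) & r = chain_length 0 s z].
have Linf z : has_inf (L z).
  split; first by exists (chain_length 0 [::] z); exists [::].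
  by exists (- enorm (0 - z)) => _ [s sG ->]; exact: chain_length_ge.
pose phi z := inf (L z).
have phi_lip x y : phi x <= phi y + enorm (x - y).
  rewrite -lerBlDr; apply: lb_le_inf; first by have [] := Linf y.
  move=> _ [s sG ->]; rewrite lerBlDr; apply: le_trans (chain_length_lipschitz _ _ _ _).
  by apply: ge_inf; [by have [] := Linf x|exists s].
have phi_abs x y : `|phi x - phi y| <= enorm (x - y).
  rewrite ler_norml; have := phi_lip x y; have := phi_lip y x.
  by rewrite (enormBC y); lra.
exists phi; split => // p Gp; apply/le_anti/andP; split.
  by rewrite (le_trans (ler_norm _)).
rewrite lerBrDr; apply: lb_le_inf; first by have [] := Linf p.1.
move=> _ [s sG ->].
have : phi p.2 <= chain_length 0 (rcons s p) p.2.
  apply: ge_inf; first by have [] := Linf p.2.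
  exists (rcons s p) => // q; rewrite mem_rcons inE => /predU1P[->//|]; exact: sG.
by rewrite chain_length_rcons subrr enorm0; lra.
Qed.

End chains.

(** * Support of an optimal coupling *)

Section cyclical_monotonicity.
Local Open Scope ereal_scope.
Context {R : realType} {d : nat}.
Local Notation T := 'rV[R]_d.
Local Notation X := (T * T)%type.
Variable G : probability X R.

Definition transport_cost (x : X) : R := enorm (x.1 - x.2).

Lemma measurable_transport_cost : measurable_fun setT transport_cost.
Proof. by apply: measurable_fun_enorm; exact: measurable_fun_subrV. Qed.

Definition box (p : X) (e : R) : set X :=
  [set x | (enorm (x.1 - p.1) < e)%R /\ (enorm (x.2 - p.2) < e)%R].

Lemma measurable_box p e : measurable (box p e).
Proof.
rewrite (_ : box p e = (fun x : X => enorm (x.1 - p.1)) @^-1` `]-oo, e[ `&`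
                       (fun x : X => enorm (x.2 - p.2)) @^-1` `]-oo, e[).
  apply: measurableI; apply: measurable_preimageT => //;
    by apply: measurable_fun_enorm; exact: measurable_fun_subrV.
by apply/seteqP; split => x /=; rewrite !in_itv.
Qed.

Definition support : set X := [set p | forall e : R, (0 < e)%R -> 0 < G (box p e)].

Lemma support_conull : exists N : set X,
  [/\ measurable N, G N = 0 & ~` N `<=` support].
Proof.
pose B j k := box (rat_rV2 d j) (k.+1%:R^-1)%R.
pose N := \bigcup_j \bigcup_k (if G (B j k) == 0 then B j k else set0).
have mNB j k : measurable (if G (B j k) == 0 then B j k else set0).
  by case: ifP => // _; exact: measurable_box.
exists N; split.
- by apply: bigcupT_measurable => j; exact: bigcupT_measurable.
- apply/negligibleP; first by apply: bigcupT_measurable => j; exact: bigcupT_measurable.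
  apply: negligible_bigcup => j; apply: negligible_bigcup => k.
  by apply/negligibleP => //; case: ifPn => [/eqP//|_]; rewrite measure0.
- move=> p Np e e0; rewrite lt_neqAle measure_ge0 andbT eq_sym; apply/negP => Gp0.
  have [k /ltW ke] : exists k, (k.+1%:R^-1 < e / 2)%R.
    have [k _ /(_ k (leqnn k))] := near_infty_natSinv_lt (PosNum (divr_gt0 e0 (ltr0n _ 2))).
    by exists k.
  have k0 : (0 < k.+1%:R^-1 :> R)%R by rewrite invr_gt0.
  have [j hj] := rat_rV2_dense p k0.
  have pB : B j k p.
    split; apply: le_lt_trans hj; first by rewrite lerDl enorm_ge0.
    by rewrite lerDr enorm_ge0.
  apply: Np; exists j => //; exists k => //.
  have sub : B j k `<=` box p e.
    move=> x [x1 x2]; split.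
    - apply: (le_lt_trans (ler_enorm_tri (rat_rV2 d j).1 _ _)).
      have [p1 _] := pB; rewrite (enormBC (rat_rV2 d j).1).
      by move: (k.+1%:R^-1)%R ke x1 p1 => u; lra.
    - apply: (le_lt_trans (ler_enorm_tri (rat_rV2 d j).2 _ _)).
      have [_ p2] := pB; rewrite (enormBC (rat_rV2 d j).2).
      by move: (k.+1%:R^-1)%R ke x2 p2 => u; lra.
  suff -> : G (B j k) == 0 by [].
  rewrite eq_le measure_ge0 andbT -(eqP Gp0).
  by apply: le_measure => //; rewrite inE; exact: measurable_box.
Qed.

Hypothesis G_optimal : forall G' : probability X R,
  (forall A : set T, measurable A -> pushforward G' fst A = pushforward G fst A /\
    pushforward G' snd A = pushforward G snd A) ->
  \int[G]_x (transport_cost x)%:E <= \int[G']_x (transport_cost x)%:E.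
Hypothesis G_cost_fin : \int[G]_x (transport_cost x)%:E < +oo.

Lemma exchange_cost (w : X * X -> R) (m : X -> R) :
  measurable_fun setT w -> (forall z, (0 <= w z)%R) ->
  measurable_fun setT m -> (forall x, (0 <= m x <= 1)%R) ->
  (forall y, \int[G]_x (w (x, y))%:E = (m y)%:E) ->
  (forall x, \int[G]_y (w (x, y))%:E = (m x)%:E) ->
  \int[G]_x (transport_cost x * m x)%:E <=
  \int[G]_x \int[G]_y (transport_cost (x.1, y.2) * w (x, y))%:E.
Proof.
move=> mw w0 mm m01 wl wr.
have m1 x : (m x <= 1)%R by case/andP : (m01 x).
have m0 x : (0 <= m x)%R by case/andP : (m01 x).
have [G' [/G_optimal Gle G'E]] := exchange_coupling mw w0 mm m1 wl wr.
have mc := measurable_transport_cost.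
have c0 x : (0 <= transport_cost x)%R by exact: enorm_ge0.
have split_cost : \int[G]_x (transport_cost x)%:E =
    \int[G]_x (transport_cost x * (1 - m x))%:E + \int[G]_x (transport_cost x * m x)%:E.
  rewrite -ge0_integralD//.
  - by apply: eq_integral => x _; rewrite -EFinD; congr EFin; ring.
  - by move=> x _; rewrite lee_fin mulr_ge0// subr_ge0.
  - by apply/measurable_EFinP; apply: measurable_funM => //; exact: measurable_funB.
  - by move=> x _; rewrite lee_fin mulr_ge0.
  - by apply/measurable_EFinP; exact: measurable_funM.
have mcE : measurable_fun setT (fun x : X => (transport_cost x)%:E).
  exact/measurable_EFinP.
move: Gle; rewrite (G'E _ mcE)//.
rewrite split_cost => h.
have fin1 : \int[G]_x (transport_cost x * (1 - m x))%:E \is a fin_num.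
  rewrite ge0_fin_numE; last first.
    by apply: integral_ge0 => x _; rewrite lee_fin mulr_ge0// subr_ge0.
  apply: le_lt_trans G_cost_fin; rewrite split_cost leeDl//.
  by apply: integral_ge0 => x _; rewrite lee_fin mulr_ge0.
have E1 : \int[G]_x ((transport_cost x)%:E * (1 - m x)%:E) =
    \int[G]_x (transport_cost x * (1 - m x))%:E by [].
by rewrite E1 leeD2lE// in h.
Qed.

Lemma integral_sum_indic N (k : 'I_N -> R) (B : 'I_N -> set X) :
  (forall i, (0 <= k i)%R) -> (forall i, measurable (B i)) ->
  \int[G]_x (\sum_i k i * \1_(B i) x)%:E = (\sum_i k i * fine (G (B i)))%:E.
Proof.
move=> k0 mB; under eq_integral do rewrite -sumEFin.
rewrite ge0_integral_sum//; last 2 first.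
- by move=> i; apply/measurable_EFinP; apply: measurable_funM.
- by move=> i x _; rewrite lee_fin mulr_ge0.
rewrite -sumEFin; apply: eq_bigr => i _.
under eq_integral do rewrite EFinM.
rewrite ge0_integralZl ?lee_fin//; last exact/measurable_EFinP.
by rewrite integral_indic// setIT EFinM fineK// fin_num_measure.
Qed.

Lemma measurable_sum_indic N (k : 'I_N -> R) (B : 'I_N -> set X) :
  (forall i, measurable (B i)) -> measurable_fun setT (fun x => \sum_i k i * \1_(B i) x)%R.
Proof. by move=> mB; apply: measurable_sum => i; apply: measurable_funM. Qed.

(** Exchanging small masses between boxes around [p (sigma i)] and around [p i]
    cannot lower the cost of the optimal [G].  The box around [p i] gives away
    mass proportionally to the inverse of its measure, normalised by the sum
    [S] of these inverses so that at most all the mass is moved. *)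
Lemma support_monotone N (p : 'I_N -> X) (sigma : 'I_N -> 'I_N) :
  injective sigma -> (forall i, support (p i)) ->
  (\sum_i enorm ((p i).1 - (p i).2) <= \sum_i enorm ((p (sigma i)).1 - (p i).2))%R.
Proof.
move=> sigma_inj pS.
have [N0|N0] := posnP N.
  by subst N; rewrite !big_ord0.
apply/ler_addgt0Pr => e' e'0.
pose e : R := (e' / (4 * N%:R))%R.
have e0 : (0 < e)%R by rewrite divr_gt0// mulr_gt0// ltr0n.
pose B i := box (p i) e.
have mB i : measurable (B i) by exact: measurable_box.
have mBs i : measurable ((B \o sigma) i) by exact: mB.
pose b i := fine (G (B i)).
have b0 i : (0 < b i)%R.
  by rewrite fine_gt0// pS//= -ge0_fin_numE// fin_num_measure.
pose S := (\sum_i (b i)^-1)%R.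
have S0 : (0 < S)%R.
  rewrite /S (bigD1 (Ordinal N0))//= ltr_pwDl ?invr_gt0//.
  by apply: sumr_ge0 => i _; rewrite invr_ge0 ltW.
pose c := S^-1%R.
have c0 : (0 < c)%R by rewrite invr_gt0.
pose m (x : X) : R := (\sum_i (c / b i) * \1_(B i) x)%R.
pose w (z : X * X) : R :=
  (\sum_i (c / (b (sigma i) * b i)) * \1_(B (sigma i)) z.1 * \1_(B i) z.2)%R.
have kw0 i : (0 <= c / (b (sigma i) * b i))%R by rewrite divr_ge0 ?mulr_ge0 ?ltW.
have i01 (A : set X) x : (0 <= (\1_A x : R) <= 1)%R by rewrite indicE; case: (_ \in _); rewrite /= ?lexx ?ler01.
have i0 (A : set X) x : (0 <= (\1_A x : R))%R by case/andP : (i01 A x).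
have i1 (A : set X) x : ((\1_A x : R) <= 1)%R by case/andP : (i01 A x).
have km0 i : (0 <= c / b i)%R by rewrite divr_ge0 ?ltW.
have m01 x : (0 <= m x <= 1)%R.
  apply/andP; split.
    by apply: sumr_ge0 => i _; rewrite mulr_ge0 ?i0.
  apply: (@le_trans _ _ (\sum_i c / b i)%R).
    by apply: ler_sum => i _; rewrite ler_piMr ?i1.
  by rewrite -mulr_sumr mulVf ?gt_eqF.
have w_ge0 z : (0 <= w z)%R.
  by apply: sumr_ge0 => i _; apply: mulr_ge0 (i0 _ _); apply: mulr_ge0 (kw0 i) (i0 _ _).
have mw : measurable_fun setT w.
  apply: measurable_sum => i; apply: measurable_funM; first apply: measurable_funM => //.
    exact: (measurableT_comp (measurable_indic (mB (sigma i))) measurable_fst).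
  exact: (measurableT_comp (measurable_indic (mB i)) measurable_snd).
have wl y : \int[G]_x (w (x, y))%:E = (m y)%:E.
  transitivity (\int[G]_x (\sum_i (c / (b (sigma i) * b i) * \1_(B i) y) * \1_(B (sigma i)) x)%:E).
    by apply: eq_integral => x _; congr EFin; apply: eq_bigr => i _; rewrite mulrAC.
  rewrite (@integral_sum_indic _ _ (B \o sigma))//; last first.
    by move=> i; rewrite mulr_ge0 ?i0.
  congr EFin; apply: eq_bigr => i _; rewrite /= -/(b (sigma i)).
  by field; rewrite !gt_eqF.
have wr x : \int[G]_y (w (x, y))%:E = (m x)%:E.
  transitivity (\int[G]_y (\sum_i (c / (b (sigma i) * b i) * \1_(B (sigma i)) x) * \1_(B i) y)%:E).
    by [].
  rewrite integral_sum_indic//; last first.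
    by move=> i; rewrite mulr_ge0 ?i0.
  congr EFin; rewrite /m [RHS](reindex_inj sigma_inj) /=.
  apply: eq_bigr => i _; rewrite -/(b i).
  by field; rewrite !gt_eqF.
have mm : measurable_fun setT m by exact: measurable_sum_indic.
have key := exchange_cost mw w_ge0 mm m01 wl wr.
have N_R : (N%:R = \sum_(i < N) 1 :> R)%R by rewrite sumr_const card_ord.
have int_m : \int[G]_x (m x)%:E = (c * N%:R)%:E.
  rewrite integral_sum_indic//; congr EFin; rewrite N_R mulr_sumr.
  by apply: eq_bigr => i _; rewrite -/(b i) mulr1 divfK ?gt_eqF.
have mc := measurable_transport_cost.
have cost0 x : (0 <= transport_cost x)%R by exact: enorm_ge0.
have m0 x : (0 <= m x)%R by case/andP : (m01 x).
have lower : (c * \sum_i enorm ((p i).1 - (p i).2))%:E <=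
    \int[G]_x (transport_cost x * m x)%:E + (2 * e * (c * N%:R))%:E.
  rewrite (_ : c * _ = \sum_i (enorm ((p i).1 - (p i).2) * (c / b i)) * fine (G (B i)))%R; last first.
    by rewrite mulr_sumr; apply: eq_bigr => i _; rewrite -/(b i); field; rewrite gt_eqF.
  rewrite -integral_sum_indic//; last by move=> i; rewrite mulr_ge0 ?enorm_ge0.
  rewrite EFinM -int_m -ge0_integralZl//; last 3 first.
  - exact/measurable_EFinP.
  - by move=> x _; rewrite lee_fin.
  - by rewrite lee_fin mulr_ge0// ltW.
  rewrite -ge0_integralD//; last 4 first.
  - by move=> x _; rewrite lee_fin mulr_ge0.
  - by apply/measurable_EFinP; exact: measurable_funM.
  - by move=> x _; rewrite -EFinM lee_fin mulr_ge0// mulr_ge0// ltW.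
  - by apply/measurable_EFinP; exact: measurable_funM.
  under [leRHS]eq_integral do rewrite -EFinM -EFinD.
  apply: ge0_le_integral => //.
  - move=> x _; rewrite lee_fin; apply: sumr_ge0 => i _; apply: mulr_ge0 (i0 _ _).
    exact: mulr_ge0 (enorm_ge0 _) (km0 i).
  - by apply/measurable_EFinP; exact: measurable_sum_indic.
  - by apply/measurable_EFinP; apply: measurable_funD; exact: measurable_funM.
  move=> x _; rewrite lee_fin -mulrDl mulr_sumr; apply: ler_sum => i _.
  rewrite indicE; case: (boolP (x \in B i)) => [|_]; last by rewrite !mulr0.
  rewrite inE => -[x1 x2].
  rewrite !mulr1; apply: ler_wpM2r => //.
  rewrite /transport_cost.
  have := ler_enorm_tri x.1 (p i).1 (p i).2; have := ler_enorm_tri x.2 x.1 (p i).2.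
  by rewrite (enormBC (p i).1 x.1); lra.
have upper : \int[G]_x \int[G]_y (transport_cost (x.1, y.2) * w (x, y))%:E <=
    (c * \sum_i (enorm ((p (sigma i)).1 - (p i).2) + 2 * e))%:E.
  pose a i := (enorm ((p (sigma i)).1 - (p i).2) + 2 * e)%R.
  have a0 i : (0 <= a i)%R by rewrite addr_ge0 ?enorm_ge0// mulr_ge0// ltW.
  have pointwise x y : (transport_cost (x.1, y.2) * w (x, y) <=
     \sum_i (a i * (c / (b (sigma i) * b i)) * \1_(B (sigma i)) x) * \1_(B i) y)%R.
    rewrite mulr_sumr; apply: ler_sum => i _ /=; rewrite !indicE.
    case: (boolP (x \in B (sigma i))) => [|_]; last by rewrite !(mulr0, mul0r).
    case: (boolP (y \in B i)) => [|_]; last by rewrite !(mulr0, mul0r).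
    rewrite !inE => -[_ y2] [x1 _]; rewrite !mulr1; apply: ler_wpM2r => //.
    rewrite /transport_cost /a /=.
    have := ler_enorm_tri (p (sigma i)).1 x.1 y.2.
    have := ler_enorm_tri (p i).2 (p (sigma i)).1 y.2.
    by rewrite (enormBC (p i).2 y.2); lra.
  have mwc x : measurable_fun setT (fun y : X => (transport_cost (x.1, y.2) * w (x, y))%:E).
    apply/measurable_EFinP; apply: measurable_funM.
      apply: measurable_fun_enorm; apply: measurable_fun_subrV.
        exact: measurable_cst.
      exact: measurable_snd.
    exact: (measurableT_comp mw (pair1_measurable x)).
  apply: (@le_trans _ _ (\int[G]_x (\sum_i (a i * (c / b (sigma i))) * \1_(B (sigma i)) x)%:E)).
    apply: ge0_le_integral => //.
    + by move=> x _; apply: integral_ge0 => y _; rewrite lee_fin mulr_ge0.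
    + apply: (@measurable_fun_fubini_tonelli_F _ _ _ _ _ G
        (fun z : X * X => (transport_cost (z.1.1, z.2.2) * w z)%:E)).
        2: by move=> z; rewrite lee_fin mulr_ge0.
      apply/measurable_EFinP; apply: measurable_funM => //.
      apply: measurable_fun_enorm; apply: measurable_fun_subrV.
        exact: (measurableT_comp measurable_fst measurable_fst).
      exact: (measurableT_comp measurable_snd measurable_snd).
    + by apply/measurable_EFinP; apply: (@measurable_sum_indic _ _ (B \o sigma)).
    move=> x _.
    apply: (@le_trans _ _ (\int[G]_y
      (\sum_i (a i * (c / (b (sigma i) * b i)) * \1_(B (sigma i)) x) * \1_(B i) y)%:E)).
      apply: ge0_le_integral => //.
      * by move=> y _; rewrite lee_fin mulr_ge0.
      * by apply/measurable_EFinP; exact: measurable_sum_indic.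
      * by move=> y _; rewrite lee_fin.
    rewrite integral_sum_indic//; last first.
      by move=> i; apply: mulr_ge0 (i0 _ _); exact: mulr_ge0.
    rewrite lee_fin le_eqVlt; apply/orP; left; apply/eqP; apply: eq_bigr => i _.
    by rewrite -/(b i); field; rewrite !gt_eqF.
  rewrite (@integral_sum_indic _ _ (B \o sigma))//; last first.
    by move=> i; apply: mulr_ge0 => //; apply: divr_ge0; exact: ltW.
  rewrite lee_fin mulr_sumr le_eqVlt; apply/orP; left; apply/eqP; apply: eq_bigr => i _.
  by rewrite /= -/(b (sigma i)) /a; field; rewrite !gt_eqF.
have := le_trans lower (leeD (le_trans key upper) (lexx _)).
rewrite -EFinD lee_fin big_split /= sumr_const card_ord -mulr_natr.
have e'E : (e' = 4 * e * N%:R)%R by rewrite /e; field; rewrite pnatr_eq0 -lt0n N0.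
move=> h; rewrite -(ler_pM2l c0); apply: (le_trans h).
by rewrite e'E le_eqVlt; apply/orP; left; apply/eqP; ring.
Qed.

Lemma kantorovich_potential : exists phi : T -> R,
  (forall x y, (`|phi x - phi y| <= enorm (x - y))%R) /\
  exists N : set X, [/\ measurable N, G N = 0 &
    forall x, ~ N x -> (phi x.1 - phi x.2 = enorm (x.1 - x.2))%R].
Proof.
have [phi [lip tight]] := potential_of_monotone support_monotone.
exists phi; split => //; have [N [mN N0 NS]] := support_conull.
by exists N; split => // x /NS; exact: tight.
Qed.

End cyclical_monotonicity.

(** * Growth estimates from left derivatives *)

Section growth.
Local Open Scope ereal_scope.
Context {R : realType}.
Let mu : {measure set _ -> \bar R} := @lebesgue_measure R.

Let mu_cc (x y : R) : (x <= y)%R -> mu `[x, y]%classic = (y - x)%:E.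
Proof.
move=> xy; have := lebesgue_measure_itv `[x, y]; rewrite /= lte_fin => ->.
have [xy'|yx] := ltP x y; first by rewrite -EFinB.
by rewrite (le_anti (introT andP (conj xy yx))) subrr.
Qed.

Let mu_oc (x y : R) : (x <= y)%R -> mu `]x, y]%classic = (y - x)%:E.
Proof.
move=> xy; have := lebesgue_measure_itv `]x, y]; rewrite /= lte_fin => ->.
have [xy'|yx] := ltP x y; first by rewrite -EFinB.
by rewrite (le_anti (introT andP (conj xy yx))) subrr.
Qed.

Lemma ge0_integral_itv_split (u : R -> \bar R) (x y z : R) :
  measurable_fun setT u -> (forall t, 0 <= u t) -> (x <= y <= z)%R ->
  \int[mu]_(t in `]x, z]) u t =
  \int[mu]_(t in `]x, y]) u t + \int[mu]_(t in `]y, z]) u t.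
Proof.
move=> mu' u0 /andP[xy yz].
rewrite (@itv_bndbnd_setU _ _ (BRight x) (BRight y) (BRight z))//.
apply: ge0_integral_setU => //.
  exact: measurable_funTS.
apply/disj_setPS => t [/=]; rewrite !in_itv /= => /andP[_ ty] /andP[yt _].
by move: (lt_le_trans yt ty); rewrite ltxx.
Qed.

(** Vitali-Caratheodory: the majorant is the sum over [n] of [e] times the
    indicator of an open set that approximates the level set [K >= n * e] from
    outside.  The level [n = 0] raises it strictly above [K]. *)
Lemma vitali_caratheodory (a b : R) (K : R -> \bar R) (e : R) : (a <= b)%R ->
  measurable_fun setT K -> (forall t, 0 <= K t) -> (0 < e)%R ->
  exists u : R -> \bar R, [/\ measurable_fun setT u, forall t, 0 <= u t,
    \int[mu]_(t in `]a, b]) u t <= \int[mu]_(t in `[a, b]) K t + (e * (b - a) + e * e)%:E &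
    forall (t D : R), t \in `[a, b] -> D%:E <= K t ->
      exists2 c : R, (0 <= c)%R /\ (D < c)%R & \forall s \near t, c%:E <= u s].
Proof.
move=> ab mK K0 e0.
pose E n := `[a, b]%classic `&` [set t | (n%:R * e)%:E <= K t].
have mE n : measurable (E n).
  apply: measurableI => //.
  rewrite (_ : [set _ | _] = K @^-1` `[(n%:R * e)%:E, +oo]).
    by apply: measurable_preimageT => //; exact: emeasurable_itv.
  by apply/seteqP; split => t /=; rewrite in_itv /= ?leey ?andbT.
have Efin n : mu (E n) < +oo.
  apply: (@le_lt_trans _ _ (mu `[a, b]%classic)).
    by apply: le_measure; [exact: mem_set (mE n)|exact: mem_set|exact: subIsetl].
  by rewrite mu_cc// ltry.
have d0 n : (0 < e / (2 ^ n.+1)%:R)%R by rewrite divr_gt0// ltr0n expn_gt0.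
pose O n := projT1 (cid (lebesgue_regularity_outer (mE n) (Efin n) (d0 n))).
have OP n : [/\ open (O n), E n `<=` O n & mu (O n `\` E n) < (e / (2 ^ n.+1)%:R)%:E].
  exact: (projT2 (cid (lebesgue_regularity_outer (mE n) (Efin n) (d0 n)))).
have mO n : measurable (O n) by apply: open_measurable; have [] := OP n.
have term0 (A : (set R)^nat) n t : 0 <= (e * \1_(A n) t)%:E.
  by rewrite lee_fin mulr_ge0// ltW.
pose u t := \sum_(n <oo) (e * \1_(O n) t)%:E.
have u0 t : 0 <= u t by apply: nneseries_ge0 => n _ _; exact: term0.
have mterm (A : (set R)^nat) : (forall n, measurable (A n)) ->
    forall n, measurable_fun setT (fun t => (e * \1_(A n) t)%:E).
  by move=> mA n; apply/measurable_EFinP; exact: measurable_funM.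
have mu_u : measurable_fun setT u.
  by apply: ge0_emeasurable_sum => [n t _ _|n _]; [exact: term0|exact: mterm].
have int_term (A : (set R)^nat) : (forall n, measurable (A n)) ->
    \int[mu]_t \sum_(n <oo) (e * \1_(A n) t)%:E = \sum_(n <oo) e%:E * mu (A n).
  move=> mA; rewrite integral_nneseries//; last exact: mterm.
  apply: eq_eseriesr => n _; under eq_integral do rewrite EFinM.
  rewrite ge0_integralZl ?lee_fin ?(ltW e0)//; last first.
    by apply/measurable_EFinP; exact: (measurable_indic (mA n)).
  rewrite (integral_indic mu measurableT (mA n)); congr (_ * mu _); exact: setIT.
have leE t n : (\sum_(0 <= i < n) e * \1_(E i) t)%:E <= (n%:R * e)%:E.
  rewrite lee_fin; elim: n => [|n IH]; first by rewrite big_nil mul0r.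
  by rewrite big_nat_recr//= -natr1 mulrDl mul1r lerD// ler_piMr ?(ltW e0)// indicE.
have leK t : \sum_(n <oo) (e * \1_(E n) t)%:E <=
    (if t \in `[a, b] then K t + e%:E else 0).
  apply: lime_le; first by apply: is_cvg_ereal_nneg_natsum => n _; exact: term0.
  apply: nearW => n; rewrite sumEFin; elim: n => [|n IH].
    rewrite big_nil; case: ifP => // _; apply: adde_ge0 => //.
    by rewrite lee_fin ltW.
  rewrite big_nat_recr//= EFinD; have [tE|tE] := boolP (t \in E n); last first.
    by rewrite indicE (negbTE tE) mulr0 adde0.
  move: (tE); rewrite inE => -[/= -> nK].
  rewrite indicE tE mulr1 leeD//; exact: le_trans (leE t n) nK.
exists u; split => //.
- apply: (@le_trans _ _ (\int[mu]_t u t)).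
    by apply: ge0_subset_integral.
  rewrite int_term//.
  apply: (@le_trans _ _ (\sum_(n <oo) (e%:E * mu (E n) + (e * e / (2 ^ n.+1)%:R)%:E))).
    apply: lee_nneseries => [n _ _|n _].
      by rewrite mule_ge0// lee_fin ltW.
    rewrite -mulrA EFinM -ge0_muleDr ?lee_fin ?(ltW (d0 n))//.
    apply: lee_wpmul2l; first by rewrite lee_fin ltW.
    have [_ EO h] := OP n.
    have mOE : measurable (O n `\` E n) by exact: measurableD (mO n) (mE n).
    have OE0 : (O n `\` E n) `&` E n = set0 by rewrite setDE -setIA setICl setI0.
    rewrite -(setDKU EO) (measureU mu mOE (mE n) OE0).
    by rewrite addeC leeD// ltW.
  have eE0 : forall k, 0 <= e%:E * mu (E k) by move=> k; rewrite mule_ge0// lee_fin ltW.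
  apply: (le_trans (epsilon_trick xpredT eE0 (mulr_ge0 (ltW e0) (ltW e0)))).
  rewrite EFinD addeA leeD// -int_term//.
  apply: (@le_trans _ _ (\int[mu]_(t in `[a, b]) (K t + e%:E))).
    rewrite [leRHS]integral_mkcond; apply: ge0_le_integral => //.
    + by move=> t _; apply: nneseries_ge0 => n _ _; exact: term0.
    + by apply: ge0_emeasurable_sum => [n t _ _|n _]; [exact: term0|exact: mterm].
    + apply/(measurable_restrictT _ (measurable_itv _)); apply: measurable_funTS.
      by apply: emeasurable_funD => //; exact: measurable_cst.
    + by move=> t _; rewrite patchE; apply: (le_trans (leK t)); rewrite mem_setE.
  rewrite ge0_integralD//; last 2 first.
  - exact: measurable_funTS.
  - by move=> t _; rewrite lee_fin ltW.
  by rewrite leeD// integral_cst// mu_cc.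
- move=> t D tab DK.
  have [m mD mK'] : exists2 m : nat, (D < m%:R * e)%R & forall n, (n < m)%N -> E n t.
    have [D0|D0] := ltP D 0%R; first by exists 0%N; rewrite ?mul0r.
    have De0 : (0 <= D / e)%R by rewrite divr_ge0// ltW.
    exists (Num.trunc (D / e)).+1.
      by rewrite -ltr_pdivrMr// -truncn_lt_nat.
    move=> n; rewrite ltnS => nm; split => //=.
    apply: le_trans DK; rewrite lee_fin -ler_pdivlMr//.
    by rewrite -truncn_ge_nat.
  exists (m%:R * e)%R; first by split => //; rewrite mulr_ge0 ?ler0n ?(ltW e0).
  have near_all : \forall s \near t, forall n, (n < m)%N -> O n s.
    elim: m {mD} mK' => [_|m IH mK']; first by exists 1%R => //= s _ k; rewrite ltn0.
    have h1 := IH (fun n nm => mK' n (ltnW nm)).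
    have h2 : \forall s \near t, O m s.
      by apply: open_nbhs_nbhs; have [Oo EO _] := OP m; split => //; exact/EO/mK'.
    apply: filterS (filterI h1 h2) => s [s1 s2] n.
    by rewrite ltnS leq_eqVlt => /predU1P[->//|]; exact: s1.
  apply: filterS near_all => s sO.
  have term0' : forall n, (0 <= n)%N -> xpredT n -> 0 <= (e * \1_(O n) s)%:E.
    by move=> n _ _; exact: term0.
  apply: le_trans (nneseries_lim_ge m term0').
  rewrite sumEFin lee_fin -[X in (X%:R * _ <= _)%R]subn0 -[X in (X * _ <= _)%R]sumr_const_nat.
  rewrite mulr_suml le_eqVlt; apply/orP; left; apply/eqP.
  apply: eq_big_nat => i /andP[_ im]; rewrite mul1r indicE mem_set ?mulr1//.
  exact: sO.
Qed.

(** Immediately to the left of any time, [h] grows less than the integral of a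
    lower semicontinuous majorant of [K].  Therefore the least time from which
    the growth up to [b] is controlled by that integral cannot be later than
    [a]. *)
Lemma growth_le_integral (a b : R) (h : R -> R) (K : R -> \bar R) : (a <= b)%R ->
  measurable_fun setT K -> (forall t, 0 <= K t) ->
  (forall c, (a <= c < b)%R -> forall eta : R, (0 < eta)%R ->
    exists2 del : R, (0 < del)%R &
    forall x, (c < x < c + del)%R -> (x <= b)%R -> (h x <= h c + eta)%R) ->
  (forall t, (a < t <= b)%R -> exists2 D : R, D%:E <= K t &
    forall eta : R, (0 < eta)%R -> exists2 del : R, (0 < del)%R &
    forall s, (a <= s)%R -> (t - del < s < t)%R -> (h t - h s <= (D + eta) * (t - s))%R) ->
  (h b - h a)%:E <= \int[mu]_(t in `[a, b]) K t.
Proof.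
move=> ab mK K0 no_jump slope.
apply/lee_addgt0Pr => e' e'0.
pose e : R := (Num.min 1 (e' / (b - a + 1)))%R.
have ba0 : (0 < b - a + 1)%R by lra.
have e0 : (0 < e)%R by rewrite lt_min ltr01 divr_gt0.
have e1 : (e <= 1)%R by rewrite ge_min lexx.
have ee' : (e * (b - a + 1) <= e')%R by rewrite -ler_pdivlMr// ge_min lexx orbT.
have [u [mu_u u0 int_u u_lsc]] := vitali_caratheodory ab mK K0 e0.
apply: (@le_trans _ _ (\int[mu]_(t in `]a, b]) u t)); last first.
  apply: (le_trans int_u); rewrite leeD// lee_fin; nra.
pose V x := \int[mu]_(t in `]x, b]) u t.
pose S := [set x | (a <= x <= b)%R /\ forall y, (x <= y <= b)%R -> (h b - h y)%:E <= V y].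
have V0 x : 0 <= V x by apply: integral_ge0.
have Sb : S b.
  split; first by rewrite ab lexx.
  by move=> y /le_anti <-; rewrite subrr.
have infS : has_inf S.
  by split; [exists b|exists a => x -[/andP[]]].
pose c := inf S.
have ac : (a <= c)%R by apply: lb_le_inf; [exists b|move=> x -[/andP[]]].
have cb : (c <= b)%R by apply: ge_inf => //; exact: infS.2.
have above y : (c < y <= b)%R -> (h b - h y)%:E <= V y.
  move=> /andP[cy yb].
  have [x [_ Sx] xy] := inf_adherent (eps := (y - c)%R) ltac:(by rewrite subr_gt0) infS.
  by apply: Sx; rewrite yb andbT ltW// (lt_le_trans xy)// addrC subrK.
have Sc : S c.
  split; first by rewrite ac.
  move=> y /andP[]; rewrite le_eqVlt => /predU1P[<- _|cy yb]; last first.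
    by apply: above; rewrite cy.
  move: cb; rewrite le_eqVlt => /predU1P[cb|cb]; first by rewrite cb subrr.
  apply/lee_addgt0Pr => eta eta0.
  have [|del del0 hdel] := no_jump c _ eta eta0; first by rewrite ac.
  pose x := (Num.min (c + del / 2) b)%R.
  have cx : (c < x)%R by rewrite lt_min cb ltrDl divr_gt0.
  have xb : (x <= b)%R by rewrite ge_min lexx orbT.
  have xdel : (x < c + del)%R.
    by rewrite gt_min; apply/orP; left; lra.
  have hx : (h x <= h c + eta)%R by apply: hdel => //; rewrite cx.
  have : (h b - h x)%:E <= V x by apply: above; rewrite cx.
  have VV : V x <= V c.
    by rewrite /V (@ge0_integral_itv_split u c x b)// ?leeDr// ?integral_ge0// (ltW cx).
  move=> /le_trans/(_ VV) hV.
  apply: (@le_trans _ _ ((h b - h x)%:E + eta%:E)); last exact: leeD.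
  by rewrite -EFinD lee_fin; lra.
have [ca|ca] := eqVneq c a.
  by have := Sc.2 a; rewrite ca ab lexx; apply.
have {ca} ac' : (a < c)%R by rewrite lt_neqAle eq_sym ca.
have [|D DK hD] := slope c; first by rewrite ac'.
have [|k [k0 Dk] near_u] := u_lsc c D _ DK; first by rewrite in_itv /= ac.
have eta0 : (0 < k - D)%R by rewrite subr_gt0.
have [del1 del10 hdel1] := hD _ eta0.
move: near_u => /nbhs_ballP[del2 /= del20 hdel2].
pose del := Num.min del1 del2.
have del0 : (0 < del)%R by rewrite lt_min del10.
have below s : (a <= s)%R -> (c - del < s < c)%R -> (h b - h s)%:E <= V s.
  move=> as_ /andP[ds sc].
  have sdel1 : (c - del1 < s < c)%R.
    rewrite sc andbT; apply: le_lt_trans ds; rewrite lerB// ge_min lexx//.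
  have h1 := hdel1 s as_ sdel1.
  rewrite (_ : D + _ = k)%R in h1; last by ring.
  rewrite /V (@ge0_integral_itv_split u s c b)// ?(ltW sc)//.
  rewrite (_ : h b - h s = (h c - h s) + (h b - h c))%R; last by ring.
  rewrite EFinD; apply: leeD; last by apply: Sc.2; rewrite lexx.
  apply: (@le_trans _ _ (\int[mu]_(t in `]s, c]) k%:E)).
    by rewrite integral_cst// mu_oc ?(ltW sc)// -EFinM lee_fin.
  apply: ge0_le_integral => //.
  - exact: measurable_funTS.
  - move=> t /=; rewrite in_itv /= => /andP[st tc]; apply: hdel2.
    rewrite /ball /= ger0_norm ?subr_ge0//.
    have : (del <= del2)%R by rewrite ge_min lexx orbT.
    by lra.
pose s := (Num.max a (c - del / 2))%R.
have as_ : (a <= s)%R by rewrite le_max lexx.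
have sc : (s < c)%R by rewrite gt_max ac' /=; lra.
have : S s.
  split; first by rewrite as_ (le_trans (ltW sc)).
  move=> y /andP[sy yb]; have [cy|yc] := leP c y.
    by apply: Sc.2; rewrite cy.
  apply: below; first exact: le_trans sy.
  rewrite yc andbT; apply: lt_le_trans sy; rewrite lt_max; apply/orP; right; lra.
move=> /(ge_inf infS.2); rewrite -/c leNgt sc//.
Qed.

End growth.

Section dini.
Local Open Scope ereal_scope.
Context {R : realType}.
Variable F : R -> R.
Hypothesis contF : continuous F.

Let step (j : nat) : R := ratr (odflt 0%R (unpickle j : option rat)).

Let slope (m j : nat) (t : R) : \bar R :=
  if (0 < step j < m.+1%:R^-1)%R then ((F t - F (t - step j)) / step j)%:E else -oo.

(** The upper left derivative of [F], computed along rational increments so as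
    to be visibly measurable. *)
Definition left_dini (t : R) : \bar R :=
  einfs (fun m => esups (fun j => slope m j t) 0%N) 0%N.

Lemma measurable_left_dini : measurable_fun setT left_dini.
Proof.
apply: measurable_fun_einfs => m; apply: measurable_fun_esups => j.
rewrite /slope; case: (0 < step j < m.+1%:R^-1)%R; last exact: measurable_cst.
apply/measurable_EFinP; apply: measurable_funM => //; apply: measurable_funB.
  exact: continuous_measurable_fun.
by apply: (measurableT_comp (continuous_measurable_fun contF)); exact: measurable_funB.
Qed.

Lemma left_dini_le (t M del : R) : (0 < del)%R ->
  (forall q, (0 < q < del)%R -> (F t - F (t - q) <= M * q)%R) ->
  left_dini t <= M%:E.
Proof.
move=> del0 h.
have [m md] : exists m : nat, (m.+1%:R^-1 < del)%R.
  have [m _ /(_ m (leqnn m))] := near_infty_natSinv_lt (PosNum del0).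
  by exists m.
apply: (@le_trans _ _ (esups (fun j => slope m j t) 0%N)).
  by apply: ereal_inf_lbound; exists m.
apply: ge_ereal_sup => _ [j _ <-]; rewrite /slope; case: ifPn => [/andP[q0 qm]|_]; last by rewrite leNye.
by rewrite lee_fin ler_pdivrMr// h// q0 (lt_trans qm).
Qed.

Lemma left_diniP (t M : R) : left_dini t < M%:E ->
  exists2 del : R, (0 < del)%R &
  forall q, (0 < q < del)%R -> (F t - F (t - q) <= M * q)%R.
Proof.
move=> /ereal_inf_lt[_ [m _ <-] slopeM].
exists (m.+1%:R^-1)%R; first by rewrite invr_gt0.
have rational j : (0 < step j < m.+1%:R^-1)%R -> (F t - F (t - step j) <= M * step j)%R.
  move=> js; have : slope m j t <= M%:E.
    by apply: le_trans (ltW slopeM); apply: ereal_sup_ubound; exists j.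
  by rewrite /slope js lee_fin; case/andP: js => j0 _; rewrite ler_pdivrMr.
move=> q /andP[q0 qm]; apply/ler_addgt0Pr => e e0.
(* the rationals approximate [q], and [F (t - _)] and [M * _] are continuous *)
have cont : continuous (fun x : R => (M * x + F (t - x))%R).
  move=> x; apply: cvgD; first by apply: cvgM => //; exact: cvg_cst.
  apply: (@continuous_comp _ _ _ (fun y : R => (t - y)%R) F); last exact: contF.
  by apply: cvgB => //; exact: cvg_cst.
have near_q : \forall x \near q, (`|(M * q + F (t - q)) - (M * x + F (t - x))| <= e)%R.
  by have /cvgrPdist_le := cont q; apply.
have near_q' : \forall x \near q, (0 < x < m.+1%:R^-1)%R.
  apply: filterS (filterI (lt_nbhsr q0) (lt_nbhsl qm)) => x [/= x0 xm].
  by rewrite x0.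
have [del /= del0 hdel] := (nbhs_ballP _ _).1 (filterI near_q near_q').
have [||x [xq [r _ rx]]] := @dense_rat R (ball q del).
- by exists q; exact: ballxx.
- exact: ball_open.
have [h1 h2] := hdel x xq.
have rj : step (pickle r) = x by rewrite /step pickleK.
have := rational (pickle r); rewrite rj => /(_ h2).
move: h1; rewrite ler_norml => /andP[h1 h1']; lra.
Qed.

Lemma growth_le_integral_dini (a b : R) : (a <= b)%R ->
  (forall t, (a < t <= b)%R -> left_dini t < +oo) ->
  (F b - F a)%:E <= \int[lebesgue_measure]_(t in `[a, b]) maxe (left_dini t) 0.
Proof.
move=> ab dfin; apply: growth_le_integral => //.
- by apply: measurable_maxe => //; exact: measurable_left_dini.
- by move=> t; rewrite le_max lexx orbT.
- move=> c _ eta eta0.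
  have : \forall x \near c, (`|F c - F x| <= eta)%R.
    by have /cvgrPdist_le := @contF c; apply.
  move=> /nbhs_ballP[del /= del0 hdel]; exists del => // x /andP[cx xd] _.
  have : ball c del x by rewrite /ball /= ltr0_norm ?subr_lt0//; lra.
  by move=> /hdel; rewrite ler_norml => /andP[]; lra.
- move=> t tab; have Kfin : maxe (left_dini t) 0 \is a fin_num.
    by rewrite ge0_fin_numE ?le_max ?lexx ?orbT// gt_max dfin// ltry.
  exists (fine (maxe (left_dini t) 0)); first by rewrite fineK.
  move=> eta eta0.
  have : left_dini t < (fine (maxe (left_dini t) 0) + eta)%:E.
    rewrite EFinD fineK//; apply: (@le_lt_trans _ _ (maxe (left_dini t) 0)).
      by rewrite le_max lexx.
    by rewrite lteDl// lte_fin.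
  move=> /left_diniP[del del0 hdel]; exists del => // s _ /andP[ds st].
  have := hdel (t - s)%R; rewrite subKr; apply; apply/andP; split; lra.
Qed.

End dini.

(** * Weak solutions along Lipschitz test functions *)

Section family_measurability.
Local Open Scope ereal_scope.
Context {R : realType} dX dY {X : measurableType dX} {Y : measurableType dY}.

Lemma measurable_integral_family (l : X -> probability Y R) (k : X * Y -> \bar R) :
  (forall U, measurable U -> measurable_fun setT (fun x => l x U)) ->
  measurable_fun setT k -> (forall z, 0 <= k z) ->
  measurable_fun setT (fun x => \int[l x]_y k (x, y)).
Proof.
move=> ml mk k0.
pose l' : X -> {measure set Y -> \bar R} := fun x => l x.
pose K0 : R.-ker X ~> Y := HB.pack l' (isKernel.Build _ _ _ _ _ l' ml).
pose K : R.-pker X ~> Y := HB.pack (Kernel.sort K0)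
  (Kernel_isProbability.Build _ _ _ _ _ (Kernel.sort K0) (fun x => probability_setT (l x))).
exact: (@measurable_fun_integral_sfinite_kernel _ _ _ _ _ k K k0 mk).
Qed.

(** The integral of a nonnegative function is a supremum over the simple
    functions below it, hence monotone on all nonnegative functions, measurable
    or not.  This is for the time integral of the theorem, as the optimal
    couplings may depend on time in any way. *)
Lemma ge0_le_lower_integral (m : {measure set X -> \bar R}) (D : set X)
    (f g : X -> \bar R) :
  (forall x, D x -> 0 <= f x) -> (forall x, D x -> f x <= g x) ->
  \int[m]_(x in D) f x <= \int[m]_(x in D) g x.
Proof.
move=> f0 fg; have g0 x : D x -> 0 <= g x by move=> Dx; exact: le_trans (f0 x Dx) (fg x Dx).
rewrite !ge0_integralE//; apply: le_ereal_sup => _ [h /= hf <-].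
exists h => //= x; apply: (le_trans (hf x)); rewrite !patchE; case: ifPn => // xD.
by apply: fg; exact: set_mem.
Qed.

End family_measurability.

Section weak_solution_facts.
Context {R : realType} {n : nat}.
Local Notation V := 'rV[R]_n.+1.
Variables (T : R) (Phi : R -> R).
Hypothesis Phi_ge0 : forall r : R, 0 <= r -> 0 <= Phi r.
Hypothesis mPhi : measurable_fun (`[0, +oo[ : set R) Phi.
Variable beta : {measure set R -> \bar R}.
Hypothesis kappa_fin : (kappa1 beta < +oo)%E.
Implicit Types (f : R -> probability V R) (phi : V -> R) (v w : V).

Definition rate v w : R := Phi (enorm (v - w)) * enorm (v - w).

Lemma Phi_enorm_ge0 v : 0 <= Phi (enorm v).
Proof. by apply: Phi_ge0; exact: enorm_ge0. Qed.

Lemma rate_ge0 v w : 0 <= rate v w.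
Proof. by rewrite mulr_ge0 ?Phi_enorm_ge0 ?enorm_ge0. Qed.

Lemma measurable_Phi_enorm d (X : measurableType d) (g : X -> V) :
  measurable_fun setT g -> measurable_fun setT (fun x => Phi (enorm (g x))).
Proof.
move=> mg; have mgn := measurable_fun_enorm mg.
apply: (measurable_comp (measurable_itv _) _ mPhi mgn).
by move=> _ [x _ <-] /=; rewrite in_itv /= andbT enorm_ge0.
Qed.

Lemma measurable_rate : measurable_fun setT (fun p : V * V => rate p.1 p.2).
Proof.
have md : measurable_fun setT (fun p : V * V => p.1 - p.2) by exact: measurable_fun_subrV.
by apply: measurable_funM; [exact: measurable_Phi_enorm|exact: measurable_fun_enorm].
Qed.

Definition mean_rate f (t : R) : \bar R :=
  (\int[f t]_v \int[f t]_w (rate v w)%:E)%E.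

Lemma mean_rate_ge0 f t : (0 <= mean_rate f t)%E.
Proof.
by apply: integral_ge0 => v _; apply: integral_ge0 => w _; rewrite lee_fin rate_ge0.
Qed.

(** A weak solution is measurable in time on [0, T] only; the freezing makes it a
    probability kernel on the whole line. *)
Definition stopped f (t : R) : probability V R := if t \in `[0, T] then f t else f 0.

Lemma measurable_stopped f : Linfty_P1 T f ->
  forall U, measurable U -> measurable_fun setT (fun t => stopped f t U).
Proof.
move=> [mf _] U mU.
rewrite (_ : (fun t => _) = (fun t => if t \in `[0, T] then f t U else f 0 U)); last first.
  by apply/funext => t; rewrite /stopped; case: ifP.
apply: measurable_fun_if => //.
- apply: (measurable_fun_bool true) => //.
  by rewrite [X in measurable X](_ : _ = `[0, T]%classic)// setTI.
- by rewrite [X in measurable_fun X](_ : _ = `[0, T]%classic) ?setTI//; exact: mf.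
Qed.

Lemma measurable_mean_rate f : Linfty_P1 T f ->
  measurable_fun setT (mean_rate (stopped f)).
Proof.
move=> /measurable_stopped mf.
have mfp d (X : measurableType d) U : measurable U ->
  measurable_fun setT (fun z : R * X => stopped f z.1 U).
  by move=> mU; exact: (measurableT_comp (mf U mU) measurable_fst).
have m1 : measurable_fun setT (fun z : R * V => \int[stopped f z.1]_w (rate z.2 w)%:E)%E.
  apply: (@measurable_integral_family _ _ _ _ _ (fun z : R * V => stopped f z.1)
    (fun z : (R * V) * V => (rate z.1.2 z.2)%:E)).
  - by move=> U; exact: mfp.
  - apply/measurable_EFinP.
    apply: (measurableT_comp measurable_rate (g := fun z : (R * V) * V => (z.1.2, z.2))).
    apply/measurable_fun_pairP; split => /=; last exact: measurable_snd.
    exact: (measurableT_comp measurable_snd measurable_fst).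
  - by move=> z; rewrite lee_fin rate_ge0.
apply: (@measurable_integral_family _ _ _ _ _ (stopped f)
    (fun z : R * V => \int[stopped f z.1]_w (rate z.2 w)%:E)%E) => //.
by move=> z; apply: integral_ge0 => w _; rewrite lee_fin rate_ge0.
Qed.

Lemma mean_rate_stopped f t : t \in `[0, T] -> mean_rate (stopped f) t = mean_rate f t.
Proof. by move=> tT; rewrite /mean_rate /stopped tT. Qed.

Definition mobility : R := kappa beta * (@sphere_area R n / 2).

Lemma mobility_ge0 : 0 <= mobility.
Proof. by rewrite mulr_ge0 ?kappa_ge0// divr_ge0 ?sphere_area_ge0. Qed.

Lemma abs_collision phi v w : (forall x y, `|phi x - phi y| <= enorm (x - y)) ->
  (`|collision_op Phi beta phi v w| <= (mobility * rate v w)%:E)%E.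
Proof.
move=> lip; rewrite collision_opE// lee_fin normrM ger0_norm ?Phi_enorm_ge0//.
rewrite /rate mulrCA ler_wpM2l ?Phi_enorm_ge0//.
exact: abs_deviation.
Qed.

Lemma measurable_collision phi : (forall x y, `|phi x - phi y| <= enorm (x - y)) ->
  measurable_fun setT (fun p : V * V => collision_op Phi beta phi p.1 p.2).
Proof.
move=> lip; under eq_fun do rewrite collision_opE//.
apply/measurable_EFinP; apply: measurable_funM; last exact: measurable_deviation.
by apply: measurable_Phi_enorm; exact: measurable_fun_subrV.
Qed.

End weak_solution_facts.

Section test_functions.
Context {R : realType} {n : nat}.
Local Notation V := 'rV[R]_n.+1.
Variables (T : R) (Phi : R -> R).
Hypothesis Phi_ge0 : forall r : R, 0 <= r -> 0 <= Phi r.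
Hypothesis mPhi : measurable_fun (`[0, +oo[ : set R) Phi.
Variable beta : {measure set R -> \bar R}.
Hypothesis kappa_fin : (kappa1 beta < +oo)%E.
Implicit Types (f : R -> probability V R) (phi : V -> R) (v w : V).

Local Notation mobility := (@mobility R n beta).
Local Notation lip1 phi := (forall x y : V, `|phi x - phi y| <= enorm (x - y)).
Local Notation mean_rate := (mean_rate Phi).
Local Notation stopped := (stopped T).

Definition mean f phi (t : R) : R := \int[f t]_v phi v.

Definition first_order (F : R -> R) (l t : R) : Prop :=
  forall eta : R, 0 < eta -> exists2 del : R, 0 < del &
  forall s, s \in `[0, T] -> `|s - t| < del ->
    `|F s - F t - l * (s - t)| <= eta * `|s - t|.

Lemma first_order_of_quotient (F : R -> R) (l t : R) :
  ((F s - F t) / (s - t)) @[s --> within `[0, T]%classic t^'] --> l ->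
  first_order F l t.
Proof.
move=> /cvgrPdist_le h eta eta0.
have := h eta eta0; rewrite near_withinE near_withinE => /nbhs_ballP[del /= del0 hdel].
exists del => // s sT st.
have [->|s_t] := eqVneq s t; first by rewrite !subrr mulr0 subrr normr0 mulr0.
have st0 : s - t != 0 by rewrite subr_eq0.
have := hdel s; rewrite /ball /= distrC => /(_ st s_t sT).
rewrite distrC => hq; rewrite -(ler_pM2r (_ : 0 < `|s - t|)) ?normr_gt0// in hq.
apply: le_trans hq; rewrite -normrM mulrBl divfK//.
Qed.

Lemma first_orderB (F1 F2 : R -> R) (l1 l2 t : R) : first_order F1 l1 t ->
  first_order F2 l2 t -> first_order (fun s => F1 s - F2 s) (l1 - l2) t.
Proof.
move=> h1 h2 eta eta0; have eta2 : 0 < eta / 2 by rewrite divr_gt0.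
have [d1 d10 hd1] := h1 _ eta2; have [d2 d20 hd2] := h2 _ eta2.
exists (Num.min d1 d2); first by rewrite lt_min d10.
move=> s sT; rewrite lt_min => /andP[/(hd1 s sT) + /(hd2 s sT)].
rewrite !ler_norml => /andP[a1 a2] /andP[b1 b2]; apply/andP; split; lra.
Qed.

Lemma first_order_left (F : R -> R) (l t : R) : first_order F l t ->
  forall eta : R, 0 < eta -> exists2 del : R, 0 < del &
  forall s, s \in `[0, T] -> t - del < s < t -> F t - F s <= (l + eta) * (t - s).
Proof.
move=> h eta /h[del del0 hdel]; exists del => // s sT /andP[ds st].
have := hdel s sT; rewrite ltr0_norm ?subr_lt0// => /(_ ltac:(lra)).
by rewrite ler_norml => /andP[h1 h2]; nra.
Qed.

Lemma first_order_right (F : R -> R) (l t : R) : first_order F l t ->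
  forall eta : R, 0 < eta -> exists2 del : R, 0 < del &
  forall x, x \in `[0, T] -> t < x < t + del -> F x <= F t + eta.
Proof.
move=> h eta eta0; have [del del0 hdel] := h 1 ltr01.
have l1 : 0 < `|l| + 1 by rewrite ltr_wpDl.
exists (Num.min del (eta / (`|l| + 1))); first by rewrite lt_min del0 divr_gt0.
move=> x xT /andP[tx]; rewrite addrC -ltrBlDr lt_min ltr_pdivlMr// => /andP[xd xe].
have := hdel x xT; rewrite gtr0_norm ?subr_gt0// => /(_ xd).
rewrite ler_norml => /andP[_ h2].
have := ler_norm l => ll; nra.
Qed.

Lemma measurable_mean_collision (P : probability V R) phi : lip1 phi ->
  measurable_fun setT (fun v => \int[P]_w collision_op Phi beta phi v w)%E.
Proof.
move=> lip; have mc := measurable_collision mPhi kappa_fin lip.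
rewrite (_ : (fun v => _) = (fun v =>
   \int[P]_w ((fun z : V * V => collision_op Phi beta phi z.1 z.2)^\+ (v, w)) -
   \int[P]_w ((fun z : V * V => collision_op Phi beta phi z.1 z.2)^\- (v, w))))%E.
  apply: emeasurable_funB.
    apply: (@measurable_fun_fubini_tonelli_F _ _ _ _ _ P) => //.
    exact: measurable_funepos.
  apply: (@measurable_fun_fubini_tonelli_F _ _ _ _ _ P) => //.
  exact: measurable_funeneg.
apply/funext => v; rewrite integralE; congr (_ - _)%E.
  by apply: eq_integral => w _; rewrite !funeposE.
by apply: eq_integral => w _; rewrite !funenegE.
Qed.

Lemma weak_solution_derivative f phi : weak_solution T Phi beta f -> lip1 phi ->
  forall t, t \in `[0, T] -> exists l : R,
    [/\ (l%:E = \int[f t]_v \int[f t]_w collision_op Phi beta phi v w)%E,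
        (`|l|%:E <= mobility%:E * mean_rate f t)%E
      & first_order (mean f phi) l t].
Proof.
move=> [_ _ wf] lip t tT.
have Lphi : Lip phi by exists 1 => x y; rewrite mul1r.
have [l lE dl] := wf phi Lphi t tT; exists l; split => //; last first.
  exact: first_order_of_quotient.
have mc := measurable_collision mPhi kappa_fin lip.
have mcv v : measurable_fun setT (fun w => collision_op Phi beta phi v w).
  exact: (measurableT_comp mc (pair1_measurable v)).
have mr := @measurable_rate R n Phi mPhi.
have mrv v : measurable_fun setT (fun w => (rate Phi v w)%:E).
  by apply/measurable_EFinP; exact: (measurableT_comp mr (pair1_measurable v)).
have r0 v w : (0 <= (rate Phi v w)%:E)%E by rewrite lee_fin rate_ge0.
have m0 : (0 <= mobility%:E)%E by rewrite lee_fin mobility_ge0.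
have mout : measurable_fun setT (fun v => \int[f t]_w (rate Phi v w)%:E)%E.
  apply: (@measurable_fun_fubini_tonelli_F _ _ _ _ _ (f t)
    (fun z : V * V => (rate Phi z.1 z.2)%:E)) => //.
  by apply/measurable_EFinP.
have mcol := measurable_mean_collision (f t) lip.
rewrite -abse_EFin lE.
apply: (@le_trans _ _ (\int[f t]_v `|\int[f t]_w collision_op Phi beta phi v w|)%E).
  exact: le_abse_integral.
rewrite /mean_rate -ge0_integralZl//; last by move=> v _; exact: integral_ge0.
apply: ge0_le_integral => //.
- exact: measurableT_comp.
- exact: emeasurable_funM.
move=> v _; apply: (le_trans (le_abse_integral _ _ _)) => //.
rewrite -ge0_integralZl//.
apply: ge0_le_integral => //.
- exact: measurableT_comp.
- exact: emeasurable_funM.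
by move=> w _; rewrite -EFinM; exact: abs_collision.
Qed.

End test_functions.

(** * The distance between two solutions *)

Section coupled_solutions.
Context {R : realType} {n : nat}.
Local Notation V := 'rV[R]_n.+1.
Variables (T : R) (Phi : R -> R).
Hypothesis Phi_ge0 : forall r : R, 0 <= r -> 0 <= Phi r.
Hypothesis mPhi : measurable_fun (`[0, +oo[ : set R) Phi.
Variable beta : {measure set R -> \bar R}.
Hypothesis kappa_fin : (kappa1 beta < +oo)%E.

Local Notation mobility := (@mobility R n beta).
Local Notation lip1 phi := (forall x y : V, `|phi x - phi y| <= enorm (x - y)).
Local Notation mean_rate := (@mean_rate R n Phi).
Local Notation stopped := (@stopped R n T).

Lemma lip1N (phi : V -> R) : lip1 phi -> lip1 (fun x => - phi x).
Proof. by move=> lip x y; rewrite -opprD normrN; exact: lip. Qed.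

Lemma m1_fin (f : R -> probability V R) t : Linfty_P1 T f -> t \in `[0, T] ->
  (\int[f t]_v (enorm v)%:E < +oo)%E.
Proof.
move=> [_ supm] tT; apply: le_lt_trans supm.
by apply: ereal_sup_ubound; exists t.
Qed.

Lemma integrable_lip1 (f : R -> probability V R) t (phi : V -> R) :
  Linfty_P1 T f -> t \in `[0, T] -> lip1 phi ->
  (f t).-integrable setT (EFin \o phi).
Proof.
move=> fP tT lip; have mphi := measurable_lip1 lip.
have men := @measurable_enorm R n.+1.
apply: (@le_integrable _ _ _ _ _ _ _ (EFin \o (fun v : V => `|phi 0| + enorm v))) => //.
- exact/measurable_EFinP.
- move=> v _; rewrite /= lee_fin (le_trans _ (ler_norm _))//.
  have := lip v 0; rewrite subr0 => lv.
  by rewrite -[phi v](subrK (phi 0)) (le_trans (ler_normD _ _))// addrC lerD2l.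
have i1 : (f t).-integrable setT (EFin \o cst `|phi 0|).
  exact: finite_measure_integrable_cst.
have i2 : (f t).-integrable setT (EFin \o (@enorm R n.+1)).
  apply/integrableP; split; first exact/measurable_EFinP.
  under eq_integral do rewrite /= ger0_norm ?enorm_ge0//.
  exact: m1_fin.
exact: (integrableD measurableT i1 i2).
Qed.

Lemma mean_growth f (phi : V -> R) a b : weak_solution T Phi beta f -> lip1 phi ->
  0 <= a -> a <= b -> b <= T ->
  ((mean f phi b - mean f phi a)%:E <=
   \int[lebesgue_measure]_(t in `[a, b]) (mobility%:E * mean_rate (stopped f) t))%E.
Proof.
move=> wf lip a0 ab bT.
have fP : Linfty_P1 T f by case: wf.
have inT t : a <= t <= b -> t \in `[0, T].
  by move=> /andP[at_ tb]; rewrite in_itv /= (le_trans a0 at_) (le_trans tb bT).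
apply: growth_le_integral => //.
- by apply: emeasurable_funM => //; exact: measurable_mean_rate.
- by move=> t; rewrite mule_ge0// ?lee_fin ?mobility_ge0// mean_rate_ge0.
- move=> c /andP[ac cb] eta eta0.
  have [|l [_ _ fo]] := weak_solution_derivative Phi_ge0 mPhi kappa_fin wf lip (t := c).
    by rewrite inT// ac ltW.
  have [del del0 hdel] := first_order_right fo eta0.
  exists del => // x cx xb; apply: hdel => //; apply: inT.
  by case/andP: cx => cx _; rewrite xb (le_trans ac)// ltW.
- move=> t /andP[at_ tb].
  have tT : t \in `[0, T] by rewrite inT// tb ltW.
  have [l [_ lb fo]] := weak_solution_derivative Phi_ge0 mPhi kappa_fin wf lip tT.
  exists l; first by rewrite mean_rate_stopped// (le_trans _ lb)// lee_fin ler_norm.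
  move=> eta eta0; have [del del0 hdel] := first_order_left fo eta0.
  exists del => // s as_ st; apply: hdel => //; apply: inT; rewrite as_ /=.
  by case/andP: st => _ st; rewrite (le_trans (ltW st)).
Qed.

Variables (f ft : R -> probability V R) (G : R -> probability (V * V)%type R).
Hypothesis wf : weak_solution T Phi beta f.
Hypothesis wft : weak_solution T Phi beta ft.
Hypothesis G_opt : forall s, s \in `[0, T] -> coupling (f s) (ft s) (G s) /\
  (d1 (f s) (ft s) = \int[G s]_x (enorm (x.1 - x.2)%R)%:E)%E.

Let fP : Linfty_P1 T f. Proof. by case: wf. Qed.
Let ftP : Linfty_P1 T ft. Proof. by case: wft. Qed.

Lemma integral_fst t (k : V -> \bar R) : t \in `[0, T] -> measurable_fun setT k ->
  (\int[f t]_v k v = \int[G t]_x k x.1)%E.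
Proof.
move=> tT mk; have [GC _] := G_opt tT.
rewrite -(integral_pushforwardT (G t) measurable_fst mk).
by apply: eq_measure_integralT => A mA; have [E _] := GC A mA; exact: esym E.
Qed.

Lemma integral_snd t (k : V -> \bar R) : t \in `[0, T] -> measurable_fun setT k ->
  (\int[ft t]_v k v = \int[G t]_x k x.2)%E.
Proof.
move=> tT mk; have [GC _] := G_opt tT.
rewrite -(integral_pushforwardT (G t) measurable_snd mk).
by apply: eq_measure_integralT => A mA; have [_ E] := GC A mA; exact: esym E.
Qed.

Lemma cost_fin t : t \in `[0, T] -> (\int[G t]_x (transport_cost x)%:E < +oo)%E.
Proof.
move=> tT; have men := @measurable_enorm R n.+1.
have men1 : measurable_fun setT (fun x : V * V => (enorm x.1)%:E).
  by apply/measurable_EFinP; exact: (measurableT_comp men measurable_fst).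
have men2 : measurable_fun setT (fun x : V * V => (enorm x.2)%:E).
  by apply/measurable_EFinP; exact: (measurableT_comp men measurable_snd).
apply: (@le_lt_trans _ _ (\int[G t]_x ((enorm x.1)%:E + (enorm x.2)%:E))%E).
  apply: ge0_le_integral => //.
  - by move=> x _; rewrite lee_fin enorm_ge0.
  - by apply/measurable_EFinP; exact: measurable_transport_cost.
  - exact: emeasurable_funD.
  - by move=> x _; rewrite -EFinD lee_fin ler_enormB.
rewrite ge0_integralD//; last 2 first.
- by move=> x _; rewrite lee_fin enorm_ge0.
- by move=> x _; rewrite lee_fin enorm_ge0.
have mk : measurable_fun setT (fun v : V => (enorm v)%:E) by exact/measurable_EFinP.
rewrite -(integral_fst tT mk) -(integral_snd tT mk).
by rewrite lte_add_pinfty// m1_fin.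
Qed.

Definition distance t : R := fine (d1 (f t) (ft t)).

Lemma distanceE t : t \in `[0, T] -> d1 (f t) (ft t) = (distance t)%:E.
Proof.
move=> tT; have [_ d1E] := G_opt tT.
rewrite fineK// d1E ge0_fin_numE; first exact: cost_fin.
by apply: integral_ge0 => x _; rewrite lee_fin enorm_ge0.
Qed.

Lemma distance_cost t : t \in `[0, T] ->
  ((distance t)%:E = \int[G t]_x (transport_cost x)%:E)%E.
Proof. by move=> tT; rewrite -distanceE//; have [_] := G_opt tT. Qed.

Lemma integrable_cost t : t \in `[0, T] ->
  (G t).-integrable setT (EFin \o (@transport_cost R n.+1)).
Proof.
move=> tT; apply/integrableP; split.
  by apply/measurable_EFinP; exact: measurable_transport_cost.
under eq_integral do rewrite /= ger0_norm ?enorm_ge0//.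
exact: cost_fin.
Qed.

Lemma mean_diff t (phi : V -> R) : t \in `[0, T] -> lip1 phi ->
  (G t).-integrable setT (EFin \o (fun x => phi x.1 - phi x.2)) /\
  mean f phi t - mean ft phi t = \int[G t]_x (phi x.1 - phi x.2).
Proof.
move=> tT lip; have mphi := measurable_lip1 lip.
have mphiE : measurable_fun setT (EFin \o phi) by exact/measurable_EFinP.
have i1 : (G t).-integrable setT (EFin \o (fun x => phi x.1)).
  apply/integrableP; split.
    by apply/measurable_EFinP; exact: (measurableT_comp mphi measurable_fst).
  have mk : measurable_fun setT (fun v : V => `|(phi v)%:E|)%E by exact: measurableT_comp.
  rewrite -(integral_fst tT mk).
  by have /integrableP[] := integrable_lip1 fP tT lip.
have i2 : (G t).-integrable setT (EFin \o (fun x => phi x.2)).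
  apply/integrableP; split.
    by apply/measurable_EFinP; exact: (measurableT_comp mphi measurable_snd).
  have mk : measurable_fun setT (fun v : V => `|(phi v)%:E|)%E by exact: measurableT_comp.
  rewrite -(integral_snd tT mk).
  by have /integrableP[] := integrable_lip1 ftP tT lip.
split; first exact: (integrableB _ i1 i2).
rewrite RintegralB//; congr (_ - _); rewrite /mean /Rintegral; congr fine.
  exact: integral_fst.
exact: integral_snd.
Qed.

Lemma distance_dual_le t (phi : V -> R) : t \in `[0, T] -> lip1 phi ->
  mean f phi t - mean ft phi t <= distance t.
Proof.
move=> tT lip; have [ip ->] := mean_diff tT lip.
rewrite -lee_fin distance_cost// /Rintegral fineK; last exact: integrable_fin_num.
apply: le_integral => //; first exact: integrable_cost.
by move=> x _; rewrite /= lee_fin (le_trans (ler_norm _)).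
Qed.

Lemma distance_dual_eq t : t \in `[0, T] -> exists phi : V -> R,
  [/\ lip1 phi, mean f phi t - mean ft phi t = distance t &
   exists N : set (V * V), [/\ measurable N, G t N = 0%E &
    forall x, ~ N x -> phi x.1 - phi x.2 = enorm (x.1 - x.2)]].
Proof.
move=> tT; have [GC d1E] := G_opt tT.
have [phi [lip [N [mN N0 tight]]]] : exists phi : V -> R, lip1 phi /\
  exists N : set (V * V), [/\ measurable N, G t N = 0%E &
    forall x, ~ N x -> phi x.1 - phi x.2 = enorm (x.1 - x.2)].
  apply: kantorovich_potential; last exact: cost_fin.
  move=> G' G'E; rewrite -distance_cost// -distanceE// /d1.
  apply: ereal_inf_lbound; exists G' => // A mA.
  by have [-> ->] := G'E A mA; exact: GC.
exists phi; split => //; last by exists N.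
have [ip ->] := mean_diff tT lip.
apply: EFin_inj; rewrite distance_cost// /Rintegral fineK; last exact: integrable_fin_num.
apply: ae_eq_integral => //.
- by case/integrableP: ip.
- by apply/measurable_EFinP; exact: measurable_transport_cost.
exists N; split => // x /= h; apply: contrapT => Nx; apply: h => _.
by congr EFin; exact: tight.
Qed.

Definition total_rate t : \bar R :=
  (mobility%:E * mean_rate (stopped f) t + mobility%:E * mean_rate (stopped ft) t)%E.

Lemma measurable_total_rate : measurable_fun setT total_rate.
Proof.
by apply: emeasurable_funD; apply: emeasurable_funM => //; exact: measurable_mean_rate.
Qed.

(** The potential that is optimal at one end bounds the distance from below at
    the other end; the sign of the difference decides which end to take. *)
Lemma distance_growth a b : 0 <= a -> a <= b -> b <= T ->
  (`|distance b - distance a|%:E <=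
   \int[lebesgue_measure]_(t in `[a, b]) total_rate t)%E.
Proof.
move=> a0 ab bT.
have aT : a \in `[0, T] by rewrite in_itv /= a0 (le_trans ab).
have bT' : b \in `[0, T] by rewrite in_itv /= bT (le_trans a0).
have split_rate : (\int[lebesgue_measure]_(t in `[a, b]) total_rate t =
   \int[lebesgue_measure]_(t in `[a, b]) (mobility%:E * mean_rate (stopped f) t) +
   \int[lebesgue_measure]_(t in `[a, b]) (mobility%:E * mean_rate (stopped ft) t))%E.
  rewrite ge0_integralD//.
  - by move=> t _; rewrite mule_ge0// ?lee_fin ?mobility_ge0// mean_rate_ge0.
  - by apply: measurable_funTS; apply: emeasurable_funM => //; exact: measurable_mean_rate.
  - by move=> t _; rewrite mule_ge0// ?lee_fin ?mobility_ge0// mean_rate_ge0.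
  - by apply: measurable_funTS; apply: emeasurable_funM => //; exact: measurable_mean_rate.
have meanN g (phi : V -> R) t : Linfty_P1 T g -> t \in `[0, T] -> lip1 phi ->
    mean g (fun x => - phi x) t = - mean g phi t.
  move=> gP tT lip; rewrite /mean -mulN1r -RintegralZl//; last exact: integrable_lip1.
  by apply: eq_Rintegral => x _; rewrite mulN1r.
have [phi [lip phib _]] := distance_dual_eq bT'.
have [psi [lip' psia _]] := distance_dual_eq aT.
have up : ((distance b - distance a)%:E <=
    \int[lebesgue_measure]_(t in `[a, b]) total_rate t)%E.
  rewrite split_rate; apply: (@le_trans _ _ ((mean f phi b - mean f phi a)%:E +
      (mean ft (fun x => - phi x) b - mean ft (fun x => - phi x) a)%:E)%E).
    rewrite -EFinD lee_fin !meanN//.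
    by have := distance_dual_le aT lip; lra.
  by apply: leeD; apply: mean_growth => //; exact: lip1N.
have down : ((distance a - distance b)%:E <=
    \int[lebesgue_measure]_(t in `[a, b]) total_rate t)%E.
  rewrite split_rate; apply: (@le_trans _ _ ((mean f (fun x => - psi x) b - mean f (fun x => - psi x) a)%:E +
      (mean ft psi b - mean ft psi a)%:E)%E).
    rewrite -EFinD lee_fin !meanN//.
    by have := distance_dual_le bT' lip'; lra.
  by apply: leeD; apply: mean_growth => //; exact: lip1N.
by case: (ger0P (distance b - distance a)) => _ //; rewrite opprB.
Qed.

End coupled_solutions.

(** * Comparison of the generators on an optimal potential *)

Section dominated_integrals.
Local Open Scope ereal_scope.
Context {R : realType} d {Z : measurableType d}.
Variable mu : {measure set Z -> \bar R}.
Implicit Types (a b c r : Z -> R).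

(** As [b] and [b'] have the same integral, their weights add up to 4, which is
    at most 8. *)
Lemma integral_weights a b b' : measurable_fun setT a -> measurable_fun setT b ->
  measurable_fun setT b' -> (forall z, 0 <= a z)%R -> (forall z, 0 <= b z)%R ->
  (forall z, 0 <= b' z)%R -> \int[mu]_z (b' z)%:E = \int[mu]_z (b z)%:E ->
  \int[mu]_z (2 * b z + 2 * b' z + a z)%:E <= \int[mu]_z (8 * b z + a z)%:E.
Proof.
move=> ma mb mb' a0 b0 b'0 bb'.
have scale (k : R) (h : Z -> R) : (0 <= k)%R -> measurable_fun setT h ->
    (forall z, 0 <= h z)%R ->
    \int[mu]_z (k * h z)%:E = k%:E * \int[mu]_z (h z)%:E.
  move=> k0 mh h0; under eq_integral do rewrite EFinM.
  rewrite ge0_integralZl//; first exact/measurable_EFinP.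
  by move=> z _; rewrite lee_fin.
have add (h g : Z -> R) : measurable_fun setT h -> measurable_fun setT g ->
    (forall z, 0 <= h z)%R -> (forall z, 0 <= g z)%R ->
    \int[mu]_z (h z + g z)%:E = \int[mu]_z (h z)%:E + \int[mu]_z (g z)%:E.
  move=> mh mg h0 g0; under eq_integral do rewrite EFinD.
  rewrite ge0_integralD//.
  - by move=> z _; rewrite lee_fin.
  - exact/measurable_EFinP.
  - by move=> z _; rewrite lee_fin.
  - exact/measurable_EFinP.
have mZ (k : R) (h : Z -> R) : measurable_fun setT h -> measurable_fun setT (fun z => k * h z)%R.
  by move=> mh; exact: measurable_funM.
have p2 (h : Z -> R) : (forall z, 0 <= h z)%R -> forall z, (0 <= 2 * h z)%R.
  by move=> h0 z; rewrite mulr_ge0.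
have p8 (h : Z -> R) : (forall z, 0 <= h z)%R -> forall z, (0 <= 8 * h z)%R.
  by move=> h0 z; rewrite mulr_ge0.
have m22 : measurable_fun setT (fun z => 2 * b z + 2 * b' z)%R.
  by apply: measurable_funD; exact: mZ.
have p22 z : (0 <= 2 * b z + 2 * b' z)%R by rewrite addr_ge0 ?p2.
rewrite (add _ _ m22 ma p22 a0) (add _ _ (mZ 8%R _ mb) ma (p8 _ b0) a0) leeD2r//.
rewrite (add _ _ (mZ 2%R _ mb) (mZ 2%R _ mb') (p2 _ b0) (p2 _ b'0)) !scale// bb'.
rewrite -ge0_muleDl ?lee_fin//; apply: lee_wpmul2r.
  by apply: integral_ge0 => z _; rewrite lee_fin.
by rewrite -EFinD lee_fin; lra.
Qed.

Lemma dominated_integrable c r (M : R) : (0 <= M)%R -> measurable_fun setT c ->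
  measurable_fun setT r -> (forall z, (0 <= r z)%R) ->
  (forall z, (`|c z| <= M * r z)%R) ->
  \int[mu]_z (r z)%:E < +oo -> mu.-integrable setT (EFin \o c).
Proof.
move=> M0 mc mr r0 cr rfin.
have ir : mu.-integrable setT (EFin \o r).
  apply/integrableP; split; first exact/measurable_EFinP.
  by under eq_integral do rewrite /= ger0_norm//.
apply: (le_integrable _ _ _ (integrableZl measurableT M ir)) => //.
  exact/measurable_EFinP.
by move=> z _; rewrite /= lee_fin (le_trans (cr z))// ler_norm.
Qed.

Lemma integral_sub_le c1 c2 b (M : R) (N : set Z) : (0 <= M)%R ->
  mu.-integrable setT (EFin \o c1) -> mu.-integrable setT (EFin \o c2) ->
  measurable_fun setT b -> (forall z, (0 <= b z)%R) -> measurable N -> mu N = 0 ->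
  (forall z, ~ N z -> (c1 z - c2 z <= M * b z)%R) ->
  \int[mu]_z (c1 z)%:E - \int[mu]_z (c2 z)%:E <= M%:E * \int[mu]_z (b z)%:E.
Proof.
move=> M0 i1 i2 mb b0 mN N0 h; rewrite -integralB//.
have mdiff : measurable_fun setT (fun z => (c1 z)%:E - (c2 z)%:E).
  by apply: emeasurable_funB; [case/integrableP : i1|case/integrableP : i2].
apply: (@le_trans _ _ (\int[mu]_z (fun z => (c1 z)%:E - (c2 z)%:E)^\+ z)).
  rewrite [leLHS]integralE -[leRHS]sube0; apply: leeB => //.
  exact: integral_ge0.
have mbE : measurable_fun setT (fun z => (b z)%:E) by exact/measurable_EFinP.
rewrite -ge0_integralZl//; last by move=> z _; rewrite lee_fin.
apply: ae_ge0_le_integral => //.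
- exact: measurable_funepos.
- by move=> z _; rewrite mule_ge0 ?lee_fin.
- exact: emeasurable_funM.
exists N; split => // z /= h'; apply: contrapT => Nz; apply: h' => _.
rewrite funeposE -EFinB -EFinM -EFin_max lee_fin ge_max h//=.
by rewrite mulr_ge0.
Qed.

End dominated_integrals.

Section generator_comparison.
Context {R : realType} {n : nat}.
Local Notation V := 'rV[R]_n.+1.
Variable Phi : R -> R.
Hypothesis Phi_ge0 : forall r : R, 0 <= r -> 0 <= Phi r.
Hypothesis mPhi : measurable_fun (`[0, +oo[ : set R) Phi.
Variable beta : {measure set R -> \bar R}.
Hypothesis kappa_fin : (kappa1 beta < +oo)%E.
Local Notation X := (V * V)%type.
Variable G : probability X R.
Variable phi : V -> R.
Hypothesis lip_phi : forall x y : V, `|phi x - phi y| <= enorm (x - y).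

Local Notation mobility := (@mobility R n beta).
Implicit Types (x y : X) (z : X * X).

(* [mu] is the product of [G] with itself, known through these three properties. *)
Variable mu : {measure set (X * X) -> \bar R}.
Hypothesis mu_tonelli : forall h : X * X -> \bar R, measurable_fun setT h ->
  (forall z, 0 <= h z)%E ->
  (\int[mu]_z h z = \int[G]_x \int[G]_y h (x, y))%E /\
  (\int[mu]_z h z = \int[G]_x \int[G]_y h (y, x))%E.
Hypothesis mu_fubini : forall h : X * X -> \bar R, mu.-integrable setT h ->
  (\int[G]_x \int[G]_y h (x, y) = \int[mu]_z h z)%E.
Hypothesis mu_null : forall N : set X, measurable N -> G N = 0%E ->
  mu (N `*` setT) = 0%E.

Let Phi1 z : R := Phi (enorm (z.1.1 - z.2.1)).
Let Phi2 z : R := Phi (enorm (z.1.2 - z.2.2)).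
Let both z : R := Num.min (Phi1 z) (Phi2 z) * enorm (z.1.1 - z.1.2).
Let both' z : R := Num.min (Phi1 z) (Phi2 z) * enorm (z.2.1 - z.2.2).
Let alone z : R :=
  Num.max (Phi1 z - Phi2 z) 0 * enorm (z.1.1 - z.2.1) +
  Num.max (Phi2 z - Phi1 z) 0 * enorm (z.1.2 - z.2.2).

Let Phi10 z : 0 <= Phi1 z. Proof. exact: Phi_enorm_ge0. Qed.
Let Phi20 z : 0 <= Phi2 z. Proof. exact: Phi_enorm_ge0. Qed.
Let min0 z : 0 <= Num.min (Phi1 z) (Phi2 z).
Proof. by rewrite le_min Phi10 Phi20. Qed.
Let both0 z : 0 <= both z. Proof. by rewrite mulr_ge0 ?enorm_ge0. Qed.
Let both'0 z : 0 <= both' z. Proof. by rewrite mulr_ge0 ?enorm_ge0. Qed.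
Let alone0 z : 0 <= alone z.
Proof. by rewrite addr_ge0// mulr_ge0 ?enorm_ge0// le_max lexx orbT. Qed.

Let m11 : measurable_fun setT (fun z : X * X => z.1.1).
Proof. exact: (measurableT_comp measurable_fst measurable_fst). Qed.
Let m12 : measurable_fun setT (fun z : X * X => z.1.2).
Proof. exact: (measurableT_comp measurable_snd measurable_fst). Qed.
Let m21 : measurable_fun setT (fun z : X * X => z.2.1).
Proof. exact: (measurableT_comp measurable_fst measurable_snd). Qed.
Let m22 : measurable_fun setT (fun z : X * X => z.2.2).
Proof. exact: (measurableT_comp measurable_snd measurable_snd). Qed.

Let mPhi1 : measurable_fun setT Phi1.
Proof. by apply: measurable_Phi_enorm => //; exact: measurable_fun_subrV. Qed.
Let mPhi2 : measurable_fun setT Phi2.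
Proof. by apply: measurable_Phi_enorm => //; exact: measurable_fun_subrV. Qed.
Let mmin : measurable_fun setT (fun z => Num.min (Phi1 z) (Phi2 z)).
Proof. exact: measurable_minr. Qed.
Let mboth : measurable_fun setT both.
Proof.
by apply: measurable_funM => //; apply: measurable_fun_enorm; exact: measurable_fun_subrV.
Qed.
Let mboth' : measurable_fun setT both'.
Proof.
by apply: measurable_funM => //; apply: measurable_fun_enorm; exact: measurable_fun_subrV.
Qed.
Let malone : measurable_fun setT alone.
Proof.
apply: measurable_funD; apply: measurable_funM.
- by apply: measurable_maxr => //; exact: measurable_funB.
- by apply: measurable_fun_enorm; exact: measurable_fun_subrV.
- by apply: measurable_maxr => //; exact: measurable_funB.
- by apply: measurable_fun_enorm; exact: measurable_fun_subrV.
Qed.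

Let gain1 z : R := Phi1 z * deviation beta phi z.1.1 z.2.1.
Let gain2 z : R := Phi2 z * deviation beta phi z.1.2 z.2.2.

Let mgain1 : measurable_fun setT gain1.
Proof.
apply: measurable_funM => //.
apply: (measurableT_comp (measurable_deviation kappa_fin lip_phi)
  (g := fun z : X * X => (z.1.1, z.2.1))).
by apply/measurable_fun_pairP; split.
Qed.

Let mgain2 : measurable_fun setT gain2.
Proof.
apply: measurable_funM => //.
apply: (measurableT_comp (measurable_deviation kappa_fin lip_phi)
  (g := fun z : X * X => (z.1.2, z.2.2))).
by apply/measurable_fun_pairP; split.
Qed.

(** The common part of the two collision rates lets both pairs collide together,
    which costs only [deviation_sub_le]; what one rate has in excess is charged
    at the full price [abs_deviation]. *)
Let gain_sub_le z : phi z.1.1 - phi z.1.2 = enorm (z.1.1 - z.1.2) ->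
  gain1 z - gain2 z <= mobility * (2 * both z + 2 * both' z + alone z).
Proof.
move=> tight.
have hI := deviation_sub_le kappa_fin lip_phi z.2.1 z.2.2 tight.
have h1 := abs_deviation kappa_fin lip_phi z.1.1 z.2.1.
have h2 := abs_deviation kappa_fin lip_phi z.1.2 z.2.2.
rewrite /gain1 /gain2 /both /both' /alone /mobility.
move: hI h1 h2 (Phi10 z) (Phi20 z).
set I1 := deviation _ _ _ _; set I2 := deviation _ _ _ _.
set k := kappa beta; set s := sphere_area.
set r1 := enorm (z.1.1 - z.2.1); set r2 := enorm (z.1.2 - z.2.2).
set dx := enorm (z.1.1 - z.1.2); set dy := enorm (z.2.1 - z.2.2).
set p := Phi1 z; set q := Phi2 z => hI.
rewrite ler_norml => /andP[h1l h1u]; rewrite ler_norml => /andP[h2l h2u] p0 q0.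
have dec : p * I1 - q * I2 = Num.min p q * (I1 - I2) +
    Num.max (p - q) 0 * I1 - Num.max (q - p) 0 * I2.
  case: (leP p q) => pq.
    rewrite (max_idPr _) ?subr_le0// (max_idPl _) ?subr_ge0//; ring.
  rewrite (max_idPl _) ?subr_ge0 ?(ltW pq)// (max_idPr _) ?subr_le0 ?(ltW pq)//; ring.
rewrite dec.
have a0 : 0 <= Num.min p q by rewrite le_min p0 q0.
have b0 : 0 <= Num.max (p - q) 0 by rewrite le_max lexx orbT.
have c0 : 0 <= Num.max (q - p) 0 by rewrite le_max lexx orbT.
have e1 := ler_wpM2l a0 hI; have e2 := ler_wpM2l b0 h1u; have e3 := ler_wpM2l c0 h2l.
apply: (@le_trans _ _ (Num.min p q * (k * s * (dx + dy)) +
   Num.max (p - q) 0 * (k * (s / 2) * r1) + Num.max (q - p) 0 * (k * (s / 2) * r2))).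
  lra.
by rewrite le_eqVlt; apply/orP; left; apply/eqP; field.
Qed.

Local Open Scope ereal_scope.

Let ge0_integral_swap (h : X * X -> R) : measurable_fun setT h ->
  (forall z, (0 <= h z)%R) ->
  \int[mu]_z (h z)%:E = \int[G]_x \int[G]_y (h (x, y))%:E /\
  \int[mu]_z (h z)%:E = \int[G]_x \int[G]_y (h (y, x))%:E.
Proof.
move=> mh h0; apply: (mu_tonelli (h := EFin \o h)); first exact/measurable_EFinP.
by move=> z; rewrite lee_fin.
Qed.

Let both_sym : \int[mu]_z (both' z)%:E = \int[mu]_z (both z)%:E.
Proof.
have [_ ->] := ge0_integral_swap mboth' both'0.
have [-> _] := ge0_integral_swap mboth both0.
apply: eq_integral => x _; apply: eq_integral => y _; congr EFin.
by rewrite /both' /both /Phi1 /Phi2 /= (enormBC y.1) (enormBC y.2).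
Qed.

Definition mismatch z : R :=
  (8 * Num.min (Phi (enorm (z.1.1 - z.2.1))) (Phi (enorm (z.1.2 - z.2.2))) *
     enorm (z.1.1 - z.1.2)
   + Num.max (Phi (enorm (z.1.1 - z.2.1)) - Phi (enorm (z.1.2 - z.2.2))) 0 *
     enorm (z.1.1 - z.2.1)
   + Num.max (Phi (enorm (z.1.2 - z.2.2)) - Phi (enorm (z.1.1 - z.2.1))) 0 *
     enorm (z.1.2 - z.2.2))%R.

Let mismatchE z : mismatch z = (8 * both z + alone z)%R.
Proof. by rewrite /mismatch /both /alone !mulrA addrA. Qed.

Let mmismatch : measurable_fun setT mismatch.
Proof.
rewrite (_ : mismatch = fun z => (8 * both z + alone z)%R); last exact/funext.
apply: measurable_funD; last exact: malone.
by apply: measurable_funM; [exact: measurable_cst|exact: mboth].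
Qed.

Lemma mismatch_ge0 z : (0 <= mismatch z)%R.
Proof. by rewrite mismatchE; exact: (addr_ge0 (mulr_ge0 (ler0n _ 8) (both0 z)) (alone0 z)). Qed.

Let bound z : R := (2 * both z + 2 * both' z + alone z)%R.

Let mbound : measurable_fun setT bound.
Proof.
apply: measurable_funD; last exact: malone.
apply: measurable_funD; apply: measurable_funM; first exact: measurable_cst.
- exact: mboth.
- exact: measurable_cst.
- exact: mboth'.
Qed.

Let bound0 z : (0 <= bound z)%R.
Proof.
exact: (addr_ge0 (addr_ge0 (mulr_ge0 (ler0n _ 2) (both0 z))
  (mulr_ge0 (ler0n _ 2) (both'0 z))) (alone0 z)).
Qed.

Let integral_bound :
  \int[mu]_z (bound z)%:E <= \int[G]_x \int[G]_y (mismatch (x, y))%:E.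
Proof.
have [<- _] := ge0_integral_swap mmismatch mismatch_ge0.
have E : \int[mu]_z (mismatch z)%:E = \int[mu]_z (8 * both z + alone z)%:E.
  by apply: eq_integral => z _; rewrite mismatchE.
rewrite E; exact: (integral_weights malone mboth mboth' alone0 both0 both'0 both_sym).
Qed.

Let mrate1 : measurable_fun setT (fun z : X * X => rate Phi z.1.1 z.2.1).
Proof.
apply: measurable_funM; first exact: mPhi1.
by apply: measurable_fun_enorm; exact: (measurable_fun_subrV m11 m21).
Qed.

Let mrate2 : measurable_fun setT (fun z : X * X => rate Phi z.1.2 z.2.2).
Proof.
apply: measurable_funM; first exact: mPhi2.
by apply: measurable_fun_enorm; exact: (measurable_fun_subrV m12 m22).
Qed.

Let gain1_le z : (`|gain1 z| <= mobility * rate Phi z.1.1 z.2.1)%R.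
Proof.
have := abs_collision Phi_ge0 kappa_fin z.1.1 z.2.1 lip_phi.
by rewrite collision_opE.
Qed.

Let gain2_le z : (`|gain2 z| <= mobility * rate Phi z.1.2 z.2.2)%R.
Proof.
have := abs_collision Phi_ge0 kappa_fin z.1.2 z.2.2 lip_phi.
by rewrite collision_opE.
Qed.

Lemma generator_sub_le_product (N : set X) (l lt : R) : measurable N -> G N = 0 ->
  (forall x, ~ N x -> (phi x.1 - phi x.2 = enorm (x.1 - x.2))%R) ->
  \int[G]_x \int[G]_y (rate Phi x.1 y.1)%:E < +oo ->
  \int[G]_x \int[G]_y (rate Phi x.2 y.2)%:E < +oo ->
  l%:E = \int[G]_x \int[G]_y collision_op Phi beta phi x.1 y.1 ->
  lt%:E = \int[G]_x \int[G]_y collision_op Phi beta phi x.2 y.2 ->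
  (l - lt)%:E <= mobility%:E * \int[G]_x \int[G]_y (mismatch (x, y))%:E.
Proof.
move=> mN N0 tight fin1 fin2 lE ltE; have mob0 := mobility_ge0 beta (n := n).
have r10 (z : X * X) : (0 <= rate Phi z.1.1 z.2.1)%R by exact: rate_ge0.
have r20 (z : X * X) : (0 <= rate Phi z.1.2 z.2.2)%R by exact: rate_ge0.
have [E1 _] := ge0_integral_swap mrate1 r10.
have [E2 _] := ge0_integral_swap mrate2 r20.
rewrite -E1 in fin1; rewrite -E2 in fin2.
have i1 := dominated_integrable mob0 mgain1 mrate1 r10 gain1_le fin1.
have i2 := dominated_integrable mob0 mgain2 mrate2 r20 gain2_le fin2.
have l1 : l%:E = \int[mu]_z (gain1 z)%:E.
  rewrite lE -(mu_fubini i1); apply: eq_integral => x _; apply: eq_integral => y _.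
  by rewrite collision_opE.
have l2 : lt%:E = \int[mu]_z (gain2 z)%:E.
  rewrite ltE -(mu_fubini i2); apply: eq_integral => x _; apply: eq_integral => y _.
  by rewrite collision_opE.
rewrite EFinB l1 l2.
have mNT : measurable (N `*` [set: X]) by exact: measurableX.
apply: (le_trans (integral_sub_le mob0 i1 i2 mbound bound0 mNT (mu_null mN N0) _)).
  by move=> z Nz; exact: (gain_sub_le (tight z.1 (fun Nz1 => Nz (conj Nz1 I)))).
by apply: lee_wpmul2l; [rewrite lee_fin|exact: integral_bound].
Qed.

End generator_comparison.

(** This is the integrated form of the comparison of two colliding pairs.
    Exchanging the two pairs shows that the distances of their members have the
    same integral against the common part of the collision rates. *)
Lemma generator_sub_le (R : realType) (n : nat) (Phi : R -> R)
    (beta : {measure set R -> \bar R})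
    (G : probability ('rV[R]_n.+1 * 'rV[R]_n.+1)%type R)
    (phi : 'rV[R]_n.+1 -> R) (N : set ('rV[R]_n.+1 * 'rV[R]_n.+1)) (l lt : R) :
  (forall r : R, 0 <= r -> 0 <= Phi r)%R ->
  measurable_fun (`[0%R, +oo[ : set R) Phi -> (kappa1 beta < +oo)%E ->
  (forall x y, (`|phi x - phi y| <= enorm (x - y))%R) ->
  measurable N -> G N = 0%E ->
  (forall x, ~ N x -> (phi x.1 - phi x.2 = enorm (x.1 - x.2))%R) ->
  (\int[G]_x \int[G]_y (rate Phi x.1 y.1)%:E < +oo)%E ->
  (\int[G]_x \int[G]_y (rate Phi x.2 y.2)%:E < +oo)%E ->
  (l%:E = \int[G]_x \int[G]_y collision_op Phi beta phi x.1 y.1)%E ->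
  (lt%:E = \int[G]_x \int[G]_y collision_op Phi beta phi x.2 y.2)%E ->
  ((l - lt)%:E <= (@mobility R n beta)%:E *
    \int[G]_x \int[G]_y (mismatch Phi (x, y))%:E)%E.
Proof.
move=> Phi_ge0 mPhi kappa_fin lip mN N0 tight.
apply: (@generator_sub_le_product R n Phi Phi_ge0 mPhi beta kappa_fin G phi lip
  (G \x G)%E _ _ _ N) => //.
- move=> h mh h0; split; first exact: (fubini_tonelli1 h mh h0).
  exact: (etrans (fubini_tonelli1 h mh h0) (fubini_tonelli h mh h0)).
- by move=> h ih; exact: integral12_prod_meas1.
- move=> M mM M0; have := product_measure1E G G mM measurableT.
  by rewrite [X in (X * _)%E]M0 mul0e.
Qed.

(** * Left derivative of the distance *)

Section distance_derivative.
Context {R : realType} {n : nat}.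
Local Notation V := 'rV[R]_n.+1.
Variables (T : R) (Phi : R -> R).
Hypothesis T_gt0 : 0 < T.
Hypothesis Phi_ge0 : forall r : R, 0 <= r -> 0 <= Phi r.
Hypothesis mPhi : measurable_fun (`[0, +oo[ : set R) Phi.
Variable beta : {measure set R -> \bar R}.
Hypothesis kappa_fin : (kappa1 beta < +oo)%E.
Variables (f ft : R -> probability V R) (G : R -> probability (V * V)%type R).
Hypothesis wf : weak_solution T Phi beta f.
Hypothesis wft : weak_solution T Phi beta ft.
Hypothesis G_opt : forall s, s \in `[0, T] -> coupling (f s) (ft s) (G s) /\
  (d1 (f s) (ft s) = \int[G s]_x (enorm (x.1 - x.2)%R)%:E)%E.

Local Notation mobility := (@mobility R n beta).
Local Notation lip1 phi := (forall x y : V, `|phi x - phi y| <= enorm (x - y)).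
Local Notation mean_rate := (@mean_rate R n Phi).
Local Notation stopped := (@stopped R n T).
Local Notation distance := (distance f ft).
Local Notation total_rate := (total_rate T Phi beta f ft).
Local Notation mu := (@lebesgue_measure R).

Lemma integrable_mean_rate g : weak_solution T Phi beta g ->
  mu.-integrable `[0, T] (mean_rate (stopped g)).
Proof.
move=> [gP gfin _]; apply/integrableP; split.
  by apply: measurable_funTS; exact: measurable_mean_rate.
apply: le_lt_trans gfin; rewrite le_eqVlt; apply/orP; left; apply/eqP.
apply: eq_integral => t; rewrite inE => tT.
by rewrite gee0_abs ?mean_rate_ge0// mean_rate_stopped.
Qed.

Lemma integrable_total_rate : mu.-integrable `[0, T] total_rate.
Proof.
apply: integrableD => //.
  by apply: integrableZl => //; exact: integrable_mean_rate.
by apply: integrableZl => //; exact: integrable_mean_rate.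
Qed.

Let rate_fun t : R := fine (total_rate t).

Let rate_funE a b : 0 <= a -> b <= T ->
  mu.-integrable `[a, b] (EFin \o rate_fun) /\
  (\int[mu]_(t in `[a, b]) total_rate t = \int[mu]_(t in `[a, b]) (rate_fun t)%:E)%E.
Proof.
move=> a0 bT; have sub : `[a, b]%classic `<=` `[0, T]%classic.
  by apply: subset_itv; rewrite bnd_simp.
have itot : mu.-integrable `[a, b] total_rate.
  by apply: integrableS integrable_total_rate.
have mtot := measurable_total_rate Phi_ge0 mPhi wf wft.
have mrf : measurable_fun setT (EFin \o rate_fun).
  by apply/measurable_EFinP; exact: measurableT_comp.
have E : ae_eq mu `[a, b]%classic total_rate (EFin \o rate_fun).
  have := @integrable_ae _ _ _ mu _ (measurable_itv _) _ itot; apply: filterS => t h tab.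
  by rewrite /= /rate_fun fineK//; exact: h.
split.
  apply: (le_integrable _ _ _ itot) => //; first exact: measurable_funTS.
  by move=> t _; rewrite /= /rate_fun; case: (total_rate t) => [r||] /=; rewrite ?normr0 ?lexx ?leey.
by apply: ae_eq_integral => //; exact: measurable_funTS.
Qed.

Let primitive x : R := parameterized_integral mu 0 x rate_fun.

Let distance_le_primitive a b : 0 <= a -> a <= b -> b <= T ->
  `|distance b - distance a| <= primitive b - primitive a.
Proof.
move=> a0 ab bT.
have [i0b _] := rate_funE (lexx 0) bT.
have [iab E] := rate_funE a0 bT.
have := distance_growth Phi_ge0 mPhi kappa_fin wf wft G_opt a0 ab bT.
rewrite E => h; rewrite -lee_fin; apply: (le_trans h).
rewrite le_eqVlt; apply/orP; left; apply/eqP.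
rewrite /primitive /parameterized_integral Rintegral_itvB//.
rewrite Rintegral_itv_obnd_cbnd; last first.
  by apply: integrableS iab => //; apply: subset_itvr; rewrite bnd_simp.
by rewrite /Rintegral fineK//; exact: integrable_fin_num.
Qed.

Let clamp (t : R) : R := Num.max 0 (Num.min t T).

Let clamp_in t : clamp t \in `[0, T].
Proof.
rewrite in_itv /= /clamp le_max lexx /= ge_max (ltW T_gt0) ge_min lexx orbT//.
Qed.

Let clamp_id t : t \in `[0, T] -> clamp t = t.
Proof. by rewrite in_itv /= /clamp => /andP[t0 tT]; rewrite (min_idPl tT) (max_idPr t0). Qed.

Let clamp_lipschitz s t : `|clamp s - clamp t| <= `|s - t|.
Proof.
rewrite /clamp; have T0 := T_gt0.
case: (leP s T) => ?; case: (leP t T) => ?; rewrite ?(max_idPr (ltW T0));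
  case: (leP 0 s) => ?; case: (leP 0 t) => ?;
  rewrite ler_norml; case: (ger0P (s - t)) => ?; apply/andP; split; lra.
Qed.

(** The distance is extended to the whole line in order to be continuous and to
    have a left derivative there. *)
Definition clamped_distance (t : R) : R := distance (clamp t).

Lemma clamped_distance_id t : t \in `[0, T] -> clamped_distance t = distance t.
Proof. by move=> tT; rewrite /clamped_distance clamp_id. Qed.

Lemma continuous_clamped_distance : continuous clamped_distance.
Proof.
have [i0T _] := rate_funE (lexx 0) (lexx T).
have := parameterized_integral_continuous (ltW T_gt0) i0T.
move=> /subspace_continuousP cP t.
apply/cvgrPdist_le => e e0.
have /cvgrPdist_le /(_ e e0) := cP (clamp t) (clamp_in t).
rewrite near_withinE => /nbhs_ballP[del /= del0 hdel].
apply/nbhs_ballP; exists del => //= s ts.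
have cts : ball (clamp t) del (clamp s).
  by rewrite /ball /=; apply: le_lt_trans ts; exact: clamp_lipschitz.
have := hdel _ cts (clamp_in s).
have := clamp_in s; have := clamp_in t; rewrite !in_itv /= => /andP[t0 tT] /andP[s0 sT].
have [st|ts'] := leP (clamp s) (clamp t).
  move=> h; apply: (le_trans (distance_le_primitive s0 st tT)).
  exact: le_trans (ler_norm _) h.
move=> h; rewrite distrC; apply: (le_trans (distance_le_primitive t0 (ltW ts') sT)).
by rewrite distrC in h; exact: le_trans (ler_norm _) h.
Qed.

Lemma left_dini_at0 : (left_dini clamped_distance 0 <= 0)%E.
Proof.
apply: (@left_dini_le _ _ _ _ 1) => // q /andP[q0 _].
rewrite /clamped_distance mul0r sub0r.
have -> : clamp (- q) = 0.
  have T0 := T_gt0; have qT : - q <= T by lra.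
  by rewrite /clamp (min_idPl qT); apply/max_idPl; rewrite oppr_le0 ltW.
have -> : clamp 0 = 0 by rewrite clamp_id// in_itv /= lexx ltW.
by rewrite subrr.
Qed.

(** With [phi] an optimal potential at time [t], the difference of its means
    bounds the distance from below at earlier times and equals it at time [t]. *)
Lemma left_dini_potential t : 0 < t <= T -> exists (phi : V -> R) (l lt : R),
  [/\ lip1 phi,
   exists N : set (V * V), [/\ measurable N, G t N = 0%E &
     forall x, ~ N x -> phi x.1 - phi x.2 = enorm (x.1 - x.2)],
   (l%:E = \int[f t]_v \int[f t]_w collision_op Phi beta phi v w)%E,
   (lt%:E = \int[ft t]_v \int[ft t]_w collision_op Phi beta phi v w)%E &
   (left_dini clamped_distance t <= (l - lt)%:E)%E].
Proof.
move=> /andP[t0 tT].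
have tI : t \in `[0, T] by rewrite in_itv /= ltW.
have [phi [lip eqt tight]] := distance_dual_eq wf wft G_opt tI.
have [l [lE _ fol]] := weak_solution_derivative Phi_ge0 mPhi kappa_fin wf lip tI.
have [lt [ltE _ folt]] := weak_solution_derivative Phi_ge0 mPhi kappa_fin wft lip tI.
exists phi, l, lt; split => //.
apply/lee_addgt0Pr => eta eta0; rewrite -EFinD.
have [del del0 hdel] := first_order_left (first_orderB fol folt) eta0.
apply: (@left_dini_le _ _ _ _ (Num.min del t)); first by rewrite lt_min del0.
move=> q /andP[q0]; rewrite lt_min => /andP[qdel qt].
have sI : t - q \in `[0, T].
  by rewrite in_itv /=; apply/andP; split; lra.
have := hdel _ sI; rewrite subKr => /(_ ltac:(by apply/andP; split; lra)).
rewrite !clamped_distance_id// => h; apply: le_trans h.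
rewrite eqt lerD2l lerN2; exact: (distance_dual_le wf wft G_opt sI lip).
Qed.

Lemma left_dini_le_mismatch t : t \in `[0, T] ->
  (mean_rate f t < +oo)%E -> (mean_rate ft t < +oo)%E ->
  (left_dini clamped_distance t <=
    mobility%:E * \int[G t]_x \int[G t]_y (mismatch Phi (x, y))%:E)%E.
Proof.
move=> tI kf kft.
have mis0 := @mismatch_ge0 R n Phi Phi_ge0.
have rhs0 : (0 <= mobility%:E * \int[G t]_x \int[G t]_y (mismatch Phi (x, y))%:E)%E.
  rewrite mule_ge0// ?lee_fin ?mobility_ge0//.
  by apply: integral_ge0 => x _; apply: integral_ge0 => y _; rewrite lee_fin.
have [t00|t0] := eqVneq t 0.
  by apply: le_trans rhs0; rewrite t00; exact: left_dini_at0.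
have tpos : 0 < t <= T.
  by move: (tI); rewrite in_itv /= => /andP[t0' ->]; rewrite lt0r t0 t0'.
have [phi [l [lt [lip [N [mN N0 tight]] lE ltE le_dini]]]] := left_dini_potential tpos.
apply: (le_trans le_dini).
have mr := @measurable_rate R n Phi mPhi.
have mrv (P : probability V R) : measurable_fun setT (fun v => \int[P]_w (rate Phi v w)%:E)%E.
  apply: (@measurable_fun_fubini_tonelli_F _ _ _ _ _ P
    (fun z : V * V => (rate Phi z.1 z.2)%:E)).
    exact/measurable_EFinP.
  by move=> z; rewrite lee_fin rate_ge0.
have mrw (v : V) : measurable_fun setT (fun w => (rate Phi v w)%:E).
  by apply/measurable_EFinP; exact: (measurableT_comp mr (pair1_measurable v)).
have mc := measurable_collision mPhi kappa_fin lip.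
have mcw (v : V) : measurable_fun setT (fun w => collision_op Phi beta phi v w).
  exact: (measurableT_comp mc (pair1_measurable v)).
have mcv P := measurable_mean_collision mPhi kappa_fin P lip.
apply: (generator_sub_le Phi_ge0 mPhi kappa_fin lip mN N0 tight).
- move: kf; rewrite /mean_rate (integral_fst G_opt tI (mrv _)).
  under eq_integral do rewrite (integral_fst G_opt tI (mrw _)).
  by [].
- move: kft; rewrite /mean_rate (integral_snd G_opt tI (mrv _)).
  under eq_integral do rewrite (integral_snd G_opt tI (mrw _)).
  by [].
- rewrite lE (integral_fst G_opt tI (mcv _)).
  by under eq_integral do rewrite (integral_fst G_opt tI (mcw _)).
- rewrite ltE (integral_snd G_opt tI (mcv _)).
  by under eq_integral do rewrite (integral_snd G_opt tI (mcw _)).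
Qed.

Lemma distance_le_mismatch t : t \in `[0, T] ->
  ((distance t - distance 0)%:E <= mobility%:E *
   \int[mu]_(s in `[0%R, t]) \int[G s]_x \int[G s]_y (mismatch Phi (x, y))%:E)%E.
Proof.
move=> tI; have /andP[t0 tT] : 0 <= t <= T by rewrite in_itv /= in tI.
have zI : 0 \in `[0, T] by rewrite in_itv /= lexx (ltW T_gt0).
set g := fun s : R => (\int[G s]_x \int[G s]_y (mismatch Phi (x, y))%:E)%E.
have mis0 := @mismatch_ge0 R n Phi Phi_ge0.
have g0 s : (0 <= g s)%E.
  by apply: integral_ge0 => x _; apply: integral_ge0 => y _; rewrite lee_fin.
pose K s := maxe (left_dini clamped_distance s) 0%E.
have K0 s : (0 <= K s)%E by rewrite le_max lexx orbT.
have mK : measurable_fun setT K.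
  apply: measurable_maxe => //; apply: measurable_left_dini.
  exact: continuous_clamped_distance.
have growth : ((distance t - distance 0)%:E <= \int[mu]_(s in `[0%R, t]) K s)%E.
  rewrite -!clamped_distance_id//; apply: growth_le_integral_dini => //.
    exact: continuous_clamped_distance.
  move=> s /andP[s0 st]; have [|_ [l [lt [_ _ _ _ h]]]] := @left_dini_potential s.
    by rewrite s0 (le_trans st).
  exact: le_lt_trans h (ltry _).
have fin_ae h : weak_solution T Phi beta h ->
    {ae mu, forall s, `[0, T]%classic s -> (mean_rate h s < +oo)%E}.
  move=> wh; have := @integrable_ae _ _ _ mu _ (measurable_itv _) _ (integrable_mean_rate wh).
  apply: filterS => s hs sI; have := hs sI.
  by rewrite mean_rate_stopped// ge0_fin_numE// mean_rate_ge0.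
have [N [mN N0 hN]] : {ae mu, forall s, `[0, T]%classic s ->
    (mean_rate f s < +oo)%E /\ (mean_rate ft s < +oo)%E}.
  move: (fin_ae _ wf) (fin_ae _ wft); apply: filterS2 => [|s h1 h2 sI].
    exact: (ae_filter_ringOfSetsType mu).
  by split; [exact: h1|exact: h2].
(* outside of [N] the collision rates are finite and the mismatch dominates [K];
   [K1] drops the rest *)
pose K1 s := (K s * (\1_(~` N) s)%:E)%E.
have K10 s : (0 <= K1 s)%E by rewrite mule_ge0// lee_fin.
have mK1 : measurable_fun setT K1.
  apply: emeasurable_funM => //; apply/measurable_EFinP.
  by apply: measurable_indic; exact: measurableC.
have KK1 : (\int[mu]_(s in `[0%R, t]) K s = \int[mu]_(s in `[0%R, t]) K1 s)%E.
  apply: ae_eq_integral => //; try exact: measurable_funTS.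
  exists N; split => // s /= hs; apply: contrapT => Ns; apply: hs => _.
  by rewrite /K1 indicE mem_set// mule1.
have K1g s : `[0, t]%classic s -> (K1 s <= mobility%:E * g s)%E.
  rewrite /= in_itv /= => /andP[s0 st]; rewrite /K1 indicE.
  have mg0 : (0 <= mobility%:E * g s)%E by rewrite mule_ge0// lee_fin mobility_ge0.
  case: (boolP (s \in ~` N)) => [|_]; last by rewrite mule0.
  rewrite inE => Ns; rewrite mule1 ge_max mg0 andbT.
  have sI : s \in `[0, T] by rewrite in_itv /= s0 (le_trans st).
  have [h1 h2] : (mean_rate f s < +oo)%E /\ (mean_rate ft s < +oo)%E.
    by apply: contrapT => h; apply: Ns; apply: hN => /(_ sI).
  exact: left_dini_le_mismatch.
apply: (le_trans growth); rewrite KK1.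
have mob0 := @mobility_ge0 R n beta.
have [mob|mob] := eqVneq mobility 0.
  rewrite mob mul0e integral0_eq// => s st; apply/le_anti; rewrite K10 andbT.
  by have := K1g s st; rewrite mob mul0e.
have mobp : 0 < mobility by rewrite lt_neqAle eq_sym mob mob0.
(* the constant is moved on the side of [K1], as [g] need not be measurable *)
have -> : (\int[mu]_(s in `[0%R, t]) K1 s =
    mobility%:E * \int[mu]_(s in `[0%R, t]) (mobility^-1%:E * K1 s))%E.
  rewrite -ge0_integralZl//.
  - by apply: eq_integral => s _; rewrite muleA -EFinM divff// mul1e.
  - by apply: measurable_funTS; exact: emeasurable_funM.
  - by move=> s _; rewrite mule_ge0// lee_fin invr_ge0.
apply: lee_wpmul2l; first by rewrite lee_fin.
apply: ge0_le_lower_integral => s st.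
  by rewrite mule_ge0// lee_fin invr_ge0.
apply: (@le_trans _ _ (mobility^-1%:E * (mobility%:E * g s))%E).
  by apply: lee_wpmul2l; rewrite ?lee_fin ?invr_ge0//; exact: K1g.
by rewrite muleA -EFinM mulVf// mul1e.
Qed.

End distance_derivative.

Local Open Scope ereal_scope.

Theorem theorem2p2 (R : realType) (d : nat) (hd : (2 <= d)%N)
  (T : R) (hT : (0 < T)%R)
  (Phi : R -> R) (Phi_ge0 : forall r : R, (0 <= r)%R -> (0 <= Phi r)%R)
  (mPhi : measurable_fun (`[0%R, +oo[ : set R) Phi)
  (beta : {measure set R -> \bar R}) (hbeta : kappa1 beta < +oo)
  (f ft : R -> probability 'rV[R]_d R)
  (hf : weak_solution T Phi beta f) (hft : weak_solution T Phi beta ft)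
  (hint : \int[lebesgue_measure]_(t in `[0%R, T])
      (\int[f t \x f t]_x ((1 + enorm x.1) * Phi (enorm (x.1 - x.2)%R))%:E +
       \int[ft t \x ft t]_x ((1 + enorm x.1) * Phi (enorm (x.1 - x.2)%R))%:E)
    < +oo)
  (G : R -> probability ('rV[R]_d * 'rV[R]_d)%type R)
  (hG : forall s, s \in `[0%R, T] -> coupling (f s) (ft s) (G s) /\
    d1 (f s) (ft s) = \int[G s]_x (enorm (x.1 - x.2)%R)%:E)
  (t : R) (ht : t \in `[0%R, T]) :
  d1 (f t) (ft t) <= d1 (f 0%R) (ft 0%R) +
    kappa1 beta * (surface_measure d.-1 [set: 'rV[R]_d.-1] * (2^-1)%:E) *
    \int[lebesgue_measure]_(s in `[0%R, t]) \int[G s]_x \int[G s]_y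
      (let r := enorm (x.1 - y.1)%R in
       let rt := enorm (x.2 - y.2)%R in
       8 * Num.min (Phi r) (Phi rt) * enorm (x.1 - x.2)
       + Num.max (Phi r - Phi rt) 0 * r
       + Num.max (Phi rt - Phi r) 0 * rt)%R%:E.
Proof.
(* the collision parameters live in dimension [d.-1], so [d] is made a successor *)
move: f ft hf hft hint G hG; have {hd} -> : d = d.-1.+1 by case: d hd.
move: d.-1 => {}d f ft hf hft _ G hG.
have zI : 0%R \in `[0%R, T] by rewrite in_itv /= lexx (ltW hT).
have main := distance_le_mismatch hT Phi_ge0 mPhi hbeta hf hft hG ht.
rewrite (distanceE hf hft hG ht) (distanceE hf hft hG zI).
rewrite -leeBlDl// -EFinB; apply: (le_trans main).
by rewrite kappaE// sphere_areaE -!EFinM.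
Qed.
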